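(* Assume that $(A,B,C,k)$ satisfies Assumption (WC) with $k\geq 1$ and let $S$ be a subset of $\mathbf{N}^2$. Let $\delta>0$ be such that $S$ is a weakly non-degenerate chain of connectedness of $(A,B+\delta C,0)$. Then, for every $\varepsilon>0$ and for every $p,q\in\mathbf{N}$, there exist $T_\varepsilon>0$ and a piecewise constant function $u_\varepsilon:[0,T_\varepsilon]\to\{0,\delta\}$ such that $$\|\Upsilon^{u_\varepsilon,(A,B,C)}_{T_\varepsilon,0}\phi_p-\phi_q\|_r<\varepsilon,$$ for every $r<k/2$.
   Context: $H$ is a separable (complex) Hilbert space with Hermitian product $\langle\cdot,\cdot\rangle$ and norm $\|\cdot\|$; $\mathbf{N}=\{1,2,\dots\}$. Assumption (WC) on $(A,B,C,k)$: $k$ is a positive number and $(A,B,C)$ is a triple of (possibly unbounded) linear operators in $H$ such that (1) $A$ with domain $D(A)$ is skew-adjoint, with pure point spectrum $(-\mathrm{i}\lambda_j)_{j\in\mathbf{N}}$ with $\lambda_{j+1}>\lambda_j>0$ for every $j$ and $\lim_{j\to\infty}\lambda_j=\infty$; (2) for every $(u_1,u_2)\in\mathbf{R}^2$, $A+u_1B+u_2C$ is skew-adjoint with domain $D(A)$; (3) for every $(u_1,u_2)\in\mathbf{R}^2$, $|A+u_1B+u_2C|^{k/2}$ has domain $D(|A|^{k/2})$; (4) $\displaystyle\sup_{\psi\in D(|A|^k)\setminus\{0\}}\left(\frac{|\Re\langle|A|^k\psi,B\psi\rangle|}{|\langle|A|^k\psi,\psi\rangle|}+\frac{|\Re\langle|A|^k\psi,C\psi\rangle|}{|\langle|A|^k\psi,\psi\rangle|}\right)<+\infty$;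 (5) there exist $d>0$ and $0\leq r<k$ such that $\|B\psi\|\leq d\||A|^{r/2}\psi\|$ and $\|C\psi\|\leq d\||A|^{r/2}\psi\|$ for every $\psi\in D(|A|^{r/2})$. $(\phi_j)_{j\in\mathbf{N}}$ is a Hilbert basis of $H$ made of eigenvectors of $A$, with $A\phi_j=-\mathrm{i}\lambda_j\phi_j$. For a real number $r$, the $r$-norm is $\|\psi\|_r:=\||A|^r\psi\|$ for $\psi\in D(|A|^r)$. The control system is $\frac{d}{dt}\psi=(A+u(t)B+u^2(t)C)\psi$. A function $u$ is piecewise constant if there is a non-decreasing sequence $(t_j)_j$ tending to $+\infty$ such that $u$ is constant on each $[t_j,t_{j+1})$. For piecewise constant $u$, $t\mapsto\Upsilon^{u,(A,B,C)}_{t,t_0}\psi_0$ is the solution with value $\psi_0$ at time $t_0$ obtained by concatenating the unitary groups $t\mapsto e^{t(A+uB+u^2C)}$. For a triple $(A,\tilde B,\tilde C)$ with $\tilde b_{jl}=\langle\phi_j,\tilde B\phi_l\rangle$ and $\tilde c_{jl}=\langle\phi_j,\tilde C\phi_l\rangle$: a pair $(j,l)\in\mathbf{N}^2$ is a weakly non-degenerate transition of $(A,\tilde B,\tilde C)$ if $|\tilde b_{jl}|+|\tilde c_{jl}|\neq0$ and, for every $m,n\in\mathbf{N}$, $|\lambda_j-\lambda_l|=|\lambda_n-\lambda_m|$ implies $\{j,l\}=\{m,n\}$ or $|\tilde b_{mn}|+|\tilde c_{mn}|=0$ or $\{m,n\}\cap\{j,l\}=\emptyset$. A subset $S$ of $\mathbf{N}^2$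 is a chain of connectedness of $(A,\tilde B,\tilde C)$ if there exists $\alpha\in\mathbf{R}$ such that, for every $m,n\in\mathbf{N}$, there exists a finite sequence $s_1=(s_1^1,s_1^2),\dots,s_h=(s_h^1,s_h^2)$ in $S$ such that $s_1^1=m$, $s_h^2=n$, $s_l^2=s_{l+1}^1$ for $l=1,\dots,h-1$, and $\langle\phi_{s_l^2},(\tilde B+\alpha\tilde C)\phi_{s_l^1}\rangle\neq0$ for $l=1,\dots,h$. It is weakly non-degenerate if every $s\in S$ is a weakly non-degenerate transition of $(A,\tilde B,\tilde C)$.
   Formalization: The control may depend on an arbitrary real lower bound r_0, and the estimate holds for all r with r_0 ≤ r < k/2; one control for all negative r at once is impossible in general when λ_1 < 1, as it would force exact transfer (e.g. q = 1). *)

(* Defs.v *)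
From HB Require Import structures.
From mathcomp Require Import all_boot all_order all_algebra complex.
From mathcomp Require Import all_classical all_reals all_analysis.

Set Implicit Arguments.
Unset Strict Implicit.
Unset Printing Implicit Defensive.

Import Order.TTheory GRing.Theory Num.Theory.
Import numFieldNormedType.Exports.

Local Open Scope classical_set_scope.
Local Open Scope ring_scope.
Local Open Scope complex_scope.

(* Norms over R[i] take their values in R[i]; this is the same norm in R. *)
Definition rnorm (R : realType) (V : normedModType R[i]) (x : V) : R :=
  complex.Re `|x|.

(* The Hermitian product is a [{dot H for Num.conj}]: linear in the FIRST and
   conjugate-linear in the second argument. *)
Definition separable_hilbert (R : realType) (H : completeNormedModType R[i])
    (ip : {dot H for Num.conj}) : Prop :=
  (forall x : H, `|x| ^+ 2 = ip x x) /\
  (exists2 D : set H, countable D & dense D).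

Definition hilbert_basis (R : realType) (H : completeNormedModType R[i])
    (ip : {dot H for Num.conj}) (e : nat -> H) : Prop :=
  (forall i j, ip (e i) (e j) = (i == j)%:R) /\
  (forall x : H, series (fun j => ip x (e j) *: e j) @ \oo --> x).

(* Possibly unbounded operators. The values of [app] outside [dom] are junk. *)
Record linop (R : realType) (H : completeNormedModType R[i]) := Linop {
  dom : set H;
  app :> H -> H;
  dom0 : dom 0;
  domP : forall (a : R[i]) x y, dom x -> dom y -> dom (a *: x + y);
  appP : forall (a : R[i]) x y, dom x -> dom y ->
           app (a *: x + y) = a *: app x + app y }.

HB.instance Definition _ (R : realType) (H : completeNormedModType R[i]) :=
  gen_eqMixin (linop H).
HB.instance Definition _ (R : realType) (H : completeNormedModType R[i]) :=
  gen_choiceMixin (linop H).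

Section operations.
Variables (R : realType) (H : completeNormedModType R[i]).
Implicit Types T : linop H.

Fact addop_domP T1 T2 (a : R[i]) x y : (dom T1 `&` dom T2) x ->
  (dom T1 `&` dom T2) y -> (dom T1 `&` dom T2) (a *: x + y).
Proof. by move=> [? ?] [? ?]; split; exact: domP. Qed.

Fact addop_appP T1 T2 (a : R[i]) x y : (dom T1 `&` dom T2) x ->
  (dom T1 `&` dom T2) y ->
  T1 (a *: x + y) + T2 (a *: x + y) = a *: (T1 x + T2 x) + (T1 y + T2 y).
Proof. by move=> [? ?] [? ?]; rewrite !appP // scalerDr addrACA. Qed.

Definition addop T1 T2 : linop H :=
  @Linop R H (dom T1 `&` dom T2) (fun x => T1 x + T2 x)
    (conj (dom0 T1) (dom0 T2)) (@addop_domP T1 T2) (@addop_appP T1 T2).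

Fact scaleop_appP (c : R[i]) T (a : R[i]) x y : dom T x -> dom T y ->
  c *: T (a *: x + y) = a *: (c *: T x) + c *: T y.
Proof. by move=> ? ?; rewrite appP // scalerDr !scalerA mulrC. Qed.

Definition scaleop (c : R[i]) T : linop H :=
  @Linop R H (dom T) (fun x => c *: T x)
    (dom0 T) (@domP _ _ T) (@scaleop_appP c T).

Fact zero_appP (a : R[i]) (x y : H) : 0 = a *: 0 + 0 :> H.
Proof. by rewrite scaler0 addr0. Qed.

Definition zeroop : linop H :=
  @Linop R H setT (fun _ => 0) I (fun _ _ _ _ _ => I)
    (fun a x y _ _ => zero_appP a x y).

Fact trivialop_domP (a : R[i]) (x y : H) : [set 0] x -> [set 0] y ->
  [set 0] (a *: x + y).
Proof. by move=> -> ->; rewrite scaler0 addr0. Qed.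

Definition trivialop : linop H :=
  @Linop R H [set 0] (fun _ => 0) erefl trivialop_domP
    (fun a x y _ _ => zero_appP a x y).

(* A + u1 B + u2 C, on the intersection of the three domains *)
Definition ctrlop (A B C : linop H) (u1 u2 : R) : linop H :=
  addop A (addop (scaleop u1%:C B) (scaleop u2%:C C)).

End operations.

Section hilbert_operators.
Variables (R : realType) (H : completeNormedModType R[i]).
Variable ip : {dot H for Num.conj}.
Implicit Types (T P : linop H) (E : set (measurableTypeR R) -> H -> H).

(* T is densely defined and its adjoint is -T. *)
Definition skew_adjoint T : Prop :=
  dense (dom T) /\
  forall y z : H,
    (forall x, dom T x -> ip (T x) y = ip x z) <-> (dom T y /\ z = - T y).

Definition eigenbasis T (mu : nat -> R[i]) (e : nat -> H) : Prop :=
  hilbert_basis ip e /\ forall j, dom T (e j) /\ T (e j) = mu j *: e j.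

Definition pure_point_spectrum T (mu : nat -> R[i]) : Prop :=
  exists e, eigenbasis T mu e.

Definition specmeas E (x : H) (F : set (measurableTypeR R)) : \bar R :=
  (complex.Re (ip (E F x) x))%:E.

(* Projection-valued Borel measures on R; idempotence of the [E F] is the case
   [F = G] of [pvm_cap]. *)
Record pvm E : Prop := {
  pvm_linear : forall F, measurable F ->
    forall (a : R[i]) x y, E F (a *: x + y) = a *: E F x + E F y;
  pvm_self_adjoint : forall F, measurable F ->
    forall x y, ip (E F x) y = ip x (E F y);
  pvm_setT : forall x, E setT x = x;
  pvm_cap : forall F G, measurable F -> measurable G ->
    forall x, E (F `&` G) x = E F (E G x);
  pvm_sigma_additive : forall x, semi_sigma_additive (specmeas E x) }.

(* P is the integral of the real function f against E; the quadratic form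
   determines P by polarization, its domain being dense. *)
Definition spectral_integral E (f : R -> R) P : Prop :=
  dom P = [set x | (\int[specmeas E x]_l (f l ^+ 2)%:E < +oo)%E] /\
  forall x, dom P x -> ip (P x) x = (fine (\int[specmeas E x]_l (f l)%:E)%E)%:C.

(* T = i \int l dE(l), i.e. E is the spectral measure of the self-adjoint
   operator -i T. *)
Definition spectral_resolution T E : Prop :=
  pvm E /\ spectral_integral E (fun l => l) (scaleop (- 'i) T).

Definition is_abspow T (s : R) P : Prop :=
  exists2 E, spectral_resolution T E &
             spectral_integral E (fun l => `|l| `^ s) P.

(* |T|^s for skew-adjoint T; for s < 0 it is meaningful only if T is
   injective. By the spectral theorem the default, of domain {0}, is never taken
   when T is skew-adjoint. *)
Definition abspow T (s : R) : linop H :=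
  xget (@trivialop R H) [set P | is_abspow T s P].

Definition sobolev_norm T (s : R) (x : H) : R := rnorm (abspow T s x).

(* The strongly continuous unitary group with generator T; surjectivity of
   the [U t] follows from the group law. *)
Record unitary_group T (U : R -> H -> H) : Prop := {
  ug_linear : forall t (a : R[i]) x y, U t (a *: x + y) = a *: U t x + U t y;
  ug_isometry : forall t x y, ip (U t x) (U t y) = ip x y;
  ug_0 : forall x, U 0 x = x;
  ug_add : forall s t x, U (s + t) x = U s (U t x);
  ug_continuous : forall x, continuous (fun t => U t x);
  ug_generator : forall x y, (dom T x /\ T x = y) <->
    ((fun h : R => (h^-1)%:C *: (U h x - x)) @ 0^' --> y) }.

(* t |-> e^{tT}; by Stone's theorem the default is never taken when T is
   skew-adjoint. *)
Definition expgroup T : R -> H -> H :=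
  xget ((fun _ x => x) : R -> H -> H) [set U | unitary_group T U].

(* Conditions (1)-(5) on (A, B, C, k). The index set {1, 2, ...} is shifted to
   nat. *)
Record WC (A B C : linop H) (k : R) (lambda : nat -> R) : Prop := {
  WC_k : 0 < k;
  WC_skew : skew_adjoint A;
  WC_spectrum : pure_point_spectrum A (fun j => - 'i * (lambda j)%:C);
  WC_lambda_gt0 : forall j, 0 < lambda j;
  WC_lambda_incr : forall j, lambda j < lambda j.+1;
  WC_lambda_oo : lambda @ \oo --> +oo;
  WC_ctrl : forall u1 u2 : R,
    skew_adjoint (ctrlop A B C u1 u2) /\ dom (ctrlop A B C u1 u2) = dom A;
  WC_ctrl_pow : forall u1 u2 : R,
    dom (abspow (ctrlop A B C u1 u2) (k / 2)) = dom (abspow A (k / 2));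
  WC_form : has_ubound
    [set (let Ak := abspow A k in
          `|complex.Re (ip (Ak psi) (B psi))|
              / complex.Re `|ip (Ak psi) psi|
          + `|complex.Re (ip (Ak psi) (C psi))|
              / complex.Re `|ip (Ak psi) psi|)
    | psi in dom (abspow A k) `\ 0];
  WC_bound : exists d r : R, [/\ 0 < d, 0 <= r, r < k &
    forall psi, dom (abspow A (r / 2)) psi ->
      [/\ dom B psi, dom C psi,
          rnorm (B psi) <= d * sobolev_norm A (r / 2) psi &
          rnorm (C psi) <= d * sobolev_norm A (r / 2) psi]] }.

Section transitions.
Variables (lambda : nat -> R) (phi : nat -> H) (B C : linop H).

Let b j l := ip (phi j) (B (phi l)).
Let c j l := ip (phi j) (C (phi l)).

Definition weakly_nondegenerate_transition (s : nat * nat) : Prop :=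
  let: (j, l) := s in
  `|b j l| + `|c j l| != 0 /\
  forall m n : nat, `|lambda j - lambda l| = `|lambda n - lambda m| ->
    [\/ [set j; l] = [set m; n],
        `|b m n| + `|c m n| = 0 |
        [set m; n] `&` [set j; l] = set0].

(* The sequence s_1, ..., s_{h+1} is [s 0, ..., s h], hence is nonempty. *)
Definition connectedness_chain (S : set (nat * nat)) : Prop :=
  exists alpha : R, forall m n : nat,
    exists (h : nat) (s : nat -> nat * nat),
      [/\ forall l, (l <= h)%N -> S (s l),
          (s 0%N).1 = m,
          (s h).2 = n,
          forall l, (l < h)%N -> (s l).2 = (s l.+1).1 &
          forall l, (l <= h)%N ->
            ip (phi (s l).2) (addop B (scaleop alpha%:C C) (phi (s l).1))
              != 0].

Definition weakly_nondegenerate_chain (S : set (nat * nat)) : Prop :=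
  connectedness_chain S /\
  forall s, S s -> weakly_nondegenerate_transition s.

End transitions.

Definition piecewise_constant (u : R -> R) : Prop :=
  exists tau : nat -> R,
    [/\ tau 0%N = 0,
        {homo tau : i j / (i <= j)%N >-> i <= j},
        tau @ \oo --> +oo &
        forall j t, tau j <= t < tau j.+1 -> u t = u (tau j)].

(* psi follows the group of A + v B + v^2 C on each interval on which u is
   constantly v; for piecewise constant u this determines psi on [t0, +oo[. *)
Definition trajectory (A B C : linop H) (u : R -> R) (t0 : R) (psi0 : H)
    (psi : R -> H) : Prop :=
  psi t0 = psi0 /\
  forall s t : R, t0 <= s -> s <= t ->
    (forall x, s <= x < t -> u x = u s) ->
    psi t = expgroup (ctrlop A B C (u s) (u s ^+ 2)) (t - s) (psi s).

Definition Upsilon (A B C : linop H) (u : R -> R) (t t0 : R) (psi0 : H) : H :=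
  xget ((fun _ => psi0) : R -> H) [set psi | trajectory A B C u t0 psi0 psi] t.

End hilbert_operators.

(* Main.v *)
From HB Require Import structures.
Require Import Defs.
From mathcomp Require Import all_boot all_order all_algebra complex.
From mathcomp Require Import all_classical all_reals all_analysis measurable_realfun.
From mathcomp Require Import ring lra.

Set Implicit Arguments.
Unset Strict Implicit.
Unset Printing Implicit Defensive.

Import Order.TTheory GRing.Theory Num.Theory.
Import numFieldNormedType.Exports.

Local Open Scope classical_set_scope.
Local Open Scope ring_scope.
Local Open Scope complex_scope.

(** Two unitary groups are available: the free one, generated by A, which turns
    phi j at the speed lambda j, and the one generated by
    T = A + delta B + delta^2 C. The control is a sequence of short pulses of the
    second group separated by free evolutions. To first order in the pulse
    durations, such a sequence replaces the entry of T between phi n and phi m by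
    its weighted mean over the pulse times s with the phase
    exp (i (lambda m - lambda n) s) (pulses_expand). Take pulses whose spacing is
    commensurable with the period of the gap of a transition (j, l), with weights
    that sample a raised cosine over many periods. The mean then keeps the diagonal
    entries, halves those at the gap and filters out all the others, up to
    arbitrarily high frequency (pulse_filter_small, resonance_residual). By weak
    nondegeneracy the only entry at the gap that is attached to phi j or phi l is
    their coupling. With a waiting time that balances the two diagonal entries, a
    cycle is thus, on the span of phi j and phi l, a phase times a slow rotation
    (cycle_exists); many short cycles make up the quarter turn that sends phi j to
    phi l up to a phase (transition). Composing along the chain of connectedness
    joins any two levels (reachable_chain), and a free evolution of the target
    cancels the last phase (reachable_exact).

    The errors are measured in the norm with weights lambda j ^ (k / 2), which
    controls the r-norms with r0 <= r < k / 2 at once (sobolev_norm_le). This requires that the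
    group of T grow at most exponentially in that norm and have there, on
    eigenvectors, the expected expansion at time 0. Formally the growth bound
    follows from the bound on the real part of the form of B and C against |A|^k.
    To avoid domain questions it is proved for the Galerkin approximations of the
    resolvent equation of T, passes to the resolvent by weak convergence
    (resolvent_wle), and to the group as the limit of implicit Euler schemes
    (ugroup_wle). Polarizing the same form bound shows that T phi j has a finite
    weighted norm (T_phi_wle), whence the expansion (ugroup_phi_expand).

    Two general facts come first. Stone's theorem is proved by resolvents, the
    group being the limit of the implicit Euler schemes (ugroup_unitary,
    unitary_group_unique). And |A|^s is the diagonal operator with entries
    lambda j ^ s in any eigenbasis (abspow_diag), because a spectral measure sees
    an eigenvector as a point mass (eigen_concentrated). *)

(** * Complex numbers, norms and inner products *)

Lemma subrACA (V : zmodType) (a b c d : V) : a - b - (c - d) = a - c - (b - d).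
Proof. by rewrite opprB [in RHS]opprB addrACA [RHS]addrACA [X in _ + X = _]addrC. Qed.

Definition cmod (R : realType) (z : R[i]) : R := complex.Re `|z|.

Section complex_modulus.
Context {R : realType}.
Implicit Types z w : R[i].

Lemma cmodE z : `|z| = (cmod z)%:C.
Proof. by rewrite RRe_real // ger0_real. Qed.

Lemma cmod_ge0 z : 0 <= cmod z.
Proof. by rewrite -lecR -cmodE; exact: normr_ge0. Qed.

Lemma cmod_sqr z : cmod z ^+ 2 = complex.Re z ^+ 2 + complex.Im z ^+ 2.
Proof.
have := add_Re2_Im2 z; rewrite cmodE -rmorphXn /=.
by move=> /(congr1 (@complex.Re R)) /=.
Qed.

Lemma cmodM z w : cmod (z * w) = cmod z * cmod w.
Proof.
apply/eqP; rewrite -(@eqrXn2 _ 2) ?mulr_ge0 ?cmod_ge0 //; apply/eqP.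
rewrite exprMn !cmod_sqr; case: z w => a b [c d] /=; ring.
Qed.

Lemma cmod_Re z : `|complex.Re z| <= cmod z.
Proof. by rewrite -lecR -cmodE; exact: normc_ge_Re. Qed.

Lemma cmodD z w : cmod (z + w) <= cmod z + cmod w.
Proof. by rewrite -lecR rmorphD /= -!cmodE ler_normD. Qed.

Lemma cmodN z : cmod (- z) = cmod z.
Proof. by rewrite /cmod normrN. Qed.

Lemma cmodB z w : cmod (z - w) <= cmod z + cmod w.
Proof. by rewrite -(cmodN w) cmodD. Qed.

Lemma cmod_conj z : cmod (Num.conj z) = cmod z.
Proof. by rewrite /cmod norm_conjC. Qed.

Lemma cmodR (a : R) : cmod a%:C = `|a|.
Proof. by rewrite /cmod normc_def /= expr0n addr0 sqrtr_sqr. Qed.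

Lemma cmod0 : cmod (0 : R[i]) = 0.
Proof. by rewrite /cmod normr0. Qed.

Lemma cmod1 : cmod (1 : R[i]) = 1.
Proof. by rewrite /cmod normr1. Qed.

Lemma cmod_i : cmod ('i : R[i]) = 1.
Proof. by rewrite /cmod normc_def /= expr0n add0r expr1n sqrtr1. Qed.

Lemma cmod_eq0 z : cmod z = 0 -> z = 0.
Proof. by move=> h; apply/eqP; rewrite -normr_eq0 cmodE h. Qed.

Lemma cmodX z n : cmod (z ^+ n) = cmod z ^+ n.
Proof. by elim: n => [|n IH]; rewrite ?expr0 ?cmod1 // !exprS cmodM IH. Qed.

Lemma conjcM z w : Num.conj (z * w) = Num.conj z * Num.conj w.
Proof. exact: rmorphM. Qed.

Lemma conjcN z : Num.conj (- z) = - Num.conj z.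
Proof. exact: rmorphN. Qed.

Lemma conjcD z w : Num.conj (z + w) = Num.conj z + Num.conj w.
Proof. exact: rmorphD. Qed.

Lemma conjc1 : Num.conj 1 = 1 :> R[i].
Proof. exact: rmorph1. Qed.

Lemma conjcr (a : R) : Num.conj a%:C = a%:C.
Proof. by rewrite conj_Creal // complex_real. Qed.

Lemma realCM (a b : R) : (a * b)%:C = a%:C * b%:C.
Proof. exact: rmorphM. Qed.

Lemma realCD (a b : R) : (a + b)%:C = a%:C + b%:C.
Proof. exact: rmorphD. Qed.

Lemma realCB (a b : R) : (a - b)%:C = a%:C - b%:C.
Proof. exact: rmorphB. Qed.

Lemma realCN (a : R) : (- a)%:C = - a%:C.
Proof. exact: rmorphN. Qed.

Lemma Re_conjc z : complex.Re (Num.conj z) = complex.Re z.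
Proof. by case: z. Qed.

Lemma Im_conjc z : complex.Im (Num.conj z) = - complex.Im z.
Proof. by case: z. Qed.

Lemma ReD z w : complex.Re (z + w) = complex.Re z + complex.Re w.
Proof. by case: z w => [? ?] []. Qed.

Lemma ReN z : complex.Re (- z) = - complex.Re z.
Proof. by case: z. Qed.

Lemma ReB z w : complex.Re (z - w) = complex.Re z - complex.Re w.
Proof. by case: z w => [? ?] []. Qed.

Lemma ReZ (a : R) z : complex.Re (a%:C * z) = a * complex.Re z.
Proof. by case: z => x y /=; rewrite mul0r subr0. Qed.

Lemma Re_sum I (r : seq I) (P : pred I) (F : I -> R[i]) :
  complex.Re (\sum_(i <- r | P i) F i) = \sum_(i <- r | P i) complex.Re (F i).
Proof. by elim/big_rec2: _ => [|i y z _ <-]; rewrite ?ReD. Qed.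

Lemma mul_conj_cmod z : z * Num.conj z = (cmod z ^+ 2)%:C.
Proof. by rewrite -normCK cmodE -rmorphXn. Qed.

Lemma le_cmod_sum I (r : seq I) (P : pred I) (F : I -> R[i]) :
  cmod (\sum_(i <- r | P i) F i) <= \sum_(i <- r | P i) cmod (F i).
Proof.
elim/big_rec2: _ => [|i y z _ h]; rewrite ?cmod0 //.
by apply: le_trans (cmodD _ _) _; rewrite lerD2l.
Qed.

Lemma complex_eq_Re_Im z w : complex.Re z = complex.Re w ->
  complex.Im z = complex.Im w -> z = w.
Proof. by case: z w => [? ?] [? ?] /= -> ->. Qed.

Lemma conjci : Num.conj 'i = - 'i :> R[i].
Proof. by apply: complex_eq_Re_Im => /=; rewrite ?oppr0. Qed.

Lemma Re_mulNi z : complex.Re (- 'i * z) = complex.Im z.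
Proof. by case: z => a b /=; ring. Qed.

End complex_modulus.

Lemma inv_natr_small (R : realType) (e : R) : 0 < e ->
  exists n0, forall n, (n0 <= n)%N -> n.+1%:R^-1 < e.
Proof.
move=> e0; exists (Num.bound e^-1) => n hn.
rewrite -(invrK e) ltf_pV2 ?posrE ?invr_gt0 ?invrK //.
apply: (@lt_le_trans _ _ (Num.bound e^-1)%:R).
  by rewrite archi_boundP // invr_ge0 ltW.
by rewrite ler_nat (leq_trans hn).
Qed.

(** Convergence in the real-valued norm, so that the estimates are statements
    about real numbers *)
Definition cvgs (R : realType) (H : completeNormedModType R[i])
    (u : nat -> H) (x : H) : Prop :=
  forall e : R, 0 < e -> exists n0, forall n, (n0 <= n)%N -> rnorm (u n - x) < e.

Section norm.
Context {R : realType} {H : completeNormedModType R[i]}.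
Implicit Types x y z : H.

Lemma rnormE x : `|x| = (rnorm x)%:C.
Proof. by rewrite RRe_real // ger0_real. Qed.

Lemma rnorm_ge0 x : 0 <= rnorm x.
Proof. by rewrite -lecR -rnormE; exact: normr_ge0. Qed.

Lemma rnorm0 : rnorm (0 : H) = 0.
Proof. by rewrite /rnorm normr0. Qed.

Lemma rnorm_eq0 x : rnorm x = 0 -> x = 0.
Proof. by move=> h; apply/eqP; rewrite -normr_eq0 rnormE h. Qed.

Lemma rnormD x y : rnorm (x + y) <= rnorm x + rnorm y.
Proof. by rewrite -lecR rmorphD /= -!rnormE ler_normD. Qed.

Lemma rnormN x : rnorm (- x) = rnorm x.
Proof. by rewrite /rnorm normrN. Qed.

Lemma rnormB x y : rnorm (x - y) <= rnorm x + rnorm y.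
Proof. by rewrite -(rnormN y) rnormD. Qed.

Lemma rnorm_sub x y : rnorm (x - y) = rnorm (y - x).
Proof. by rewrite -rnormN opprB. Qed.

Lemma rnormZ a x : rnorm (a *: x) = cmod a * rnorm x.
Proof. by rewrite {1}/rnorm normrZ rnormE cmodE -rmorphM. Qed.

Lemma rnormZr (a : R) x : rnorm (a%:C *: x) = `|a| * rnorm x.
Proof. by rewrite rnormZ cmodR. Qed.

Lemma rnorm_tri x y z : rnorm (x - z) <= rnorm (x - y) + rnorm (y - z).
Proof. by apply: le_trans (rnormD _ _); rewrite addrA subrK. Qed.

Lemma rnorm_subl x y : rnorm x <= rnorm y + rnorm (x - y).
Proof. by apply: le_trans (rnormD _ _); rewrite addrC subrK. Qed.

Lemma rnorm_sum I (r : seq I) (P : pred I) (F : I -> H) :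
  rnorm (\sum_(i <- r | P i) F i) <= \sum_(i <- r | P i) rnorm (F i).
Proof.
elim/big_rec2: _ => [|i y z _ h]; rewrite ?rnorm0 //.
by apply: le_trans (rnormD _ _) _; rewrite lerD2l.
Qed.

Lemma rnorm_sum_le n (F : 'I_n -> H) M : (forall i, rnorm (F i) <= M) ->
  rnorm (\sum_(i < n) F i) <= n%:R * M.
Proof.
move=> hF; apply: le_trans (rnorm_sum _ _ _) _; rewrite -[n in leRHS]card_ord.
by rewrite mulr_natl -sumr_const; exact: ler_sum.
Qed.

Lemma rnorm_small x : (forall e : R, 0 < e -> rnorm x <= e) -> x = 0.
Proof.
move=> h; apply: rnorm_eq0; apply/eqP; rewrite eq_le rnorm_ge0 andbT.
by apply/ler_addgt0Pr => e e0; rewrite add0r h.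
Qed.

(** Real and complex tolerances give the same limits. *)
Lemma lt_complex_pos (e : R[i]) : 0 < e -> exists2 r : R, 0 < r & e = r%:C.
Proof.
move=> e0; exists (complex.Re e); last by rewrite RRe_real // gtr0_real.
by rewrite -ltcR RRe_real // gtr0_real.
Qed.

Lemma cvgsP (u : nat -> H) x : cvgs u x <-> (u @ \oo --> x).
Proof.
split=> [h|/cvgrPdist_lt h].
  apply/cvgrPdist_lt => e /lt_complex_pos [r r0 ->].
  have [n0 hn] := h r r0; exists n0 => // n /= /hn.
  by rewrite distrC rnormE ltcR.
move=> e e0; have e0' : 0 < e%:C by rewrite ltcR.
have [n0 _ hn] := h _ e0'; exists n0 => n /hn /=.
by rewrite distrC rnormE ltcR.
Qed.

Lemma rnorm_cvgP (X : Type) (F : set_system X) (FF : Filter F) (f : X -> H) y :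
  (f @ F --> y) <-> (forall e : R, 0 < e -> \forall t \near F, rnorm (f t - y) < e).
Proof.
split=> [/cvgrPdist_lt h e e0|h].
  have e0' : 0 < e%:C by rewrite ltcR.
  have := h _ e0'; apply: filterS => t.
  by rewrite distrC rnormE ltcR.
apply/cvgrPdist_lt => e /lt_complex_pos [r r0 ->].
have := h _ r0; apply: filterS => t.
by rewrite distrC rnormE ltcR.
Qed.

Lemma generator_limP (f : R -> H) y :
  ((fun h : R => (h^-1)%:C *: f h) @ 0^' --> y) <->
  (forall e : R, 0 < e -> exists2 d : R, 0 < d &
     forall h, h != 0 -> `|h| < d -> rnorm (f h - h%:C *: y) <= `|h| * e).
Proof.
have E h : h != 0 -> rnorm (f h - h%:C *: y) = `|h| * rnorm (h^-1%:C *: f h - y).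
  move=> h0; rewrite -rnormZr scalerBr scalerA -realCM mulfV // scale1r //.
split=> [/rnorm_cvgP hf e e0|hf].
  have := hf e e0; rewrite /dnbhs near_withinE => /nbhs_norm0P [d d0 hd].
  by exists d => // h h0 hh; rewrite E // ler_wpM2l // ltW //; exact: hd.
apply/rnorm_cvgP => e e0; have e2 : 0 < e / 2 by rewrite divr_gt0.
have [d d0 hd] := hf _ e2; near=> h.
have h0 : h != 0 by near: h; exact: nbhs_dnbhs_neq.
have hh : `|h| < d by near: h; exact: dnbhs0_lt.
have := hd h h0 hh; rewrite E // ler_pM2l ?normr_gt0 // => /le_lt_trans; apply.
by rewrite ltr_pdivrMr // ltr_pMr // ltr1n.
Unshelve. all: by end_near.
Qed.

Lemma cvgs_cauchy (u : nat -> H) :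
  (forall e : R, 0 < e -> exists n0, forall n m, (n0 <= n)%N -> (n0 <= m)%N ->
     rnorm (u n - u m) < e) -> exists x, cvgs u x.
Proof.
move=> h; suff : cvg (u @ \oo) by move=> hc; exists (lim (u @ \oo)); apply/cvgsP.
apply: cauchy_cvg; apply: cauchy_exP => e /lt_complex_pos [r r0 ->].
have [n0 hn] := h r r0; exists (u n0); exists n0 => // n /= h0.
by rewrite -ball_normE /= rnormE ltcR; exact: hn.
Qed.

Lemma cvgs_unique (u : nat -> H) x y : cvgs u x -> cvgs u y -> x = y.
Proof.
move=> hx hy; apply/eqP; rewrite -subr_eq0; apply/eqP/rnorm_small => e e0.
have e2 : 0 < e / 2 by rewrite divr_gt0.
have [n1 h1] := hx _ e2; have [n2 h2] := hy _ e2.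
have := h1 _ (leq_maxl n1 n2); have := h2 _ (leq_maxr n1 n2).
set v := u _ => ha hb; apply: le_trans (rnorm_tri _ v _) _.
by rewrite (rnorm_sub x v); lra.
Qed.

Lemma cvgs_cst x : cvgs (fun=> x) x.
Proof. by move=> e e0; exists 0%N => n _; rewrite subrr rnorm0. Qed.

Lemma cvgsD (u v : nat -> H) x y : cvgs u x -> cvgs v y ->
  cvgs (fun n => u n + v n) (x + y).
Proof. by move=> /cvgsP hu /cvgsP hv; apply/cvgsP; exact: cvgD. Qed.

Lemma cvgsB (u v : nat -> H) x y : cvgs u x -> cvgs v y ->
  cvgs (fun n => u n - v n) (x - y).
Proof. by move=> /cvgsP hu /cvgsP hv; apply/cvgsP; exact: cvgB. Qed.

Lemma cvgsZ (u : nat -> H) x a : cvgs u x -> cvgs (fun n => a *: u n) (a *: x).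
Proof.
move=> hu e e0; have a0 : 0 < 1 + cmod a by rewrite ltr_pwDl ?cmod_ge0.
have [n0 hn] := hu (e / (1 + cmod a)) (divr_gt0 e0 a0).
exists n0 => n /hn; rewrite ltr_pdivlMr // -scalerBr rnormZ; apply: le_lt_trans.
by rewrite mulrC ler_wpM2l ?rnorm_ge0 // lerDr.
Qed.

Lemma cvgs_bound (u : nat -> H) x (b : nat -> R) :
  (forall n, rnorm (u n - x) <= b n) -> b @ \oo --> (0 : R) -> cvgs u x.
Proof.
move=> hu /cvgr0Pnorm_lt hb e e0; have [n0 _ hn] := hb _ e0.
exists n0 => n /hn /=; apply: le_lt_trans; apply: le_trans (hu n) _.
exact: ler_norm.
Qed.

Lemma cvgs_rnorm_le (u : nat -> H) x M n0 :
  (forall n, (n0 <= n)%N -> rnorm (u n) <= M) -> cvgs u x -> rnorm x <= M.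
Proof.
move=> hM hu; apply/ler_addgt0Pr => e e0.
have [n1 hn] := hu _ e0; have := hn _ (leq_maxr n0 n1).
have := hM _ (leq_maxl n0 n1); set v := u _ => h1 h2.
by apply: le_trans (rnorm_subl _ v) _; rewrite (rnorm_sub x); lra.
Qed.

Lemma cvgs_shift (u : nat -> H) k x : cvgs (fun n => u (n + k)%N) x -> cvgs u x.
Proof.
move=> hu e e0; have [n0 hn] := hu e e0; exists (n0 + k)%N => n h.
have -> : n = ((n - k) + k)%N by rewrite subnK // (leq_trans _ h) // leq_addl.
by apply: hn; rewrite leq_subRL ?(leq_trans _ h) ?leq_addl // addnC.
Qed.

End norm.

Section inner_product.
Context {R : realType} {H : completeNormedModType R[i]}.
Context {ip : {dot H for Num.conj}}.
Hypothesis ip_norm : forall x : H, `|x| ^+ 2 = ip x x.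
Implicit Types x y z : H.

Lemma ipC x y : ip x y = Num.conj (ip y x).
Proof. by rewrite hermC expr0 mul1r. Qed.

Lemma ipDl x y z : ip (x + y) z = ip x z + ip y z.
Proof. by rewrite linearDl. Qed.

Lemma ipDr x y z : ip x (y + z) = ip x y + ip x z.
Proof. by rewrite linearDr. Qed.

Lemma ipZl a x y : ip (a *: x) y = a * ip x y.
Proof. by rewrite linearZl_LR. Qed.

Lemma ipZr a x y : ip x (a *: y) = Num.conj a * ip x y.
Proof. by rewrite linearZr_LR. Qed.

Lemma ipZrR (a : R) x y : ip x (a%:C *: y) = a%:C * ip x y.
Proof. by rewrite ipZr conjcr. Qed.

Lemma ipNl x y : ip (- x) y = - ip x y.
Proof. by rewrite linearNl. Qed.

Lemma ipNr x y : ip x (- y) = - ip x y.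
Proof. by rewrite linearNr. Qed.

Lemma ipBl x y z : ip (x - y) z = ip x z - ip y z.
Proof. by rewrite linearBl. Qed.

Lemma ipBr x y z : ip x (y - z) = ip x y - ip x z.
Proof. by rewrite linearBr. Qed.

Lemma ip0l x : ip 0 x = 0.
Proof. by rewrite linear0l. Qed.

Lemma ip0r x : ip x 0 = 0.
Proof. by rewrite linear0r. Qed.

Lemma ip_suml I (r : seq I) (P : pred I) (F : I -> H) y :
  ip (\sum_(i <- r | P i) F i) y = \sum_(i <- r | P i) ip (F i) y.
Proof. by rewrite linear_sumlz. Qed.

Lemma ip_sumr I (r : seq I) (P : pred I) (F : I -> H) y :
  ip y (\sum_(i <- r | P i) F i) = \sum_(i <- r | P i) ip y (F i).
Proof. by rewrite linear_sumr. Qed.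

Lemma Re_ipC x y : complex.Re (ip x y) = complex.Re (ip y x).
Proof. by rewrite ipC Re_conjc. Qed.

Lemma ip_self x : ip x x = (rnorm x ^+ 2)%:C.
Proof. by rewrite -ip_norm rnormE -rmorphXn. Qed.

Lemma rnorm_sqr x : rnorm x ^+ 2 = complex.Re (ip x x).
Proof. by rewrite ip_self. Qed.

Lemma rnormD_sqr x y :
  rnorm (x + y) ^+ 2 = rnorm x ^+ 2 + rnorm y ^+ 2 + 2 * complex.Re (ip x y).
Proof. by rewrite !rnorm_sqr ipDl !ipDr !ReD (Re_ipC y x); ring. Qed.

Lemma rnormB_sqr x y :
  rnorm (x - y) ^+ 2 = rnorm x ^+ 2 + rnorm y ^+ 2 - 2 * complex.Re (ip x y).
Proof. by rewrite rnormD_sqr rnormN ipNr ReN; ring. Qed.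

Lemma cauchy_schwarz x y : cmod (ip x y) <= rnorm x * rnorm y.
Proof.
have [->|/eqP y0] := eqVneq y 0; first by rewrite ip0r cmod0 rnorm0 mulr0.
have n0 : 0 < rnorm y.
  by rewrite lt_def rnorm_ge0 andbT; apply/eqP => /rnorm_eq0.
have := sqr_ge0 (rnorm ((rnorm y ^+ 2)%:C *: x - ip x y *: y)).
rewrite rnormB_sqr rnormZr rnormZ ipZl ipZr ReZ mulrC -[_ * ip x y]mulrC.
rewrite mul_conj_cmod /= => h.
rewrite -(@ler_pXn2r _ 2) ?nnegrE ?cmod_ge0 ?mulr_ge0 ?rnorm_ge0 //.
have y2 : 0 < rnorm y ^+ 2 by rewrite exprn_gt0.
rewrite -subr_ge0 -(@pmulr_rge0 _ (rnorm y ^+ 2)) //.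
move: h; rewrite ger0_norm ?sqr_ge0 //.
lra.
Qed.

Lemma cvgs_ipl (u : nat -> H) x y : cvgs u x -> forall e, 0 < e ->
  exists n0, forall n, (n0 <= n)%N -> cmod (ip (u n) y - ip x y) < e.
Proof.
move=> hu e e0; have y0 : 0 < 1 + rnorm y by rewrite ltr_pwDl ?rnorm_ge0.
have [n0 hn] := hu (e / (1 + rnorm y)) (divr_gt0 e0 y0); exists n0 => n /hn.
rewrite ltr_pdivlMr // -ipBl; apply: le_lt_trans.
by apply: le_trans (cauchy_schwarz _ _) _; rewrite ler_wpM2l ?rnorm_ge0 // lerDr.
Qed.

Lemma ip_cvgs_eq (u v : nat -> H) x y a b : cvgs u x -> cvgs v y ->
  (forall n, ip (u n) a = ip (v n) b) -> ip x a = ip y b.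
Proof.
move=> hu hv huv; apply/eqP; rewrite -subr_eq0; apply/eqP/cmod_eq0.
apply/eqP; rewrite eq_le cmod_ge0 andbT; apply/ler_addgt0Pr => e e0.
have e2 : 0 < e / 2 by rewrite divr_gt0.
have [n1 h1] := cvgs_ipl a hu e2; have [n2 h2] := cvgs_ipl b hv e2.
have := h1 _ (leq_maxl n1 n2); have := h2 _ (leq_maxr n1 n2).
set n := maxn _ _ => ha hb.
have -> : ip x a - ip y b = (ip (v n) b - ip y b) - (ip (u n) a - ip x a).
  by rewrite huv; ring.
by apply: le_trans (cmodB _ _) _; lra.
Qed.

(** By polarization *)
Lemma isometry_ip (f : H -> H) : (forall a x y, f (a *: x + y) = a *: f x + f y) ->
  (forall x, rnorm (f x) = rnorm x) -> forall x y, ip (f x) (f y) = ip x y.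
Proof.
move=> fl fn x y.
have hRe a b : complex.Re (ip (f a) (f b)) = complex.Re (ip a b).
  have := rnormD_sqr (f a) (f b); have := rnormD_sqr a b.
  have <- : f (a + b) = f a + f b by have := fl 1 a b; rewrite !scale1r.
  by rewrite !fn; lra.
apply: complex_eq_Re_Im; first exact: hRe.
have f0 : f 0 = 0 by apply: rnorm_eq0; rewrite fn rnorm0.
have := hRe (- 'i *: x) y.
by rewrite -[- 'i *: x]addr0 fl f0 !addr0 !ipZl !Re_mulNi.
Qed.

(** By the parallelogram law, a sequence in K minimizing the distance to x is a
    Cauchy sequence; at its limit the distance is stationary, which gives
    orthogonality. *)
Lemma orthogonal_projection (K : set H) (x : H) :
  K 0 -> (forall a y z, K y -> K z -> K (a *: y + z)) ->
  (forall u y, (forall n, K (u n)) -> cvgs u y -> K y) ->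
  exists2 y, K y & forall z, K z -> ip (x - y) z = 0.
Proof.
move=> K0 Kl Kc; pose D := [set rnorm (x - y) | y in K].
have Dn : D !=set0 by exists (rnorm (x - 0)), 0.
have Dlb : has_lbound D by exists 0 => _ [y _ <-]; exact: rnorm_ge0.
pose d := inf D.
have dle y : K y -> d <= rnorm (x - y) by move=> Ky; apply: ge_inf => //; exists y.
have d0 : 0 <= d by apply: lb_le_inf => // _ [y _ <-]; exact: rnorm_ge0.
have /choice [u hu] (n : nat) : exists y, K y /\ rnorm (x - y) < d + n.+1%:R^-1.
  have [|_ [y Ky <-] hy] := @inf_adherent _ D n.+1%:R^-1 _ (conj Dn Dlb).
    by rewrite invr_gt0.
  by exists y.
have para (a b : H) : rnorm (a + b) ^+ 2 + rnorm (a - b) ^+ 2 =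
    2 * (rnorm a ^+ 2 + rnorm b ^+ 2) by rewrite rnormD_sqr rnormB_sqr; ring.
have key y z eta : K y -> K z -> 0 <= eta -> rnorm (x - y) <= d + eta ->
    rnorm (x - z) <= d + eta -> rnorm (y - z) ^+ 2 <= 4 * ((d + eta) ^+ 2 - d ^+ 2).
  move=> Ky Kz e0 hy hz; have := para (x - y) (x - z).
  have -> : x - y - (x - z) = z - y by rewrite opprB addrC addrA subrK.
  have -> : x - y + (x - z) = 2%:R%:C *: (x - (2^-1%:C *: y + 2^-1%:C *: z)).
    rewrite scalerBr scalerDr !scalerA -rmorphM mulfV ?pnatr_eq0 // !scale1r.
    by rewrite rmorph_nat scaler_nat mulr2n opprD addrACA.
  rewrite rnormZr (rnorm_sub z y) ger0_norm // => hp.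
  have hd : d <= rnorm (x - (2^-1%:C *: y + 2^-1%:C *: z)).
    by apply: dle; apply: (Kl _ _ _) => //; rewrite -[_ *: z]addr0; apply: (Kl _ _ _).
  have h1 : d ^+ 2 <= rnorm (x - (2^-1%:C *: y + 2^-1%:C *: z)) ^+ 2.
    by rewrite ler_pXn2r ?nnegrE ?rnorm_ge0.
  have h2 : rnorm (x - y) ^+ 2 <= (d + eta) ^+ 2.
    by rewrite ler_pXn2r ?nnegrE ?rnorm_ge0 ?addr_ge0.
  have h3 : rnorm (x - z) ^+ 2 <= (d + eta) ^+ 2.
    by rewrite ler_pXn2r ?nnegrE ?rnorm_ge0 ?addr_ge0.
  by move: hp; rewrite exprMn; lra.
have [y hy] : exists y, cvgs u y.
  apply: cvgs_cauchy => e e0.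
  pose q := Num.min 1 (e ^+ 2 / (4 * (2 * d + 2))).
  have D0 : 0 < 4 * (2 * d + 2) by lra.
  have q0 : 0 < q by rewrite lt_min ltr01 divr_gt0 ?exprn_gt0.
  have [n0 /(_ n0 (leqnn n0)) hn0] := inv_natr_small q0.
  exists n0 => n m hn hm.
  have hq k : (n0 <= k)%N -> rnorm (x - u k) <= d + n0.+1%:R^-1.
    move=> hk; apply: ltW; apply: lt_le_trans (hu k).2 _.
    by rewrite lerD2l lef_pV2 ?posrE // ler_nat ltnS.
  have i0 : (0 : R) < n0.+1%:R^-1 by rewrite invr_gt0.
  have := key _ _ _ (hu n).1 (hu m).1 (ltW i0) (hq n hn) (hq m hm).
  set i := _^-1 in i0 hn0 *; set r := rnorm _ => hr.
  have hi1 : i < 1 by apply: lt_le_trans hn0 _; rewrite ge_min lexx.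
  have hi2 : i * (4 * (2 * d + 2)) < e ^+ 2.
    by rewrite -ltr_pdivlMr //; apply: lt_le_trans hn0 _; rewrite ge_min lexx orbT.
  rewrite -(@ltr_pXn2r _ 2) ?nnegrE ?rnorm_ge0 ?ltW //.
  apply: le_lt_trans hr _; apply: le_lt_trans hi2.
  rewrite sqrrD; suff : i ^+ 2 <= i by nra.
  by rewrite expr2 -[leRHS]mulr1 ler_pM2l // ltW.
have Ky : K y by apply: Kc hy => n; exact: (hu n).1.
have hyd : rnorm (x - y) <= d.
  apply/ler_addgt0Pr => e e0; have e2 : 0 < e / 2 by rewrite divr_gt0.
  have [n1 h1] := hy _ e2.
  have [n2 hn2] := inv_natr_small e2.
  have := h1 _ (leq_maxl n1 n2); have := hn2 _ (leq_maxr n1 n2).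
  set n := maxn _ _ => h4 h2; have h3 := (hu n).2.
  apply: le_trans (rnorm_tri _ (u n) _) _.
  by move: h4 h3; move: (_^-1) => i; lra.
exists y => // z Kz.
have : forall w, K w -> rnorm (x - y) <= rnorm (x - y - w).
  move=> w Kw; rewrite (le_trans hyd) // -addrA -opprD [y + w]addrC.
  by apply: dle; rewrite -[w]scale1r; exact: Kl.
move: (x - y) => v hmin.
(* First variation of the distance in the direction c z *)
have hvar (c : R[i]) : cmod c = 1 -> 0 <= - complex.Re (Num.conj c * ip v z).
  move=> c1; rewrite oppr_ge0; apply/ler_addgt0Pr => e e0; rewrite add0r.
  have z1 : 0 < 1 + rnorm z ^+ 2 by rewrite ltr_pwDl ?sqr_ge0.
  pose t := e / (1 + rnorm z ^+ 2); have t0 : 0 < t by exact: divr_gt0.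
  have : rnorm v ^+ 2 <= rnorm (v - (t%:C * c) *: z) ^+ 2.
    rewrite ler_pXn2r ?nnegrE ?rnorm_ge0 // hmin //.
    by rewrite -[_ *: z]addr0; exact: Kl.
  rewrite rnormB_sqr rnormZ cmodM c1 cmodR (gtr0_norm t0) ipZr conjcM conjcr.
  rewrite mulr1 -mulrA ReZ exprMn => h.
  have : 2 * (t * complex.Re (Num.conj c * ip v z)) <= t * (t * rnorm z ^+ 2) by lra.
  rewrite mulrCA ler_pM2l // => h2.
  suff : t * rnorm z ^+ 2 <= e by lra.
  by rewrite /t mulrAC ler_pdivrMr // ler_pM2l // lerDr.
have h1 := hvar 1 (@cmod1 _).
have h2 := hvar (-1) _; rewrite cmodN cmod1 in h2.
have h3 := hvar 'i (@cmod_i _).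
have h4 := hvar (- 'i) _; rewrite cmodN cmod_i in h4.
move: h1 (h2 erefl) h3 (h4 erefl).
rewrite !conjcN conjc1 !mulNr !mul1r !ReN.
case: (ip v z) => a b /= ha hb hc hd.
by apply: complex_eq_Re_Im => /=; lra.
Qed.

End inner_product.

(** * Unbounded operators and Stone's theorem *)

Section linear_maps.
Context {R : realType} {H : completeNormedModType R[i]} {f : H -> H}.
Hypothesis f_lin : forall (a : R[i]) x y, f (a *: x + y) = a *: f x + f y.

Lemma lin0 : f 0 = 0.
Proof. by have := f_lin (-1) 0 0; rewrite scaler0 addr0 scaleN1r addNr. Qed.

Lemma linZ a x : f (a *: x) = a *: f x.
Proof. by rewrite -[a *: x]addr0 f_lin lin0 addr0. Qed.

Lemma linB x y : f (x - y) = f x - f y.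
Proof. by rewrite addrC -scaleN1r f_lin scaleN1r addrC. Qed.

End linear_maps.

Section linop_theory.
Context {R : realType} {H : completeNormedModType R[i]} (T : linop H).
Implicit Types x y : H.

Lemma domD x y : dom T x -> dom T y -> dom T (x + y).
Proof. by move=> hx hy; rewrite -[x]scale1r; exact: domP. Qed.

Lemma domZ a x : dom T x -> dom T (a *: x).
Proof. by move=> hx; rewrite -[_ *: _]addr0; apply: domP => //; exact: dom0. Qed.

Lemma domB x y : dom T x -> dom T y -> dom T (x - y).
Proof. by move=> hx hy; rewrite -scaleN1r addrC; exact: domP. Qed.

Lemma dom_sum I (r : seq I) (P : pred I) (F : I -> H) :
  (forall i, P i -> dom T (F i)) -> dom T (\sum_(i <- r | P i) F i).
Proof. by move=> h; elim/big_rec: _ => [|i x Pi hx]; [exact: dom0|apply: domD => //; exact: h]. Qed.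

Lemma app0 : T 0 = 0.
Proof.
have := Defs.appP (-1) (dom0 T) (dom0 T).
by rewrite scaler0 addr0 scaleN1r addNr.
Qed.

Lemma appD x y : dom T x -> dom T y -> T (x + y) = T x + T y.
Proof. by move=> hx hy; rewrite -[x in LHS]scale1r Defs.appP // scale1r. Qed.

Lemma appZ a x : dom T x -> T (a *: x) = a *: T x.
Proof.
by move=> hx; rewrite -[_ *: _ in LHS]addr0 Defs.appP ?app0 ?addr0 //; exact: dom0.
Qed.

Lemma appB x y : dom T x -> dom T y -> T (x - y) = T x - T y.
Proof. by move=> hx hy; rewrite -scaleN1r addrC Defs.appP // scaleN1r addrC. Qed.

Lemma app_sum I (r : seq I) (P : pred I) (F : I -> H) :
  (forall i, P i -> dom T (F i)) ->
  T (\sum_(i <- r | P i) F i) = \sum_(i <- r | P i) T (F i).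
Proof.
move=> h; suff [] : dom T (\sum_(i <- r | P i) F i) /\
  T (\sum_(i <- r | P i) F i) = \sum_(i <- r | P i) T (F i) by [].
elim/big_rec2: _ => [|i x y Pi [hx hxy]]; first by split; [exact: dom0|exact: app0].
by split; [apply: domD => //; exact: h|rewrite appD ?hxy //; exact: h].
Qed.

End linop_theory.

Lemma dense_rnorm (R : realType) (H : completeNormedModType R[i]) (D : set H) :
  dense D -> forall x (e : R), 0 < e -> exists2 y, D y & rnorm (x - y) < e.
Proof.
move=> hD x e e0; have e0' : 0 < e%:C by rewrite ltcR.
have hO : open (ball x e%:C) by exact: ball_open.
have [|y [] ] := hD (ball x e%:C) _ hO.
  by exists x; exact: ballxx.
by rewrite -ball_normE /= rnormE ltcR => h Dy; exists y.
Qed.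

Section resolvent.
Context {R : realType} {H : completeNormedModType R[i]}.
Context {ip : {dot H for Num.conj}}.
Hypothesis ip_norm : forall x : H, `|x| ^+ 2 = ip x x.
Variable T : linop H.
Hypothesis T_skew : skew_adjoint ip T.
Implicit Types x y z : H.

Lemma skew_ip x y : dom T x -> dom T y -> ip (T x) y = - ip x (T y).
Proof.
move=> hx hy; have [_ /(_ y (- T y)) [_ h]] := T_skew.
by rewrite h // ipNr.
Qed.

Lemma skew_domP y z : (forall x, dom T x -> ip (T x) y = - ip x z) ->
  dom T y /\ T y = z.
Proof.
move=> h; have [_ /(_ y (- z)) [h1 _]] := T_skew.
have [|hy hz] := h1 _; first by move=> x /h; rewrite ipNr.
by split => //; apply: oppr_inj.
Qed.

Lemma skew_Re0 x : dom T x -> complex.Re (ip (T x) x) = 0.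
Proof.
move=> hx; have := congr1 (@complex.Re R) (skew_ip hx hx).
by rewrite ReN (Re_ipC x); lra.
Qed.

Lemma skew_closed (u : nat -> H) x y : (forall n, dom T (u n)) ->
  cvgs u x -> cvgs (fun n => T (u n)) y -> dom T x /\ T x = y.
Proof.
move=> hu hx hy; apply: skew_domP => z hz.
rewrite [LHS]ipC [ip z y]ipC -conjcN; congr Num.conj; rewrite -ipNr.
by apply: (ip_cvgs_eq ip_norm hx hy) => n; rewrite ipNr skew_ip ?opprK.
Qed.

Lemma resolvent_sqr (h : R) x : dom T x ->
  rnorm (x - h%:C *: T x) ^+ 2 = rnorm x ^+ 2 + h ^+ 2 * rnorm (T x) ^+ 2.
Proof.
move=> hx; rewrite (rnormB_sqr ip_norm) rnormZr exprMn real_normK ?num_real //.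
by rewrite ipZrR ReZ (Re_ipC x) skew_Re0 // !mulr0 subr0.
Qed.

Lemma resolvent_ge (h : R) x : dom T x -> rnorm x <= rnorm (x - h%:C *: T x).
Proof.
move=> hx; rewrite -(@ler_pXn2r _ 2) ?nnegrE ?rnorm_ge0 // resolvent_sqr //.
by rewrite lerDl mulr_ge0 ?sqr_ge0.
Qed.

Lemma one_minus_hT_lin (h : R) a x y : dom T x -> dom T y ->
  (a *: x + y) - h%:C *: T (a *: x + y) =
  a *: (x - h%:C *: T x) + (y - h%:C *: T y).
Proof.
move=> hx hy; rewrite Defs.appP // scalerDr scalerA mulrC -scalerA opprD addrACA.
by rewrite -scalerBr.
Qed.

Lemma cvgs_cauchy_seq (u : nat -> H) x : cvgs u x -> forall e : R, 0 < e ->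
  exists n0, forall n m, (n0 <= n)%N -> (n0 <= m)%N -> rnorm (u n - u m) < e.
Proof.
move=> hu e e0; have [n0 hn] := hu _ (divr_gt0 e0 (ltr0Sn R 1)); exists n0 => n m h1 h2.
apply: le_lt_trans (rnorm_tri _ x _) _; rewrite (rnorm_sub x).
by have := hn _ h1; have := hn _ h2; lra.
Qed.

(** The range of 1 - hT is closed because 1 - hT does not decrease norms, and
    a vector orthogonal to it would be an eigenvector of T for the non-imaginary
    eigenvalue -1/h. *)
Lemma resolvent_surj (h : R) x : h != 0 ->
  exists2 y, dom T y & y - h%:C *: T y = x.
Proof.
move=> h0; pose K := [set y - h%:C *: T y | y in dom T].
have K0 : K 0 by exists 0; [exact: dom0|rewrite app0 scaler0 subr0].
have Kl a y z : K y -> K z -> K (a *: y + z).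
  move=> [y' hy' <-] [z' hz' <-]; exists (a *: y' + z'); first exact: domP.
  by rewrite one_minus_hT_lin.
have Kc (u : nat -> H) y : (forall n, K (u n)) -> cvgs u y -> K y.
  move=> hK hu.
  have /choice [v hv] n : exists v, dom T v /\ v - h%:C *: T v = u n.
    by have [v ? ?] := hK n; exists v.
  have vd n : dom T (v n) := (hv n).1.
  have vu n m : (v n - v m) - h%:C *: T (v n - v m) = u n - u m.
    rewrite -(hv n).2 -(hv m).2 appB // scalerBr.
    by rewrite opprB [in RHS]opprB addrACA [RHS]addrACA [X in _ + X = _]addrC.
  have [w hw] : exists w, cvgs v w.
    apply: cvgs_cauchy => e e0; have [n0 hn] := cvgs_cauchy_seq hu e0.
    exists n0 => n m h1 h2; apply: le_lt_trans (hn n m h1 h2).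
    by rewrite -vu; apply: resolvent_ge; exact: domB.
  have hTv : cvgs (fun n => T (v n)) (h^-1%:C *: (w - y)).
    apply: (@cvgs_shift _ _ _ 0).
    have -> : (fun n => T (v (n + 0)%N)) = (fun n => h^-1%:C *: (v n - u n)).
      apply/funext => n; rewrite addn0 -(hv n).2 opprB addrC subrK scalerA.
      by rewrite -rmorphM mulVf // scale1r.
    by apply: cvgsZ; apply: cvgsB.
  have [hwd hTw] := skew_closed vd hw hTv.
  exists w => //; rewrite hTw scalerA -rmorphM mulfV // scale1r opprB addrC.
  by rewrite subrK.
have [y [y' hy' hy] hort] := orthogonal_projection ip_norm x K0 Kl Kc.
exists y' => //; rewrite hy; apply/eqP; rewrite eq_sym -subr_eq0; apply/eqP.
move: (x - y) hort => v hort.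
have hv0 z : dom T z -> ip z v = h%:C * ip (T z) v.
  move=> hz; have : ip v (z - h%:C *: T z) = 0 by apply: hort; exists z.
  rewrite ipC ipBl ipZl => /(congr1 Num.conj).
  by rewrite conjCK conjC0 => /eqP; rewrite subr_eq0 => /eqP.
have [hvd hTv] : dom T v /\ T v = - h^-1%:C *: v.
  apply: skew_domP => z hz.
  rewrite scaleNr ipNr opprK ipZrR (hv0 _ hz) mulrA -rmorphM mulVf //.
  by rewrite mul1r.
have := hv0 v hvd; rewrite hTv ipZl mulrA -rmorphN -rmorphM mulrN mulfV //.
rewrite (ip_self ip_norm) rmorphN mulN1r => /(congr1 (@complex.Re R)) /= hn.
apply/rnorm_eq0/eqP; have /eqP : rnorm v ^+ 2 = 0 by lra.
by rewrite expf_eq0.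
Qed.

(** Parametrized by the time step h, the inverse of the spectral parameter, so
    that h = 0 gives the identity *)
Definition resolvent (h : R) x : H :=
  if h == 0 then x else xget 0 [set y | dom T y /\ y - h%:C *: T y = x].

Local Notation J := resolvent.

Lemma resolventP (h : R) x : h != 0 -> dom T (J h x) /\ J h x - h%:C *: T (J h x) = x.
Proof.
rewrite /J => h0; rewrite (negbTE h0); case: xgetP => //.
by have [y ? ?] := resolvent_surj x h0 => /(_ y) [].
Qed.

Lemma resolvent_inj (h : R) x y : dom T x -> dom T y ->
  x - h%:C *: T x = y - h%:C *: T y -> x = y.
Proof.
move=> hx hy he; have := resolvent_ge h (domP (-1) hx hy).
rewrite one_minus_hT_lin // he !scaleN1r addNr rnorm0 addrC => h0.
apply/esym/eqP; rewrite -subr_eq0; apply/eqP/rnorm_eq0/eqP.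
by rewrite eq_le rnorm_ge0 h0.
Qed.

Lemma resolventK (h : R) x : dom T x -> J h (x - h%:C *: T x) = x.
Proof.
move=> hx; have [->|h0] := eqVneq h 0.
  by rewrite /J eqxx scale0r subr0.
by have [hy hyx] := resolventP (x - h%:C *: T x) h0; exact: resolvent_inj hyx.
Qed.

Lemma resolvent0 x : J 0 x = x.
Proof. by rewrite /J eqxx. Qed.

Lemma resolvent_unique (h : R) x y : dom T y -> y - h%:C *: T y = x -> J h x = y.
Proof. by move=> hy <-; rewrite resolventK. Qed.

Lemma resolvent_lin (h : R) a x y : J h (a *: x + y) = a *: J h x + J h y.
Proof.
have [->|h0] := eqVneq h 0; first by rewrite !resolvent0.
have [hx Ex] := resolventP x h0; have [hy Ey] := resolventP y h0.
by apply: resolvent_unique; [exact: domP|rewrite one_minus_hT_lin // Ex Ey].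
Qed.

Lemma resolventB (h : R) x y : J h (x - y) = J h x - J h y.
Proof. exact: (linB (resolvent_lin h)). Qed.

Lemma resolventZ (h : R) a x : J h (a *: x) = a *: J h x.
Proof. exact: (linZ (resolvent_lin h)). Qed.

Lemma resolvent_contr (h : R) x : rnorm (J h x) <= rnorm x.
Proof.
have [->|h0] := eqVneq h 0; first by rewrite resolvent0.
by have [hx {2}<-] := resolventP x h0; exact: resolvent_ge.
Qed.

Lemma dom_resolvent (h : R) x : dom T x -> dom T (J h x).
Proof.
have [->|h0] := eqVneq h 0; first by rewrite resolvent0.
by move=> _; exact: (resolventP x h0).1.
Qed.

Lemma resolvent_T (h : R) x : dom T x -> T (J h x) = J h (T x).
Proof.
have [->|h0] := eqVneq h 0; first by rewrite !resolvent0.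
move=> hx; have [hy Ey] := resolventP x h0.
have hTy : T (J h x) = h^-1%:C *: (J h x - x).
  by rewrite -[X in _ - X]Ey opprB addrC subrK scalerA -rmorphM mulVf ?scale1r.
have hd : dom T (T (J h x)) by rewrite hTy; apply: domZ; exact: domB.
apply/esym; apply: resolvent_unique => //.
by rewrite -[X in _ = T X]Ey appB //; [rewrite appZ|exact: domZ].
Qed.

Lemma resolvent_step (h : R) x : dom T x -> J h x - x = h%:C *: J h (T x).
Proof.
move=> hx; rewrite -resolvent_T //; have [->|h0] := eqVneq h 0.
  by rewrite resolvent0 subrr scale0r.
by have [hy {2}<-] := resolventP x h0; rewrite opprB addrC subrK.
Qed.

Lemma resolventC (a b : R) x : J a (J b x) = J b (J a x).
Proof.
have [->|a0] := eqVneq a 0; first by rewrite !resolvent0.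
have [hy Ey] := resolventP x a0.
apply: resolvent_unique; first exact: dom_resolvent.
by rewrite resolvent_T // -resolventZ -resolventB Ey.
Qed.

Definition dom2 x := dom T x /\ dom T (T x).

Lemma dom2_resolvent (h : R) x : dom2 x -> dom2 (J h x).
Proof. by move=> [hx hTx]; split; rewrite ?resolvent_T //; exact: dom_resolvent. Qed.

Lemma dom2_iter (h : R) n x : dom2 x -> dom2 (iter n (J h) x).
Proof. by move=> hx; elim: n => //= n IH; exact: dom2_resolvent. Qed.

Lemma iter_resolvent_T (h : R) n x : dom T x ->
  dom T (iter n (J h) x) /\ T (iter n (J h) x) = iter n (J h) (T x).
Proof.
move=> hx; elim: n => //= n [hd IH].
by split; [exact: dom_resolvent|rewrite resolvent_T // IH].
Qed.

Lemma iter_resolvent_lin (h : R) n a x y :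
  iter n (J h) (a *: x + y) = a *: iter n (J h) x + iter n (J h) y.
Proof. by elim: n => //= n ->; rewrite resolvent_lin. Qed.

Lemma iter_resolventB (h : R) n x y :
  iter n (J h) (x - y) = iter n (J h) x - iter n (J h) y.
Proof. exact: (linB (iter_resolvent_lin h n)). Qed.

Lemma iter_resolvent_contr (h : R) n x : rnorm (iter n (J h) x) <= rnorm x.
Proof. by elim: n => //= n; apply: le_trans; exact: resolvent_contr. Qed.

(** (1 - aT)(1 - bT) and 1 - (a + b)T differ by ab T^2 only. *)
Lemma resolvent_comp (a b : R) x : dom2 x ->
  rnorm (J a (J b x) - J (a + b) x) <= `|a * b| * rnorm (T (T x)).
Proof.
move=> hx; have [hy hTy] := dom2_resolvent (a + b) hx.
have hd : dom T (J (a + b) x - b%:C *: T (J (a + b) x)).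
  by apply: domB => //; exact: domZ.
have E : (J (a + b) x - b%:C *: T (J (a + b) x)) -
    a%:C *: T (J (a + b) x - b%:C *: T (J (a + b) x)) =
    x + (a * b)%:C *: T (T (J (a + b) x)).
  have Ex : x = J (a + b) x - (a + b)%:C *: T (J (a + b) x).
    have [e0|e0] := eqVneq (a + b) 0.
      by rewrite e0 resolvent0 scale0r subr0.
    by have [] := resolventP x e0.
  rewrite [X in _ = X + _]Ex appB //; last exact: domZ.
  rewrite appZ // scalerBr scalerA -realCM realCD scalerDl.
  move: (J (a + b) x) => y.
  move: (b%:C *: T y) (a%:C *: T y) (_ *: T (T y)) => v w u.
  rewrite opprB [in RHS]opprD (addrC (- w)) addrA addrAC.
  by rewrite -!addrA.
have -> : J a (J b x) = J (a + b) x -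
    (a * b)%:C *: J a (J b (T (T (J (a + b) x)))).
  apply/eqP; rewrite eq_sym subr_eq eq_sym -!resolventZ.
  rewrite -[J a (J b x)]scale1r -!resolvent_lin scale1r -E resolventC.
  by rewrite resolventK // resolventK.
rewrite addrAC subrr add0r rnormN rnormZr ler_wpM2l //.
apply: le_trans (resolvent_contr _ _) _; apply: le_trans (resolvent_contr _ _) _.
by case: hx => h1 h2; rewrite !resolvent_T // resolvent_contr.
Qed.

Lemma iter_resolventC (a b : R) n x :
  iter n (J a) (J b x) = J b (iter n (J a) x).
Proof. by elim: n => //= n ->; exact: resolventC. Qed.

Lemma iter_diff_le (P Q : H -> H) (c : R) n x :
  (forall y z, rnorm (P y - P z) <= rnorm (y - z)) ->
  (forall j, rnorm (P (iter j Q x) - Q (iter j Q x)) <= c) ->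
  rnorm (iter n P x - iter n Q x) <= n%:R * c.
Proof.
move=> hP hQ; elim: n => [|n IH]; first by rewrite /= subrr rnorm0 mul0r.
rewrite !iterS; apply: le_trans (rnorm_tri _ (P (iter n Q x)) _) _.
rewrite -addn1 natrD mulrDl mul1r; apply: lerD => //.
exact: le_trans (hP _ _) IH.
Qed.

Lemma resolvent_lip (h : R) x y : rnorm (J h x - J h y) <= rnorm (x - y).
Proof. by rewrite -resolventB resolvent_contr. Qed.

Lemma iter_resolvent_lip (h : R) n x y :
  rnorm (iter n (J h) x - iter n (J h) y) <= rnorm (x - y).
Proof. by rewrite -iter_resolventB iter_resolvent_contr. Qed.

Lemma iter_resolvent_comp (a b : R) n x : dom2 x ->
  rnorm (iter n (J a) (iter n (J b) x) - iter n (J (a + b)) x) <=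
  n%:R * (`|a * b| * rnorm (T (T x))).
Proof.
move=> hx.
have -> : iter n (J a) (iter n (J b) x) = iter n (J a \o J b) x.
  by elim: n => //= n <-; rewrite iter_resolventC.
apply: iter_diff_le => [y z|j].
  exact: le_trans (resolvent_lip _ _ _) (resolvent_lip _ _ _).
apply: le_trans (resolvent_comp _ _ (dom2_iter _ _ hx)) _.
rewrite ler_wpM2l //; case: hx => h1 h2.
have [h3 ->] := iter_resolvent_T (a + b) j h1.
by have [_ ->] := iter_resolvent_T (a + b) j h2; exact: iter_resolvent_contr.
Qed.

Lemma resolvent_small (h : R) x : dom T x ->
  rnorm (J h x - x) <= `|h| * rnorm (T x).
Proof.
by move=> hx; rewrite resolvent_step // rnormZr ler_wpM2l // resolvent_contr.
Qed.

(** The vector J h x works for small h: its image under T is J h (T x). *)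
Lemma dom2_graph_dense x (e : R) : dom T x -> 0 < e ->
  exists2 y, dom2 y & rnorm (x - y) < e /\ rnorm (T x - T y) < e.
Proof.
move=> hx e0; have e4 : 0 < e / 4 by rewrite divr_gt0.
have [z hz hzx] := dense_rnorm T_skew.1 (T x) e4.
pose c := 1 + rnorm (T x) + rnorm (T z).
have c0 : 0 < c by rewrite /c -addrA ltr_pwDl ?addr_ge0 ?rnorm_ge0.
pose h := e / (2 * c); have h0 : 0 < h by rewrite divr_gt0 ?mulr_gt0.
have hc : h * c = e / 2 by rewrite /h; field; rewrite gt_eqF.
exists (J h x).
  split; first exact: dom_resolvent.
  rewrite resolvent_T //; exact: (resolventP (T x) (lt0r_neq0 h0)).1.
have hl t : 0 <= t -> t < c -> h * t < e / 2 by move=> ? ?; rewrite -hc ltr_pM2l.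
split; rewrite rnorm_sub.
  apply: le_lt_trans (resolvent_small _ hx) _; rewrite gtr0_norm //.
  have := hl (rnorm (T x)) (rnorm_ge0 _) _; rewrite /c.
    by have := rnorm_ge0 (T z); lra.
rewrite resolvent_T //; apply: le_lt_trans (rnorm_tri _ (J h z) _) _.
have h1 := resolvent_lip h (T x) z.
have h2 := rnorm_tri (J h z) z (T x); rewrite (rnorm_sub z) in h2.
have h3 := resolvent_small h hz; rewrite gtr0_norm // in h3.
have := hl (rnorm (T z)) (rnorm_ge0 _) _; rewrite /c.
by have := rnorm_ge0 (T x); lra.
Qed.

Lemma dom2_dense x (e : R) : 0 < e -> exists2 y, dom2 y & rnorm (x - y) < e.
Proof.
move=> e0; have e2 : 0 < e / 2 by rewrite divr_gt0.
have [z hz hzx] := dense_rnorm T_skew.1 x e2.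
have [y hy [hyz _]] := dom2_graph_dense hz e2.
by exists y => //; apply: le_lt_trans (rnorm_tri _ z _) _; lra.
Qed.

Lemma eq_on_dom2 (f g : H -> H) :
  (forall x y, rnorm (f x - f y) <= rnorm (x - y)) ->
  (forall x y, rnorm (g x - g y) <= rnorm (x - y)) ->
  (forall x, dom2 x -> f x = g x) -> forall x, f x = g x.
Proof.
move=> hf hg hfg x; apply/eqP; rewrite -subr_eq0; apply/eqP/rnorm_small => e e0.
have e2 : 0 < e / 2 by rewrite divr_gt0.
have [y hy hxy] := dom2_dense x e2.
apply: le_trans (rnorm_tri _ (f y) _) _; rewrite (rnorm_sub (f y)) [f y in X in _ + X]hfg //.
by have := hf x y; have := hg x y; lra.
Qed.

(** The implicit Euler scheme with 2^m steps. Halving the step makes the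
    convergence a geometric series. *)
Definition euler m (t : R) x : H := iter (2 ^ m) (J (t / (2 ^ m)%:R)) x.

Lemma euler_lip m t x y : rnorm (euler m t x - euler m t y) <= rnorm (x - y).
Proof. exact: iter_resolvent_lip. Qed.

Lemma euler_comp m (s t : R) x : dom2 x ->
  rnorm (euler m s (euler m t x) - euler m (s + t) x) <=
  `|s * t| * rnorm (T (T x)) / (2 ^ m)%:R.
Proof.
move=> hx; rewrite /euler mulrDl; apply: le_trans (iter_resolvent_comp _ _ _ hx) _.
have n0 : (0 : R) < (2 ^ m)%:R by rewrite ltr0n expn_gt0.
rewrite le_eqVlt; apply/orP; left; apply/eqP.
rewrite mulf_div normrM normfV (gtr0_norm (mulr_gt0 n0 n0)).
by field; rewrite gt_eqF.
Qed.

Lemma euler_double m (t : R) x : dom2 x ->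
  rnorm (euler m.+1 t x - euler m t x) <= t ^+ 2 * rnorm (T (T x)) / (2 ^ m)%:R.
Proof.
move=> hx; have -> : euler m.+1 t x = euler m (t / 2) (euler m (t / 2) x).
  rewrite /euler expnS mul2n -addnn iterD natrD.
  have n0 : (0 : R) < (2 ^ m)%:R by rewrite ltr0n expn_gt0.
  have -> // : t / ((2 ^ m)%:R + (2 ^ m)%:R) = t / 2 / (2 ^ m)%:R.
  by field; rewrite gt_eqF //= gt_eqF ?addr_gt0.
have {3}-> : t = t / 2 + t / 2 by lra.
apply: le_trans (euler_comp _ _ _ hx) _.
rewrite !ler_wpM2r ?invr_ge0 ?ler0n ?rnorm_ge0 //.
by rewrite ger0_norm; nra.
Qed.

Lemma cvg_geometric_half (c : R) : (fun m : nat => c / (2 ^ m)%:R) @ \oo --> (0 : R).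
Proof.
have := @cvg_geometric R c 2^-1; rewrite gtr0_norm ?invr_gt0 // invf_lt1 // ltr1n.
move=> /(_ isT); apply: cvg_trans; apply: near_eq_cvg; apply: nearW => m /=.
by rewrite /geometric /= exprVn natrX.
Qed.

Lemma euler_cvg (t : R) x : exists y, cvgs (fun m => euler m t x) y.
Proof.
apply: cvgs_cauchy => e e0; have e4 : 0 < e / 4 by rewrite divr_gt0.
have [y hy hxy] := dom2_dense x e4.
pose c := t ^+ 2 * rnorm (T (T y)); have c0 : 0 <= c by rewrite mulr_ge0 ?sqr_ge0 ?rnorm_ge0.
have hstep m k : rnorm (euler (m + k) t y - euler m t y) <=
    2 * c / (2 ^ m)%:R - 2 * c / (2 ^ (m + k))%:R.
  elim: k => [|k IH]; first by rewrite addn0 !subrr rnorm0.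
  rewrite addnS; apply: le_trans (rnorm_tri _ (euler (m + k) t y) _) _.
  apply: le_trans (lerD (euler_double _ _ hy) IH) _; rewrite -/c.
  rewrite addrCA lerD2l expnS natrM invfM le_eqVlt; apply/orP; left; apply/eqP.
  by field; rewrite pnatr_eq0 -lt0n expn_gt0.
have /cvgr0Pnorm_lt /(_ _ e4) [n0 _ hn0] := cvg_geometric_half (2 * c).
have cge m : 0 <= 2 * c / (2 ^ m)%:R by apply: divr_ge0 => //; exact: mulr_ge0.
have hle m : (n0 <= m)%N -> rnorm (euler m t y - euler n0 t y) < e / 4.
  move=> hm; have := hstep n0 (m - n0)%N; rewrite subnKC //.
  have := hn0 n0 (leqnn n0) => /=; rewrite ger0_norm //.
  have := cge m.
  by move: (_ / (2 ^ m)%:R) (_ / (2 ^ n0)%:R) (rnorm _) => u v w; lra.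
exists n0 => n m hn hm.
apply: le_lt_trans (rnorm_tri _ (euler n t y) _) _.
apply: le_lt_trans (lerD (euler_lip _ _ _ _) (rnorm_tri _ (euler m t y) _)) _.
have := rnorm_tri (euler n t y) (euler n0 t y) (euler m t y).
have := euler_lip m t y x; rewrite (rnorm_sub y x) (rnorm_sub (euler n0 _ _)).
by have := hle _ hn; have := hle _ hm; lra.
Qed.

Definition ugroup (t : R) x : H := xget 0 [set y | cvgs (fun m => euler m t x) y].

Local Notation U := ugroup.

Lemma ugroupP t x : cvgs (fun m => euler m t x) (U t x).
Proof.
by have [y hy] := euler_cvg t x; exact: (xgetI 0 hy).
Qed.

Lemma ugroup_unique t x y : cvgs (fun m => euler m t x) y -> U t x = y.
Proof. by move=> hy; apply: cvgs_unique hy; exact: ugroupP. Qed.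

Lemma ugroup_lin t a x y : U t (a *: x + y) = a *: U t x + U t y.
Proof.
apply: ugroup_unique.
rewrite (_ : (fun m => _) = (fun m => a *: euler m t x + euler m t y)).
  by apply: cvgsD; [apply: cvgsZ|]; exact: ugroupP.
by apply/funext => m; exact: iter_resolvent_lin.
Qed.

Lemma ugroupB t x y : U t (x - y) = U t x - U t y.
Proof. exact: (linB (ugroup_lin t)). Qed.

Lemma ugroup_contr t x : rnorm (U t x) <= rnorm x.
Proof.
apply: (cvgs_rnorm_le (n0 := 0%N)) (ugroupP t x) => n _.
exact: iter_resolvent_contr.
Qed.

Lemma ugroup_lip t x y : rnorm (U t x - U t y) <= rnorm (x - y).
Proof. by rewrite -ugroupB ugroup_contr. Qed.

Lemma ugroup0 x : U 0 x = x.
Proof.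
apply: ugroup_unique; rewrite (_ : (fun m => _) = fun=> x); first exact: cvgs_cst.
apply/funext => m; rewrite /euler mul0r; elim: (2 ^ m)%N => //= n ->.
exact: resolvent0.
Qed.

Lemma ugroupD s t x : U (s + t) x = U s (U t x).
Proof.
move: x; apply: eq_on_dom2 => [x y|x y|x hx].
- exact: ugroup_lip.
- exact: le_trans (ugroup_lip _ _ _) (ugroup_lip _ _ _).
pose w := fun m => euler m (s + t) x - euler m s (euler m t x).
have hw : cvgs w 0.
  apply: cvgs_bound (cvg_geometric_half (`|s * t| * rnorm (T (T x)))) => m.
  by rewrite subr0 rnorm_sub; exact: euler_comp.
apply: ugroup_unique.
have -> : (fun m => euler m (s + t) x) = (fun m => w m +
   (euler m s (euler m t x) - euler m s (U t x)) + euler m s (U t x)).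
  by apply/funext => m; rewrite /w addrA subrK subrK.
rewrite -[U s (U t x)]add0r; apply: cvgsD; last exact: ugroupP.
rewrite -[X in cvgs _ X]add0r; apply: cvgsD => // e e0.
have [n0 hn] := ugroupP t x e0; exists n0 => n /hn; apply: le_lt_trans.
by rewrite subr0; exact: euler_lip.
Qed.

Lemma ugroup_isometry t x : rnorm (U t x) = rnorm x.
Proof.
apply/eqP; rewrite eq_le ugroup_contr /=.
by rewrite -{1}(ugroup0 x) -(addNr t) ugroupD ugroup_contr.
Qed.

(** Each step adds h times a resolvent of T x, T commuting with the resolvent. *)
Lemma iter_resolvent_step (h : R) n x : dom T x ->
  iter n (J h) x - x = h%:C *: \sum_(i < n) iter i.+1 (J h) (T x).
Proof.
move=> hx; elim: n => [|n IH]; first by rewrite big_ord0 scaler0 subrr.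
rewrite big_ord_recr /= scalerDr -IH.
have [hd hT] := iter_resolvent_T h n hx.
by rewrite -hT -resolvent_step // [RHS]addrC addrA subrK.
Qed.

Lemma ugroup_small t x : dom T x -> rnorm (U t x - x) <= `|t| * rnorm (T x).
Proof.
move=> hx; apply: (cvgs_rnorm_le (n0 := 0%N)) (cvgsB (ugroupP t x) (cvgs_cst x)) => m _.
rewrite /euler iter_resolvent_step // rnormZr.
have n0 : (0 : R) < (2 ^ m)%:R by rewrite ltr0n expn_gt0.
apply: (@le_trans _ _ (`|t / (2 ^ m)%:R| * ((2 ^ m)%:R * rnorm (T x)))).
  rewrite ler_wpM2l //; apply: rnorm_sum_le => i.
  exact: (iter_resolvent_contr _ i.+1).
rewrite normrM normfV (gtr0_norm n0) le_eqVlt; apply/orP; left; apply/eqP.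
by field; rewrite gt_eqF.
Qed.

Lemma ugroup_small2 t x : dom2 x ->
  rnorm (U t x - x - t%:C *: T x) <= t ^+ 2 * rnorm (T (T x)).
Proof.
move=> [hx hTx].
apply: (cvgs_rnorm_le (n0 := 0%N))
  (cvgsB (cvgsB (ugroupP t x) (cvgs_cst x)) (cvgs_cst (t%:C *: T x))) => m _.
rewrite /euler iter_resolvent_step //.
set N := (2 ^ m)%N; have n0 : (0 : R) < N%:R by rewrite ltr0n expn_gt0.
have -> : t%:C *: T x = (t / N%:R)%:C *: \sum_(i < N) T x.
  rewrite sumr_const card_ord -[T x *+ N]scaler_nat scalerA.
  rewrite -(rmorph_nat (real_complex R)) -realCM.
  by rewrite divfK // gt_eqF.
rewrite -scalerBr -sumrB rnormZr.
apply: (@le_trans _ _ (`|t / N%:R| * (N%:R * (`|t| * rnorm (T (T x)))))).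
  rewrite ler_wpM2l //; apply: rnorm_sum_le => i.
  rewrite iter_resolvent_step // rnormZr.
  apply: (@le_trans _ _ (`|t / N%:R| * (i.+1%:R * rnorm (T (T x))))).
    rewrite ler_wpM2l //; apply: rnorm_sum_le => j.
    exact: (iter_resolvent_contr _ j.+1).
  rewrite mulrA ler_wpM2r ?rnorm_ge0 // normrM normfV (gtr0_norm n0).
  by rewrite -mulrA ler_piMr // mulrC ler_pdivrMr // mul1r ler_nat.
rewrite normrM normfV (gtr0_norm n0) mulrA divfK ?gt_eqF // mulrA.
by rewrite -expr2 real_normK ?num_real.
Qed.

Lemma ugroup_little_o x : dom T x -> forall e : R, 0 < e ->
  exists2 d : R, 0 < d & forall t, `|t| < d ->
    rnorm (U t x - x - t%:C *: T x) <= `|t| * e.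
Proof.
move=> hx e e0; have e4 : 0 < e / 4 by rewrite divr_gt0.
have [y hy [_ hxy]] := dom2_graph_dense hx e4; have [hyd _] := hy.
have c0 : 0 < 1 + rnorm (T (T y)) by rewrite ltr_pwDl ?rnorm_ge0.
exists (e / 2 / (1 + rnorm (T (T y)))); first by rewrite !divr_gt0.
move=> t; rewrite ltr_pdivlMr // => ht.
have -> : U t x - x - t%:C *: T x = (U t (x - y) - (x - y)) -
    t%:C *: T (x - y) + (U t y - y - t%:C *: T y).
  rewrite appB // ugroupB scalerBr.
  by rewrite (subrACA (U t x) (U t y) x y) (subrACA (U t x - x)) subrK.
have hd : dom T (x - y) by exact: domB.
apply: le_trans (rnormD _ _) _; apply: le_trans (lerD (rnormB _ _) (ugroup_small2 _ hy)) _.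
rewrite rnormZr; have h1 := ugroup_small t hd.
rewrite appB // in h1 *.
have h2 : `|t| * rnorm (T x - T y) <= `|t| * (e / 4) by rewrite ler_wpM2l // ltW.
have h3 : t ^+ 2 * rnorm (T (T y)) <= `|t| * (e / 2).
  rewrite -[t ^+ 2]real_normK ?num_real // expr2 -mulrA ler_wpM2l //.
  by apply: le_trans (ltW ht); rewrite ler_wpM2l // lerDr.
lra.
Qed.

Lemma ugroup_generator x y : (dom T x /\ T x = y) <->
  ((fun h : R => (h^-1)%:C *: (U h x - x)) @ 0^' --> y).
Proof.
split=> [[hx <-]|/generator_limP hxy].
  apply/generator_limP => e e0; have [d d0 hd] := ugroup_little_o hx e0.
  by exists d => // h _; exact: hd.
apply: skew_domP => // z hz.
have hU h : ip (U h z - z) x = ip z (U (- h) x - x).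
  rewrite ipBl ipBr; congr (_ - _).
  rewrite -[in RHS](isometry_ip ip_norm (ugroup_lin h) (ugroup_isometry h)).
  by rewrite -ugroupD subrr ugroup0.
apply/eqP; rewrite -subr_eq0 opprK; apply/eqP/cmod_eq0/eqP.
rewrite eq_le cmod_ge0 andbT; apply/ler_addgt0Pr => e e0; rewrite add0r.
have c0 : 0 < 1 + rnorm x + rnorm z by rewrite -addrA ltr_pwDl ?addr_ge0 ?rnorm_ge0.
have e1 : 0 < e / (1 + rnorm x + rnorm z) by rewrite divr_gt0.
have [d1 d10 hd1] := ugroup_little_o hz e1; have [d2 d20 hd2] := hxy _ e1.
pose h := Num.min d1 d2 / 2.
have h0 : 0 < h by rewrite divr_gt0 // lt_min d10.
have hmin : h < Num.min d1 d2 by rewrite ltr_pdivrMr // ltr_pMr ?lt_min ?d10 // ltr1n.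
have [hm1 hm2] : h < d1 /\ h < d2 by apply/andP; rewrite -lt_min.
have := hd1 h; have := hd2 (- h).
rewrite oppr_eq0 normrN gtr0_norm // => /(_ (lt0r_neq0 h0) hm2) h2 /(_ hm1) h1.
rewrite -(ler_pM2l h0) -{1}(gtr0_norm h0) -cmodR -cmodM.
have -> : h%:C * (ip (T z) x + ip z y) = ip z (U (- h) x - x - (- h)%:C *: y)
    - ip (U h z - z - h%:C *: T z) x.
  rewrite (ipBr z) (ipBl (U h z - z)) hU ipZrR ipZl realCN; ring.
apply: le_trans (cmodB _ _) _.
apply: le_trans (lerD (cauchy_schwarz ip_norm _ _) (cauchy_schwarz ip_norm _ _)) _.
have h3 : rnorm z * rnorm (U (- h) x - x - (- h)%:C *: y) <=
   rnorm z * (h * (e / (1 + rnorm x + rnorm z))) by rewrite ler_wpM2l ?rnorm_ge0.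
have h4 : rnorm (U h z - z - h%:C *: T z) * rnorm x <=
   (h * (e / (1 + rnorm x + rnorm z))) * rnorm x by rewrite ler_wpM2r ?rnorm_ge0.
apply: le_trans (lerD h3 h4) _.
rewrite [_ * rnorm x]mulrC -mulrDl mulrCA ler_pM2l // mulrA ler_pdivrMr //.
by rewrite mulrC ler_pM2l //; lra.
Qed.

(** Stone's theorem: the axioms of a unitary group pass to the limit from the
    Euler scheme, the estimates being proved on the domain of the square of T. *)
Lemma ugroup_unitary : unitary_group ip T U.
Proof.
split.
- exact: ugroup_lin.
- by move=> t; apply: isometry_ip => //; [exact: ugroup_lin|exact: ugroup_isometry].
- exact: ugroup0.
- exact: ugroupD.
- move=> x t; apply/rnorm_cvgP => e e0; have e4 : 0 < e / 4 by rewrite divr_gt0.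
  have [y [hy _] hxy] := dom2_dense x e4.
  have c0 : 0 < 1 + rnorm (T y) by rewrite ltr_pwDl ?rnorm_ge0.
  have d0 : 0 < e / 4 / (1 + rnorm (T y)) by exact: divr_gt0.
  near=> s.
  have hs : `|s - t| < e / 4 / (1 + rnorm (T y)).
    by near: s; apply: cvgr_distC_lt => //; exact: cvg_id.
  have -> : U s x - U t x = U t (U (s - t) x - x) by rewrite ugroupB -ugroupD [t + _]addrC subrK.
  rewrite ugroup_isometry.
  apply: le_lt_trans (rnorm_tri _ (U (s - t) y) _) _.
  apply: le_lt_trans (lerD (ugroup_lip _ _ _) (rnorm_tri _ y _)) _.
  rewrite (rnorm_sub y x); have := ugroup_small (s - t) hy.
  rewrite ltr_pdivlMr // in hs.
  have : `|s - t| * rnorm (T y) <= `|s - t| * (1 + rnorm (T y)).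
    by rewrite ler_wpM2l // lerDr.
  by lra.
- exact: ugroup_generator.
Unshelve. all: by end_near.
Qed.

(** Both the group and its generator commute with the resolvent, so that the
    errors of one Euler step just add up. *)
Lemma unitary_group_unique (V : R -> H -> H) : unitary_group ip T V ->
  forall t x, V t x = U t x.
Proof.
case=> Vlin Visom V0 Vadd _ Vgen t.
have VB s := linB (Vlin s); have VZ s := linZ (Vlin s).
have Vn s x : rnorm (V s x) = rnorm x.
  apply/eqP; rewrite -(@eqrXn2 _ 2) ?rnorm_ge0 // !(rnorm_sqr ip_norm).
  by rewrite Visom.
have Vdom s x : dom T x -> dom T (V s x) /\ T (V s x) = V s (T x).
  move=> hx; apply/Vgen/generator_limP => e e0.
  have /Vgen/generator_limP /(_ e e0) [d d0 hd] := conj hx (erefl (T x)).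
  exists d => // h h0 hh; apply: le_trans (hd h h0 hh).
  by rewrite -Vadd [h + s]addrC Vadd -VB -VZ -VB Vn.
have VJ s a x : V s (J a x) = J a (V s x).
  have [->|a0] := eqVneq a 0; first by rewrite !resolvent0.
  have [hx Ex] := resolventP x a0; have [hd hT] := Vdom s _ hx.
  by apply/esym/resolvent_unique => //; rewrite hT -VZ -VB Ex.
move=> x; move: x; apply: eq_on_dom2 => [x y|x y|x hx].
- by rewrite -VB Vn.
- exact: ugroup_lip.
apply/esym/ugroup_unique => e e0.
pose C := rnorm (T (T x)); have C0 : 0 <= C by exact: rnorm_ge0.
have t1 : 0 < 1 + `|t| by rewrite ltr_pwDl.
have e1 : 0 < e / 2 / (1 + `|t|) by rewrite !divr_gt0.
have /Vgen/generator_limP /(_ _ e1) [d d0 hd] := conj (proj1 hx) (erefl (T x)).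
have e2 : 0 < e / 2 by rewrite divr_gt0.
have /cvgr0Pnorm_lt /(_ _ e2) [n1 _ hn1] := cvg_geometric_half (t ^+ 2 * C).
have /cvgr0Pnorm_lt /(_ _ d0) [n2 _ hn2] := cvg_geometric_half t.
exists (maxn n1 n2) => m hm.
have := hn1 m (leq_trans (leq_maxl _ _) hm) => /= h1.
have := hn2 m (leq_trans (leq_maxr _ _) hm) => /= h2.
have n0 : (0 : R) < (2 ^ m)%:R by rewrite ltr0n expn_gt0.
have Vt : V t x = iter (2 ^ m) (V (t / (2 ^ m)%:R)) x.
  have Vit n s y : V (n%:R * s) y = iter n (V s) y.
    elim: n => [|n IH] /=; first by rewrite mul0r V0.
    by rewrite -IH -Vadd -natr1; congr (V _ y); ring.
  by rewrite -Vit mulrCA mulfV ?gt_eqF // mulr1.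
rewrite Vt /euler; move: h1 h2; set h := t / _ => h1 h2.
have hdiff : rnorm (J h x - V h x) <= `|h| * (`|h| * C + e / 2 / (1 + `|t|)).
  have [h0|h0] := eqVneq h 0; first by rewrite h0 resolvent0 V0 subrr rnorm0 normr0 mul0r.
  have -> : J h x - V h x = (J h x - x - h%:C *: T x) - (V h x - x - h%:C *: T x).
    by rewrite subrACA subrr subr0 subrACA subrr subr0.
  apply: le_trans (rnormB _ _) _; rewrite mulrDr; apply: lerD; last exact: hd.
  case: hx => hx1 hx2; rewrite resolvent_step // -scalerBr rnormZr ler_wpM2l //.
  exact: resolvent_small.
apply: le_lt_trans (iter_diff_le (2 ^ m) _ _) _.
- exact: resolvent_lip.
- move=> j; rewrite (_ : rnorm _ = rnorm (J h x - V h x)); first exact: hdiff.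
  elim: j => //= j <-; rewrite -!VJ -VB Vn //.
have E : (2 ^ m)%:R * (`|h| * (`|h| * C + e / 2 / (1 + `|t|))) =
    t ^+ 2 * C / (2 ^ m)%:R + `|t| * (e / 2 / (1 + `|t|)).
  rewrite /h normrM normfV (gtr0_norm n0) -[t ^+ 2]real_normK ?num_real //.
  by field; rewrite !gt_eqF.
rewrite E; have {}h1 := le_lt_trans (ler_norm _) h1.
have h3 : `|t| * (e / 2 / (1 + `|t|)) <= e / 2.
  by rewrite mulrA ler_pdivrMr // mulrC ler_pM2l // lerDr.
lra.
Qed.

Lemma expgroupE t x : expgroup ip T t x = U t x.
Proof.
apply: unitary_group_unique; rewrite /expgroup.
exact: (@xgetI _ _ [set V | unitary_group ip T V] U ugroup_unitary).
Qed.

End resolvent.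

(** * Hilbert bases and weighted norms *)

Lemma fin_eventually m (P : nat -> nat -> Prop) :
  (forall j, (j < m)%N -> exists n0, forall n, (n0 <= n)%N -> P j n) ->
  exists n0, forall n, (n0 <= n)%N -> forall j, (j < m)%N -> P j n.
Proof.
elim: m => [_|m IH h]; first by exists 0%N.
have [n1 h1] := IH (fun j hj => h j (ltnW hj)).
have [n2 h2] := h m (ltnSn m).
exists (maxn n1 n2) => n; rewrite geq_max => /andP[hn1 hn2] j.
by rewrite ltnS leq_eqVlt => /orP[/eqP ->|]; [exact: h2|exact: h1].
Qed.

Section basis.
Context {R : realType} {H : completeNormedModType R[i]}.
Context {ip : {dot H for Num.conj}}.
Hypothesis ip_norm : forall x : H, `|x| ^+ 2 = ip x x.
Variable phi : nat -> H.
Hypothesis phi_basis : hilbert_basis ip phi.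
Implicit Types (x y z : H) (w : nat -> R) (c : nat -> R[i]).

Local Notation coord x j := (ip x (phi j)).

Lemma ip_phi i j : ip (phi i) (phi j) = (i == j)%:R.
Proof. exact: (proj1 phi_basis). Qed.

Lemma rnorm_phi j : rnorm (phi j) = 1.
Proof.
apply/eqP; rewrite -(@eqrXn2 _ 2) ?rnorm_ge0 // (rnorm_sqr ip_norm).
by rewrite ip_phi eqxx expr1n.
Qed.

Definition comb c n : H := \sum_(j < n) c j *: phi j.

Lemma coord_comb c n j : coord (comb c n) j = if (j < n)%N then c j else 0.
Proof.
rewrite /comb ip_suml; case: ifP => [hj|/negbT hj].
  rewrite (bigD1 (Ordinal hj)) //= ipZl ip_phi eqxx mulr1 big1 ?addr0 // => i hi.
  by rewrite ipZl ip_phi (negbTE (_ : i != j :> nat)) ?mulr0.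
rewrite big1 // => i _; rewrite ipZl ip_phi (_ : _ == _ = false) ?mulr0 //.
by apply/negbTE; apply: contraNneq hj => <-.
Qed.

Lemma ip_comb c n y : ip (comb c n) y = \sum_(j < n) c j * Num.conj (coord y j).
Proof. by rewrite ip_suml; apply: eq_bigr => j _; rewrite ipZl -ipC. Qed.

Lemma comb_sqr c n : rnorm (comb c n) ^+ 2 = \sum_(j < n) cmod (c j) ^+ 2.
Proof.
rewrite (rnorm_sqr ip_norm) ip_comb Re_sum; apply: eq_bigr => j _.
by rewrite coord_comb ltn_ord mul_conj_cmod.
Qed.

Lemma combD c c' n : comb (fun j => c j + c' j) n = comb c n + comb c' n.
Proof. by rewrite -big_split; apply: eq_bigr => j _; rewrite scalerDl. Qed.

Lemma combZ a c n : comb (fun j => a * c j) n = a *: comb c n.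
Proof. by rewrite scaler_sumr; apply: eq_bigr => j _; rewrite scalerA. Qed.

Lemma comb_ext c c' n : (forall j, (j < n)%N -> c j = c' j) -> comb c n = comb c' n.
Proof. by move=> h; apply: eq_bigr => j _; rewrite h. Qed.

Lemma cvgs_comb (c : nat -> nat -> R[i]) c' m :
  (forall j, (j < m)%N -> forall e : R, 0 < e -> exists n0, forall n, (n0 <= n)%N ->
     cmod (c n j - c' j) < e) ->
  cvgs (fun n => comb (c n) m) (comb c' m).
Proof.
move=> h e e0; have e1 : 0 < e / m.+1%:R by rewrite divr_gt0.
have [n0 hn] := @fin_eventually m (fun j n => cmod (c n j - c' j) < e / m.+1%:R)
  (fun j hj => h j hj _ e1).
exists n0 => n hnn.
have -> : comb (c n) m - comb c' m = \sum_(j < m) (c n j - c' j) *: phi j.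
  by rewrite -sumrB; apply: eq_bigr => j _; rewrite scalerBl.
apply: (@le_lt_trans _ _ (m%:R * (e / m.+1%:R))).
  apply: rnorm_sum_le => j; rewrite rnormZ rnorm_phi mulr1 ltW //.
  exact: hn.
by rewrite mulrCA gtr_pMr // ltr_pdivrMr // mul1r ltr_nat.
Qed.

Definition bproj n x : H := comb (fun j => coord x j) n.

Lemma proj_lin n a x y : bproj n (a *: x + y) = a *: bproj n x + bproj n y.
Proof.
by rewrite /bproj -combZ -combD; apply: comb_ext => j _; rewrite ipDl ipZl.
Qed.

Lemma coord_proj n x j : coord (bproj n x) j = if (j < n)%N then coord x j else 0.
Proof. exact: coord_comb. Qed.

Lemma proj_adj n x y : ip (bproj n x) y = ip x (bproj n y).
Proof.
rewrite ip_comb ip_sumr; apply: eq_bigr => j _.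
by rewrite ipZr mulrC.
Qed.

Lemma cvgs_proj x : cvgs (fun n => bproj n x) x.
Proof.
apply/cvgsP; have := proj2 phi_basis x; rewrite (_ : series _ = fun n => bproj n x) //.
by apply/funext => n; rewrite /series /= big_mkord.
Qed.

Lemma coord_ext x y : (forall j, coord x j = coord y j) -> x = y.
Proof.
move=> h; apply: cvgs_unique (cvgs_proj x) _.
rewrite (_ : (fun n => _) = (fun n => bproj n y)); first exact: cvgs_proj.
by apply/funext => n; apply: comb_ext.
Qed.

Lemma proj_idem n x : bproj n (bproj n x) = bproj n x.
Proof.
by apply: coord_ext => j; rewrite !coord_proj; case: (j < n)%N.
Qed.

Lemma rnorm_proj n x : rnorm (bproj n x) <= rnorm x.
Proof.
have [->|h] := eqVneq (rnorm (bproj n x)) 0; first exact: rnorm_ge0.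
have h0 : 0 < rnorm (bproj n x) by rewrite lt_def h rnorm_ge0.
rewrite -(ler_pM2l h0) -expr2 (rnorm_sqr ip_norm) proj_adj proj_idem -proj_adj.
apply: le_trans (ler_norm _) _; apply: le_trans (cmod_Re _) _.
exact: cauchy_schwarz.
Qed.

Lemma sum_coord_sqr n x : \sum_(j < n) cmod (coord x j) ^+ 2 <= rnorm x ^+ 2.
Proof.
rewrite -(comb_sqr (fun j => coord x j)).
by rewrite ler_pXn2r ?nnegrE ?rnorm_ge0 //; exact: rnorm_proj.
Qed.

Lemma ip_proj_eq x y x' y' :
  (forall n, ip (bproj n x) y = ip (bproj n x') y') -> ip x y = ip x' y'.
Proof. exact: (ip_cvgs_eq ip_norm (cvgs_proj x) (cvgs_proj x')). Qed.

Lemma parseval x y x' y' :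
  (forall j, coord x j * Num.conj (coord y j) = coord x' j * Num.conj (coord y' j)) ->
  ip x y = ip x' y'.
Proof. by move=> h; apply: ip_proj_eq => n; rewrite !ip_comb; apply: eq_bigr => j _. Qed.

Lemma riesz_fischer c (M : R) : (forall n, \sum_(j < n) cmod (c j) ^+ 2 <= M) ->
  exists x, forall j, coord x j = c j.
Proof.
move=> hM; pose s n := \sum_(j < n) cmod (c j) ^+ 2.
have s_nd : {homo s : n m / (n <= m)%N >-> n <= m}.
  apply/nondecreasing_seqP => n.
  by rewrite /s big_ord_recr lerDl sqr_ge0.
have comb_dist n k : rnorm (comb c (n + k) - comb c n) ^+ 2 = s (n + k)%N - s n.
  have -> : comb c (n + k) - comb c n =
      comb (fun j => if (n <= j)%N then c j else 0) (n + k).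
    apply: coord_ext => j; rewrite ipBl !coord_comb.
    case: (ltnP j n) => hj; first by rewrite (ltn_addr _ hj) subrr.
    by rewrite subr0; case: ifP.
  rewrite comb_sqr /s !big_split_ord /= addrAC subrr add0r.
  rewrite [X in X + _]big1 ?add0r => [|i _]; last first.
    by rewrite leqNgt ltn_ord /= cmod0 expr0n.
  by apply: eq_bigr => i _; rewrite leq_addr.
have s_cvg : cvg (s @ \oo).
  apply: nondecreasing_is_cvgn => //.
  by exists M => _ [n _ <-]; exact: hM.
have [x hx] : exists x, cvgs (comb c) x.
  apply: cvgs_cauchy => e e0; have e2 : 0 < e / 2 by rewrite divr_gt0.
  have e4 : 0 < (e / 2) ^+ 2 by rewrite exprn_gt0.
  have /cvgrPdist_lt /(_ _ e4) [n0 _ hn] := s_cvg.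
  have hd n : (n0 <= n)%N -> rnorm (comb c n - comb c n0) < e / 2.
    move=> hnn; rewrite -(@ltr_pXn2r _ 2) ?nnegrE ?rnorm_ge0 // ?ltW //.
    rewrite -(subnKC hnn) comb_dist subnKC //.
    have := hn n0 (leqnn n0) => /= h1.
    have h2 : s n <= lim (s @ \oo) by exact: nondecreasing_cvgn_le.
    by have := le_lt_trans (ler_norm _) h1; lra.
  exists n0 => n m h1 h2; apply: le_lt_trans (rnorm_tri _ (comb c n0) _) _.
  by rewrite (rnorm_sub _ (comb c m)); have := hd _ h1; have := hd _ h2; lra.
exists x => j; apply/eqP; rewrite -subr_eq0; apply/eqP/cmod_eq0/eqP.
rewrite eq_le cmod_ge0 andbT; apply/ler_addgt0Pr => e e0; rewrite add0r.
have [n0 hn] := cvgs_ipl ip_norm (phi j) hx e0.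
have := hn _ (leq_maxl n0 j.+1).
by rewrite coord_comb leq_max leqnn orbT -opprB cmodN => /ltW.
Qed.

(** A bound on the norm with weights w, through partial sums so that it makes
    sense for every vector of H *)
Definition wnorm_le w x M := forall n, rnorm (comb (fun j => (w j)%:C * coord x j) n) <= M.

Lemma wnorm_leP w x M : 0 <= M ->
  wnorm_le w x M <-> (forall n, \sum_(j < n) w j ^+ 2 * cmod (coord x j) ^+ 2 <= M ^+ 2).
Proof.
have E n : \sum_(j < n) w j ^+ 2 * cmod (coord x j) ^+ 2 =
    rnorm (comb (fun j => (w j)%:C * coord x j) n) ^+ 2.
  rewrite comb_sqr; apply: eq_bigr => j _.
  by rewrite cmodM cmodR exprMn real_normK ?num_real.
by move=> M0; split=> h n; have := h n; rewrite ?E ler_pXn2r ?nnegrE ?rnorm_ge0.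
Qed.

Lemma wnorm_le_ge0 w x M : wnorm_le w x M -> 0 <= M.
Proof. by move=> /(_ 0%N); apply: le_trans; exact: rnorm_ge0. Qed.

Lemma wnorm_le_mono w x M M' : M <= M' -> wnorm_le w x M -> wnorm_le w x M'.
Proof. by move=> hM h n; exact: le_trans (h n) hM. Qed.

Lemma wnorm_le0 w M : 0 <= M -> wnorm_le w 0 M.
Proof.
move=> M0 n; rewrite (_ : comb _ n = 0) ?rnorm0 //.
by apply: big1 => j _; rewrite ip0l mulr0 scale0r.
Qed.

Lemma wnorm_leD w x y M M' : wnorm_le w x M -> wnorm_le w y M' ->
  wnorm_le w (x + y) (M + M').
Proof.
move=> hx hy n; rewrite (@comb_ext _ (fun j => (w j)%:C * coord x j + (w j)%:C * coord y j)).
  by rewrite combD; apply: le_trans (rnormD _ _) (lerD (hx n) (hy n)).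
by move=> j _; rewrite ipDl mulrDr.
Qed.

Lemma wnorm_leZ w x a M : wnorm_le w x M -> wnorm_le w (a *: x) (cmod a * M).
Proof.
move=> hx n; rewrite (@comb_ext _ (fun j => a * ((w j)%:C * coord x j))).
  by rewrite combZ rnormZ ler_wpM2l ?cmod_ge0.
by move=> j _; rewrite ipZl mulrCA.
Qed.

Lemma wnorm_leN w x M : wnorm_le w x M -> wnorm_le w (- x) M.
Proof.
by move=> /(wnorm_leZ (-1)); rewrite scaleN1r cmodN cmod1 mul1r.
Qed.

Lemma wnorm_leB w x y M M' : wnorm_le w x M -> wnorm_le w y M' ->
  wnorm_le w (x - y) (M + M').
Proof. by move=> hx /wnorm_leN; exact: wnorm_leD. Qed.

Lemma wnorm_le_sum w n (F : 'I_n -> H) M : (forall i, wnorm_le w (F i) M) ->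
  0 <= M -> wnorm_le w (\sum_(i < n) F i) (n%:R * M).
Proof.
move=> hF M0; elim: n F hF => [|n IH] F hF.
  by rewrite big_ord0 mul0r; exact: wnorm_le0.
rewrite big_ord_recr -natr1 mulrDl mul1r; apply: wnorm_leD => //.
by apply: IH => i.
Qed.

(** Each partial sum depends on finitely many coordinates, which converge. *)
Lemma wnorm_le_lim w (u : nat -> H) x M n0 :
  (forall j (e : R), 0 < e -> exists n0, forall n, (n0 <= n)%N ->
     cmod (coord (u n) j - coord x j) < e) ->
  (forall n, (n0 <= n)%N -> wnorm_le w (u n) M) -> wnorm_le w x M.
Proof.
move=> hu hM m; apply: (cvgs_rnorm_le (u := fun n =>
  comb (fun j => (w j)%:C * coord (u n) j) m) (n0 := n0)).
  by move=> n hn; exact: hM.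
apply: cvgs_comb => j _ e e0.
have w1 : 0 < 1 + `|w j| by rewrite ltr_pwDl.
have [n1 hn] := hu j _ (divr_gt0 e0 w1); exists n1 => n /hn.
rewrite ltr_pdivlMr // -mulrBr cmodM cmodR => /(le_lt_trans _); apply.
by rewrite mulrC ler_wpM2l ?cmod_ge0 // lerDr.
Qed.

Lemma wnorm_le_cvgs w (u : nat -> H) x M n0 : cvgs u x ->
  (forall n, (n0 <= n)%N -> wnorm_le w (u n) M) -> wnorm_le w x M.
Proof. by move=> hu; apply: wnorm_le_lim => j e; exact: (cvgs_ipl ip_norm). Qed.

Lemma wnorm_le_comb w c n : exists M, wnorm_le w (comb c n) M.
Proof.
exists (\sum_(j < n) rnorm (((w j)%:C * c j) *: phi j)) => m.
apply: le_trans (_ : rnorm (comb (fun j => (w j)%:C * c j) n) <= _); last exact: rnorm_sum.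
rewrite -(@ler_pXn2r _ 2) ?nnegrE ?rnorm_ge0 //.
rewrite (_ : comb _ m = bproj m (comb (fun j => (w j)%:C * c j) n)).
  by rewrite ler_pXn2r ?nnegrE ?rnorm_ge0 // rnorm_proj.
by apply: comb_ext => j _; rewrite !coord_comb; case: ifP; rewrite ?mulr0.
Qed.

(** The weighted coordinates of x are square-summable, hence those of a vector,
    whose expansion converges. *)
Lemma wnorm_le_tail w x M (e : R) : wnorm_le w x M -> 0 < e ->
  exists n, wnorm_le w (x - bproj n x) e.
Proof.
move=> hx e0.
have M0 := wnorm_le_ge0 hx.
have hM n : \sum_(j < n) cmod ((w j)%:C * coord x j) ^+ 2 <= M ^+ 2.
  by rewrite -(comb_sqr (fun j => (w j)%:C * coord x j)) ler_pXn2r ?nnegrE ?rnorm_ge0.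
have [y hy] := @riesz_fischer (fun j => (w j)%:C * coord x j) _ hM.
have [n hn] := cvgs_proj y e0; exists n => m.
apply: le_trans (ltW (hn n (leqnn n))).
rewrite rnorm_sub; apply: le_trans (rnorm_proj m _).
rewrite le_eqVlt; apply/orP; left; apply/eqP; congr rnorm.
apply: comb_ext => j _; rewrite !ipBl !coord_proj.
by case: ifP => _; rewrite ?subrr ?subr0 ?mulr0 ?hy.
Qed.

End basis.

Arguments bproj {R H} ip phi n x.
Arguments wnorm_le {R H} ip phi w x M.

(** * Spectral measures of eigenvectors *)

Section eq_integral.
Import HBNNSimple.

Lemma eq_integral_measurable_sets d (T : measurableType d) (R : realType)
    (m1 m2 : set T -> \bar R) (f : T -> \bar R) :
  (forall F, measurable F -> m1 F = m2 F) ->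
  (\int[m1]_x f x = \int[m2]_x f x)%E.
Proof.
move=> h; rewrite /integral; congr (_ - _)%E; congr ereal_sup;
  apply/seteqP; split=> _ [g hg <-] /=; exists g => //;
  rewrite /sintegral; apply: eq_fsbigr => r _; congr (_ * _)%E; rewrite h //;
  exact/measurable_funPTI.
Qed.

End eq_integral.

Section pvm_theory.
Context {R : realType} {H : completeNormedModType R[i]}.
Context {ip : {dot H for Num.conj}}.
Hypothesis ip_norm : forall x : H, `|x| ^+ 2 = ip x x.
Variable E : set (measurableTypeR R) -> H -> H.
Hypothesis E_pvm : pvm ip E.
Implicit Types (x y : H) (F G : set (measurableTypeR R)).

Lemma pvmB F x y : measurable F -> E F (x - y) = E F x - E F y.
Proof. by move=> mF; rewrite addrC -scaleN1r (pvm_linear E_pvm) // scaleN1r addrC. Qed.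

Lemma pvmC F G x : measurable F -> measurable G -> E F (E G x) = E G (E F x).
Proof. by move=> mF mG; rewrite -!(pvm_cap E_pvm) // setIC. Qed.

Lemma pvm_ip F x : measurable F -> ip (E F x) x = (rnorm (E F x) ^+ 2)%:C.
Proof.
move=> mF; rewrite -(ip_self ip_norm) (pvm_self_adjoint E_pvm) //.
by rewrite [in RHS](pvm_self_adjoint E_pvm) // -(pvm_cap E_pvm) // setIid.
Qed.

Lemma specmeasE F x : measurable F -> specmeas ip E x F = (rnorm (E F x) ^+ 2)%:E.
Proof. by move=> mF; rewrite /specmeas pvm_ip. Qed.

Lemma pvm_set0 x : E set0 x = 0.
Proof.
have hs : semi_sigma_additive (specmeas ip E x) :=
  @pvm_sigma_additive _ _ _ _ E_pvm x.
have tF : trivIset setT (fun _ : nat => set0 : set (measurableTypeR R)).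
  by apply/trivIsetP => i j _ _ _; rewrite set0I.
have mU : measurable (\bigcup_(n : nat) (set0 : set (measurableTypeR R))).
  by rewrite bigcup0.
have := hs (fun=> set0) (fun=> measurable0) tF mU.
rewrite bigcup0 // specmeasE //; set c := rnorm _ ^+ 2 => h.
have {}h : (fun n : nat => n%:R * c) @ \oo --> c.
  move/fine_cvgP: h => [_ h].
  apply: cvg_trans h; apply: near_eq_cvg; apply: nearW => n /=.
  by rewrite sumEFin big_const_nat subn0 iter_addr addr0 mulr_natl.
have c0 : c = 0.
  have h1 : (fun n : nat => n.+1%:R * c) @ \oo --> c.
    by rewrite -(cvg_shiftS (fun n : nat => n%:R * c)) in h.
  have h2 : (fun n : nat => n.+1%:R * c - n%:R * c) @ \oo --> c - c by exact: cvgB.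
  have h3 : (fun n : nat => n.+1%:R * c - n%:R * c) @ \oo --> c.
    rewrite (_ : (fun n => _) = cst c); first exact: cvg_cst.
    by apply/funext => n; rewrite -natr1 mulrDl mul1r addrC addKr.
  by rewrite -(cvg_lim _ h3) // (cvg_lim _ h2) // subrr.
apply/rnorm_eq0/eqP; have /eqP : c = 0 by [].
by rewrite expf_eq0.
Qed.

(** The spectral measure of x; projections are only constrained on Borel sets. *)
Definition pvm_measure (x : H) (F : set (measurableTypeR R)) : \bar R :=
  if `[< measurable F >] then specmeas ip E x F else 0%E.

Let pvm_measure0 x : pvm_measure x set0 = 0%E.
Proof.
by rewrite /pvm_measure; case: asboolP => // m0; rewrite specmeasE // pvm_set0 rnorm0 expr0n.
Qed.

Let pvm_measure_ge0 x F : (0 <= pvm_measure x F)%E.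
Proof.
rewrite /pvm_measure; case: asboolP => // mF.
by rewrite specmeasE // lee_fin sqr_ge0.
Qed.

Lemma pvm_measureE x F : measurable F -> pvm_measure x F = specmeas ip E x F.
Proof. by move=> mF; rewrite /pvm_measure asboolT. Qed.

Let pvm_measure_sigma x : semi_sigma_additive (pvm_measure x).
Proof.
move=> F mF tF mU; rewrite pvm_measureE //.
have hs : semi_sigma_additive (specmeas ip E x) :=
  @pvm_sigma_additive _ _ _ _ E_pvm x.
apply: cvg_trans (hs F mF tF mU); apply: near_eq_cvg; apply: nearW => n /=.
by apply: eq_bigr => i _; rewrite pvm_measureE.
Qed.

HB.instance Definition _ x := isMeasure.Build _ _ _ (pvm_measure x)
  (pvm_measure0 x) (pvm_measure_ge0 x) (@pvm_measure_sigma x).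

Lemma pvm_measure_fin F x : measurable F -> pvm_measure x F = (rnorm (E F x) ^+ 2)%:E.
Proof. by move=> mF; rewrite pvm_measureE // specmeasE. Qed.

Lemma integral_pvm_measure x (f : R -> \bar R) :
  (\int[specmeas ip E x]_l f l = \int[pvm_measure x]_l f l)%E.
Proof. by apply: eq_integral_measurable_sets => F mF; rewrite pvm_measureE. Qed.


Variable Q : linop H.
Hypothesis Q_sym : forall x y, dom Q x -> dom Q y -> ip (Q x) y = ip x (Q y).
Hypothesis Q_spec : spectral_integral ip E (fun l => l) Q.

(** Rotating the component E F x by a unit scalar does not change the spectral
    measure, hence not the quadratic form of Q either; so Q does not couple
    E F x and its complement. *)
Lemma spectral_part x F : dom Q x -> measurable F ->
  dom Q (E F x) /\ ip (Q x) (E F x) = ip (Q (E F x)) (E F x).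
Proof.
move=> hx mF; pose a := E F x; have [b bE] : exists b, b = x - a by exists (x - a).
have hba : b + a = x by rewrite bE subrK.
have rot (c : R[i]) G : cmod c = 1 -> measurable G ->
    specmeas ip E (b + c *: a) G = specmeas ip E x G.
  move=> c1 mG; pose p := E G (E F x).
  have p1 : E G a = p by [].
  have p2 : E F p = p.
    by rewrite /p (pvmC x mG mF) -(pvm_cap E_pvm) // setIid.
  have cross : ip (E G b) a = 0 /\ ip p b = 0.
    split; last first.
      by rewrite bE ipBr -[X in ip X x]p2 (pvm_self_adjoint E_pvm mF p x) subrr.
    rewrite (pvm_self_adjoint E_pvm mG b a) p1 bE ipBl.
    by rewrite -[X in ip x X]p2 -(pvm_self_adjoint E_pvm mF x p) subrr.
  have gen (d : R[i]) : ip (E G (b + d *: a)) (b + d *: a) =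
      ip (E G b) b + d * Num.conj d * ip p a.
    rewrite addrC (pvm_linear E_pvm) // p1 ipDl !ipDr !ipZl !ipZr.
    by rewrite cross.1 cross.2 !mulr0 add0r addr0 addrC mulrA.
  rewrite /specmeas gen mul_conj_cmod c1 expr1n mul1r.
  by have := gen 1; rewrite scale1r hba mul_conj_cmod cmod1 expr1n mul1r => ->.
have int_rot (c : R[i]) (f : R -> \bar R) : cmod c = 1 ->
    (\int[specmeas ip E (b + c *: a)%R]_l f l = \int[specmeas ip E x]_l f l)%E.
  by move=> c1; apply: eq_integral_measurable_sets => G; exact: rot.
case: Q_spec => Q_dom Q_form.
have dom_rot (c : R[i]) : cmod c = 1 -> dom Q (b + c *: a).
  by move=> c1; rewrite Q_dom /= int_rot //; move: hx; rewrite Q_dom.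
have c1 := @cmod1 R; have cN1 : cmod (-1 : R[i]) = 1 by rewrite cmodN cmod1.
have hxE : x = b + 1 *: a by rewrite scale1r hba.
have da : dom Q a.
  have -> : a = 2^-1 *: (x - (b + (-1) *: a)).
    rewrite scaleN1r bE -addrA -opprD opprB addrC subrK -mulr2n -[a *+ 2]scaler_nat.
    by rewrite scalerA mulVf ?scale1r ?pnatr_eq0.
  by apply: domZ; apply: domB => //; exact: dom_rot.
have db : dom Q b by rewrite bE; exact: domB.
split=> //; pose q := ip (Q a) b.
have form (c : R[i]) : cmod c = 1 -> c * q + Num.conj (c * q) = q + Num.conj q.
  move=> cc; have h0 : ip (Q (b + c *: a)) (b + c *: a) = ip (Q (b + 1 *: a)) (b + 1 *: a).
    rewrite (Q_form _ (dom_rot c cc)) (Q_form _ (dom_rot 1 c1)).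
    by rewrite (int_rot c) // (int_rot 1).
  have gen (d : R[i]) : cmod d = 1 -> ip (Q (b + d *: a)) (b + d *: a) =
      ip (Q b) b + ip (Q a) a + (d * q + Num.conj (d * q)).
    move=> dd; rewrite appD ?appZ //; last exact: domZ.
    rewrite ipDl !ipDr !ipZl !ipZr.
    have -> : ip (Q b) a = Num.conj q by rewrite /q -ipC Q_sym.
    have : d * Num.conj d = 1 by rewrite mul_conj_cmod dd expr1n.
    rewrite conjcM => h1; rewrite (mulrA d) h1; ring.
  by move: h0; rewrite !gen // => /addrI ->; rewrite mul1r.
have q0 : q = 0.
  have := form _ cN1; have := form _ (@cmod_i _).
  rewrite mulN1r; case: q {form} => u v /(congr1 (@complex.Re R)) /=.
  move=> h1 /(congr1 (@complex.Re R)) /= h2.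
  by apply: complex_eq_Re_Im => /=; lra.
rewrite -/a [in LHS]hxE scale1r appD // ipDl.
by rewrite (_ : ip (Q b) a = 0) ?add0r // Q_sym // ipC -/q q0 conjC0.
Qed.

Lemma pvm_part_setC F x : measurable F -> E (~` F) (E F x) = 0.
Proof.
move=> mF; rewrite -(pvm_cap E_pvm) ?setICl ?pvm_set0 //.
exact: measurableC.
Qed.

(** The part of x in F is still an eigenvector for mu by spectral_part, so that
    the mean of its spectral measure is mu. *)
Lemma eigen_integral x (mu : R) F : dom Q x -> Q x = mu%:C *: x -> measurable F ->
  let m := pvm_measure (E F x) in let M := rnorm (E F x) ^+ 2 in
  [/\ m F = M%:E, m.-integrable setT (fun l => l%:E) &
      (\int[m]_(l in F) l%:E = (mu * M)%:E)%E].
Proof.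
move=> hx Qx mF m M.
have [ha hQa] := spectral_part hx mF.
have mFM : m F = M%:E.
  by rewrite /m pvm_measure_fin // -(pvm_cap E_pvm) // setIid.
have mT : m setT = M%:E by rewrite /m pvm_measure_fin // (pvm_setT E_pvm).
have sq_fin : (\int[m]_l (l ^+ 2)%:E < +oo)%E.
  by move: ha; rewrite (proj1 Q_spec) /= integral_pvm_measure.
have habs (l : R) : `|l| <= `|1 + l ^+ 2|.
  rewrite [leRHS]ger0_norm ?addr_ge0 ?sqr_ge0 // -[l ^+ 2]real_normK ?num_real //.
  by have := sqr_ge0 (`|l| - 1); have := normr_ge0 l; nra.
have intm : m.-integrable setT (fun l : R => l%:E).
  apply: (@le_integrable _ _ _ m setT measurableT _ (fun l : R => (1 + l ^+ 2)%:E)).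
  - exact/measurable_EFinP.
  - by move=> l _; exact: habs.
  apply/integrableP; split.
    by apply/measurable_EFinP; apply: measurable_funD.
  apply: (@le_lt_trans _ _ (\int[m]_l (1%:E + (l ^+ 2)%:E))%E).
    rewrite le_eqVlt; apply/orP; left; apply/eqP; apply: eq_integral => l _.
    by rewrite gee0_abs ?EFinD // adde_ge0 // lee_fin ?ler01 ?sqr_ge0.
  rewrite ge0_integralD //; first last.
  - exact/measurable_EFinP/measurable_funX.
  - by move=> l _; rewrite lee_fin sqr_ge0.
  apply: lte_add_pinfty; last exact: sq_fin.
  have hc : (\int[m]_l (cst 1%:E l) = M%:E)%E.
    by rewrite integral_cst // mul1e; exact: mT.
  by move: hc => /= ->; rewrite ltry.
split=> //.
have hval : (\int[m]_l l%:E = (mu * M)%:E)%E.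
  have hfin : (\int[m]_l l%:E)%E \is a fin_num by exact: integrable_fin_num.
  rewrite -(fineK hfin); congr _%:E.
  have := proj2 Q_spec _ ha; rewrite -hQa Qx ipZl integral_pvm_measure.
  rewrite (ipC x) pvm_ip // conjcr -realCM => /(congr1 (@complex.Re R)) /= -> //.
rewrite -hval (@negligible_integral _ _ _ m setT (~` F)) //.
- by rewrite setTD setCK.
- exact: measurableC.
transitivity (rnorm (E (~` F) (E F x)) ^+ 2)%:E.
  by apply: pvm_measure_fin; exact: measurableC.
by rewrite pvm_part_setC // rnorm0 expr0n.
Qed.

(** A measure carried by one side of mu, away from mu, cannot have mean mu unless
    it vanishes. *)
Lemma eigen_part0 x (mu d : R) F : dom Q x -> Q x = mu%:C *: x -> measurable F ->
  0 < d -> (forall l, F l -> mu + d <= l) \/ (forall l, F l -> l <= mu - d) ->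
  E F x = 0.
Proof.
move=> hx Qx mF d0 hF.
pose M := rnorm (E F x) ^+ 2.
have [m [mFM intm hval]] : exists m : {measure set (measurableTypeR R) -> \bar R},
    [/\ m F = M%:E, m.-integrable setT (fun l => l%:E) &
      (\int[m]_(l in F) l%:E = (mu * M)%:E)%E].
  by exists (pvm_measure (E F x)); exact: eigen_integral.
have intF : m.-integrable F (fun l => l%:E) by exact: (integrableS measurableT).
have intc c : m.-integrable F (cst c%:E).
  apply/integrableP; split; first exact: measurable_cst.
  by rewrite /= integral_cst // mFM -EFinM ltry.
have cstE c : (\int[m]_(l in F) (cst c%:E) l = (c * M)%:E)%E.
  by rewrite integral_cst // mFM.
suff M0 : M <= 0.
  apply/rnorm_eq0/eqP; have /eqP : M = 0 by apply/eqP; rewrite eq_le M0 sqr_ge0.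
  by rewrite expf_eq0.
case: hF => hF.
  have : (\int[m]_(l in F) (cst (mu + d)%:E) l <= \int[m]_(l in F) l%:E)%E.
    by apply: le_integral => // l; rewrite inE => /hF; rewrite lee_fin.
  by rewrite cstE hval lee_fin; nra.
have : (\int[m]_(l in F) l%:E <= \int[m]_(l in F) (cst (mu - d)%:E) l)%E.
  by apply: le_integral => // l; rewrite inE => /hF; rewrite lee_fin.
by rewrite cstE hval lee_fin; nra.
Qed.

(** The complement of mu is a countable union of half-lines at positive distance
    from mu, none of which is charged. *)
Lemma eigen_concentrated x (mu : R) F : dom Q x -> Q x = mu%:C *: x ->
  measurable F -> E F x = if `[< F mu >] then x else 0.
Proof.
move=> hx Qx mF.
have meas y : exists m : {measure set (measurableTypeR R) -> \bar R},
    forall G, measurable G -> m G = (rnorm (E G y) ^+ 2)%:E.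
  by exists (pvm_measure y) => G; exact: pvm_measure_fin.
have [m hm] := meas x.
have null : m (~` [set mu]) = 0%E.
  have -> : ~` [set mu] = (\bigcup_n [set l | mu + n.+1%:R^-1 <= l]) `|`
      (\bigcup_n [set l | l <= mu - n.+1%:R^-1]).
    apply/seteqP; split=> l /=; last first.
      case=> -[n _ /= hn] hl; have : (0 : R) < n.+1%:R^-1 by rewrite invr_gt0.
        by move: hn; rewrite hl; move: (_^-1) => v; lra.
      by move: hn; rewrite hl; move: (_^-1) => v; lra.
    move=> /eqP; rewrite neq_lt => /orP[] hl; [right|left];
      rewrite -subr_gt0 in hl; have [n /(_ n (leqnn n)) hn] := inv_natr_small hl;
      exists n => //=; move: hn; move: (_^-1) => v; lra.
  have mup n : measurable ([set l | mu + n.+1%:R^-1 <= l] : set (measurableTypeR R)).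
    rewrite (_ : [set l | _] = `[mu + n.+1%:R^-1, +oo[%classic); first exact: measurable_itv.
    by apply/seteqP; split=> l /=; rewrite in_itv /= andbT.
  have mdn n : measurable ([set l | l <= mu - n.+1%:R^-1] : set (measurableTypeR R)).
    rewrite (_ : [set l | _] = `]-oo, mu - n.+1%:R^-1]%classic); first exact: measurable_itv.
    by apply/seteqP; split=> l /=; rewrite in_itv.
  apply/negligibleP; first by apply: measurableU; exact: bigcupT_measurable.
  apply: negligibleU; apply: negligible_bigcup => n.
    apply: (proj2 (negligibleP m (mup n))); apply: etrans (hm _ (mup n)) _.
    rewrite (@eigen_part0 x mu n.+1%:R^-1) ?rnorm0 ?expr0n ?invr_gt0 //.
    by left.
  apply: (proj2 (negligibleP m (mdn n))); apply: etrans (hm _ (mdn n)) _.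
  rewrite (@eigen_part0 x mu n.+1%:R^-1) ?rnorm0 ?expr0n ?invr_gt0 //.
  by right.
have zero G : measurable G -> ~ G mu -> E G x = 0.
  move=> mG hG; apply/rnorm_eq0/eqP.
  have : (m G <= 0)%E.
    rewrite -null le_measure ?inE //.
      by apply: measurableC; rewrite -set_itv1; exact: measurable_itv.
    by move=> l Gl /= hl; apply: hG; rewrite -hl.
  rewrite hm // lee_fin => h.
  have /eqP : rnorm (E G x) ^+ 2 = 0 by apply/eqP; rewrite eq_le h sqr_ge0.
  by rewrite expf_eq0.
case: asboolP => hF; last exact: zero.
apply/eqP; rewrite -subr_eq0; apply/eqP/rnorm_eq0/eqP.
have mC : measurable (~` F) by exact: measurableC.
have h1 : E F (E F x - x) = 0 by rewrite pvmB // -(pvm_cap E_pvm) // setIid subrr.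
have h2 : E (~` F) (E F x - x) = 0 by rewrite pvmB // pvm_part_setC // zero // subrr.
have [m' hm'] := meas (E F x - x).
have : (m' (~` F `|` F) = m' (~` F) + m' F)%E.
  by apply: measureU => //; exact: setICl.
rewrite setvU !hm' // h1 h2 rnorm0 expr0n adde0 (pvm_setT E_pvm) => -[h].
by have /eqP := h; rewrite expf_eq0 rnorm_sub.
Qed.

End pvm_theory.

(** * Diagonal operators *)

Section nonneg_series.
Context {R : realType}.
Implicit Types a : nat -> R.

Lemma nneg_series_partial_le a n : (forall k, 0 <= a k) ->
  ((\sum_(j < n) a j)%:E <= \sum_(0 <= k <oo) (a k)%:E)%E.
Proof.
move=> a0; apply: le_trans (nneseries_lim_ge n _).
  by rewrite big_mkord sumEFin.
by move=> k _ _; rewrite lee_fin.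
Qed.

Lemma nneg_series_finP a : (forall k, 0 <= a k) ->
  (\sum_(0 <= k <oo) (a k)%:E < +oo)%E <-> exists M, forall n, \sum_(j < n) a j <= M.
Proof.
move=> a0; split=> [h|[M hM]].
  exists (fine (\sum_(0 <= k <oo) (a k)%:E)%E) => n.
  rewrite -lee_fin fineK; first exact: nneg_series_partial_le.
  by rewrite ge0_fin_numE // nneseries_ge0 // => k _ _; rewrite lee_fin.
apply: (@le_lt_trans _ _ M%:E); last exact: ltry.
apply: lime_le.
  by apply: is_cvg_nneseries => k _ _; rewrite lee_fin.
by apply: nearW => n; rewrite big_mkord sumEFin lee_fin.
Qed.

Lemma cvg_nneg_series a : (forall k, 0 <= a k) ->
  (exists M, forall n, \sum_(j < n) a j <= M) ->
  (fun n => \sum_(j < n) a j) @ \oo --> fine (\sum_(0 <= k <oo) (a k)%:E)%E.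
Proof.
move=> a0 /(proj2 (nneg_series_finP a0)) hfin.
have h0 : (0 <= \sum_(0 <= k <oo) (a k)%:E)%E.
  by apply: nneseries_ge0 => k _ _; rewrite lee_fin.
have hc : cvg ((fun n => \sum_(0 <= k < n) (a k)%:E)%E @ \oo).
  by apply: is_cvg_nneseries => k _ _; rewrite lee_fin.
have /fine_cvgP [_] : (fun n => \sum_(0 <= k < n) (a k)%:E)%E @ \oo -->
    (fine (\sum_(0 <= k <oo) (a k)%:E)%E)%:E.
  by rewrite fineK ?ge0_fin_numE.
apply: cvg_trans; apply: near_eq_cvg; apply: nearW => n /=.
by rewrite big_mkord sumEFin.
Qed.

End nonneg_series.

Section diagonal_operators.
Context {R : realType} {H : completeNormedModType R[i]}.
Context {ip : {dot H for Num.conj}}.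
Hypothesis ip_norm : forall x : H, `|x| ^+ 2 = ip x x.
Variable phi : nat -> H.
Hypothesis phi_basis : hilbert_basis ip phi.
Implicit Types (x y : H) (w : nat -> R).

Local Notation coord x j := (ip x (phi j)).

Definition diag_dom w : set H := [set x | exists M, wnorm_le ip phi w x M].

Definition diag_app w x : H :=
  xget 0 [set y | forall j, coord y j = (w j)%:C * coord x j].

Lemma coord_diag w x j : diag_dom w x -> coord (diag_app w x) j = (w j)%:C * coord x j.
Proof.
move=> [M hM]; have M0 := wnorm_le_ge0 hM.
have hM2 n : \sum_(j < n) cmod ((w j)%:C * coord x j) ^+ 2 <= M ^+ 2.
  rewrite -(comb_sqr ip_norm phi_basis (fun j => (w j)%:C * coord x j)).
  by rewrite ler_pXn2r ?nnegrE ?rnorm_ge0.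
have [y hy] := @riesz_fischer _ _ _ ip_norm _ phi_basis
  (fun j => (w j)%:C * coord x j) _ hM2.
exact: (@xgetI _ 0 [set y | forall j, coord y j = (w j)%:C * coord x j] y hy).
Qed.

Lemma diag_dom0 w : diag_dom w 0.
Proof. by exists 0; exact: wnorm_le0. Qed.

Lemma diag_domP w (a : R[i]) x y : diag_dom w x -> diag_dom w y ->
  diag_dom w (a *: x + y).
Proof.
move=> [M hM] [M' hM']; exists (cmod a * M + M').
by apply: wnorm_leD => //; exact: wnorm_leZ.
Qed.

Lemma diag_appP w (a : R[i]) x y : diag_dom w x -> diag_dom w y ->
  diag_app w (a *: x + y) = a *: diag_app w x + diag_app w y.
Proof.
move=> hx hy; apply: (coord_ext phi_basis) => j.
rewrite coord_diag; last exact: diag_domP.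
by rewrite !ipDl !ipZl !coord_diag // mulrDr mulrCA.
Qed.

Definition diagop w : linop H :=
  @Linop R H (diag_dom w) (diag_app w) (diag_dom0 w) (@diag_domP w) (@diag_appP w).

Lemma diag_domE w x : diag_dom w x <->
  exists M, forall n, \sum_(j < n) w j ^+ 2 * cmod (coord x j) ^+ 2 <= M.
Proof.
split=> [[M hM]|[M hM]].
  by exists (M ^+ 2); apply/(wnorm_leP ip_norm phi_basis w x (wnorm_le_ge0 hM)).
have M0 : 0 <= M by have := hM 0%N; rewrite big_ord0.
exists (Num.sqrt M); apply/(wnorm_leP ip_norm phi_basis); first exact: sqrtr_ge0.
by rewrite sqr_sqrtr.
Qed.

Lemma diag_dom_comb w c n : diag_dom w (comb phi c n).
Proof. exact: wnorm_le_comb. Qed.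

Lemma diag_dom_phi w j : diag_dom w (phi j).
Proof.
have -> : phi j = comb phi (fun i => (i == j)%:R) j.+1.
  apply: (coord_ext phi_basis) => i; rewrite coord_comb // ip_phi // eq_sym.
  by case: ltnP => // /gtn_eqF; rewrite eq_sym => ->.
exact: diag_dom_comb.
Qed.

Lemma rnorm_diag_le w x M : diag_dom w x -> 0 <= M ->
  rnorm (diag_app w x) <= M <-> wnorm_le ip phi w x M.
Proof.
move=> hx M0.
have E n : comb phi (fun j => (w j)%:C * coord x j) n = bproj ip phi n (diag_app w x).
  by apply: comb_ext => j _; rewrite coord_diag.
split=> h.
  by move=> n; rewrite E; apply: le_trans h; exact: rnorm_proj.
apply: (cvgs_rnorm_le (n0 := 0%N) _ (cvgs_proj phi_basis (diag_app w x))) => n _.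
by rewrite -E.
Qed.

Lemma diag_form_bounded w x : (forall j, 0 <= w j) -> diag_dom w x ->
  exists M, forall n, \sum_(j < n) w j * cmod (coord x j) ^+ 2 <= M.
Proof.
move=> w0 /diag_domE [M hM]; exists (rnorm x ^+ 2 + M) => n.
apply: le_trans (lerD (sum_coord_sqr ip_norm phi_basis n x) (hM n)).
rewrite -big_split; apply: ler_sum => j _ /=.
rewrite -[X in X + _]mul1r -mulrDl ler_wpM2r ?sqr_ge0 //.
by have := sqr_ge0 (w j - 1); have := w0 j; nra.
Qed.

Lemma diag_form w x : (forall j, 0 <= w j) -> diag_dom w x ->
  ip (diag_app w x) x =
    (fine (\sum_(0 <= k <oo) (w k * cmod (coord x k) ^+ 2)%:E)%E)%:C.
Proof.
move=> w0 hx; have hb := diag_form_bounded w0 hx.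
have h1 : (fun n => \sum_(j < n) w j * cmod (coord x j) ^+ 2) @ \oo -->
    fine (\sum_(0 <= k <oo) (w k * cmod (coord x k) ^+ 2)%:E)%E.
  by apply: cvg_nneg_series => // k; rewrite mulr_ge0 ?sqr_ge0.
have h2 : (fun n => \sum_(j < n) w j * cmod (coord x j) ^+ 2) @ \oo -->
    complex.Re (ip (diag_app w x) x).
  apply/cvgrPdist_lt => e e0.
  have [n0 hn] := cvgs_ipl ip_norm x (cvgs_proj phi_basis (diag_app w x)) e0.
  exists n0 => // n /= /hn; apply: le_lt_trans.
  rewrite -cmodN opprB; apply: le_trans (cmod_Re _); rewrite ReB.
  rewrite le_eqVlt; apply/orP; left; apply/eqP; congr `|_ - _|.
  rewrite ip_comb Re_sum; apply: eq_bigr => j _.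
  by rewrite coord_diag // -mulrA mul_conj_cmod -realCM.
apply: complex_eq_Re_Im => /=; last first.
  have h3 : ip (diag_app w x) x = ip x (diag_app w x).
    apply: (parseval ip_norm phi_basis) => j.
    by rewrite !coord_diag // conjcM conjcr mulrCA mulrA.
  have := congr1 (@complex.Im R) h3; rewrite (ipC x) Im_conjc; lra.
by rewrite -(cvg_lim _ h2) // (cvg_lim _ h1).
Qed.

(** Polarization: the form at x + c phi m, for c = 1 and c = 'i, determines the
    coordinate m of P x. *)
Lemma quadratic_form_coord w (P : linop H) :
  (forall j, 0 <= w j) -> dom P = diag_dom w ->
  (forall x, dom P x -> ip (P x) x =
     (fine (\sum_(0 <= k <oo) (w k * cmod (coord x k) ^+ 2)%:E)%E)%:C) ->
  forall x, dom P x -> P x = diag_app w x.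
Proof.
move=> w0 Pdom Pform x hx.
pose s x k := w k * cmod (coord x k) ^+ 2.
have s0 y k : 0 <= s y k by rewrite mulr_ge0 ?sqr_ge0.
pose S y := fine (\sum_(0 <= k <oo) (s y k)%:E)%E.
have Scvg y : dom P y -> (fun n => \sum_(j < n) s y j) @ \oo --> S y.
  rewrite Pdom => /diag_domE [M hM]; apply: cvg_nneg_series => //.
  by apply: diag_form_bounded => //; apply/diag_domE; exists M.
apply: (coord_ext phi_basis) => m.
rewrite coord_diag; last by rewrite Pdom in hx.
have hm : dom P (phi m) by rewrite Pdom; exact: diag_dom_phi.
have diff (c : R[i]) : S (x + c *: phi m) - S x =
    w m * (cmod (coord x m + c) ^+ 2 - cmod (coord x m) ^+ 2).
  have hd : dom P (x + c *: phi m) by apply: domD => //; exact: domZ.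
  have h1 : (fun n => \sum_(j < n) s (x + c *: phi m) j - \sum_(j < n) s x j) @ \oo -->
    S (x + c *: phi m) - S x by apply: cvgB; exact: Scvg.
  have h2 : (fun n => \sum_(j < n) s (x + c *: phi m) j - \sum_(j < n) s x j) @ \oo -->
    w m * (cmod (coord x m + c) ^+ 2 - cmod (coord x m) ^+ 2).
    apply: (@cvg_trans _ (cst (w m * (cmod (coord x m + c) ^+ 2 -
      cmod (coord x m) ^+ 2)) @ \oo)); last exact: cvg_cst.
    apply: near_eq_cvg; exists m.+1 => // n /= hn.
    rewrite -sumrB (bigD1 (Ordinal hn)) //= big1 ?addr0.
      by rewrite /s -mulrBr ipDl ipZl ip_phi // eqxx mulr1.
    move=> j hj; rewrite /s ipDl ipZl ip_phi // (_ : (m == j)%N = false).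
      by rewrite mulr0 addr0 subrr.
    by apply/negbTE; apply: contraNneq hj => hmj; apply/eqP/val_inj.
  by rewrite -(cvg_lim _ h1) // (cvg_lim _ h2).
have Pm : ip (P (phi m)) (phi m) = (w m)%:C.
  have h0 : S (phi m) = w m.
    have h1 := Scvg _ hm.
    have h2 : (fun n => \sum_(j < n) s (phi m) j) @ \oo --> w m.
      apply: (@cvg_trans _ (cst (w m) @ \oo)); last exact: cvg_cst.
      apply: near_eq_cvg; exists m.+1 => // n /= hn.
      rewrite (bigD1 (Ordinal hn)) //= big1 ?addr0.
        by rewrite /s ip_phi // eqxx cmod1 expr1n mulr1.
      move=> j hj; rewrite /s ip_phi // (_ : (m == j)%N = false).
        by rewrite cmod0 expr0n mulr0.
      by apply/negbTE; apply: contraNneq hj => hmj; apply/eqP/val_inj.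
    by rewrite -(cvg_lim _ h1) // (cvg_lim _ h2).
  by rewrite Pform // -/(S _) h0.
have eqn (c : R[i]) : cmod c = 1 ->
    Num.conj c * ip (P x) (phi m) + c * ip (P (phi m)) x =
    (w m)%:C * (Num.conj c * coord x m + c * Num.conj (coord x m)).
  move=> c1; have hd : dom P (c *: phi m) by exact: domZ.
  have h := Pform _ (domD hx hd); rewrite -/(S _) in h.
  have hx' := Pform _ hx; rewrite -/(S _) in hx'.
  have hc : c * Num.conj c = 1 by rewrite mul_conj_cmod c1 expr1n.
  have hS : S (x + c *: phi m) = S x + w m * (cmod (coord x m + c) ^+ 2 - cmod (coord x m) ^+ 2).
    by rewrite -diff; ring.
  move: h; rewrite appD // appZ // ipDl !ipDr !ipZl !ipZr hx' Pm hS.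
  rewrite realCD realCM realCB -!mul_conj_cmod conjcD.
  move=> h.
  move: h => /(congr1 (fun z => z - (S x)%:C - c * Num.conj c * (w m)%:C)) h.
  have h' : (w m)%:C * (c * Num.conj c - 1) = 0 by rewrite hc subrr mulr0.
  by apply: etrans (etrans _ h) _; ring.
have e1 := eqn 1 (@cmod1 _); have e2 := eqn 'i (@cmod_i _).
move: e1 e2.
case: (ip (P x) (phi m)) (ip (P (phi m)) x) (coord x m) => p1 p2 [q1 q2] [t1 t2].
move=> h1 h2.
have := congr1 (@complex.Re R) h1; have := congr1 (@complex.Im R) h1.
have := congr1 (@complex.Re R) h2; have := congr1 (@complex.Im R) h2.
move=> /= g1 g2 g3 g4.
by apply: complex_eq_Re_Im => /=; lra.
Qed.

End diagonal_operators.

Arguments diag_dom {R H} ip phi w.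
Arguments diag_app {R H} ip phi w x.

(** * Powers of an operator with an eigenbasis *)

Section powers.
Context {R : realType} {H : completeNormedModType R[i]}.
Context {ip : {dot H for Num.conj}}.
Hypothesis ip_norm : forall x : H, `|x| ^+ 2 = ip x x.
Variables (A : linop H) (lambda : nat -> R) (phi : nat -> H).
Hypothesis A_skew : skew_adjoint ip A.
Hypothesis A_eig : eigenbasis ip A (fun j => - 'i * (lambda j)%:C) phi.
Hypothesis lambda_gt0 : forall j, 0 < lambda j.
Implicit Types (x y : H) (F G : set (measurableTypeR R)).

Local Notation coord x j := (ip x (phi j)).

Let phi_basis : hilbert_basis ip phi := proj1 A_eig.

Lemma coord_A x j : dom A x -> coord (A x) j = - 'i * (lambda j)%:C * coord x j.
Proof.
move=> hx; have [hj Ej] := proj2 A_eig j.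
rewrite (skew_ip A_skew hx hj) Ej ipZr conjcM conjcr -mulNr.
by rewrite conjcN conjci; ring.
Qed.

(** A vector of the diagonal domain is in the domain of the adjoint of A. *)
Lemma dom_A_diag x : dom A x <-> diag_dom ip phi lambda x.
Proof.
split=> [hx|hx].
  apply/(diag_domE ip_norm phi_basis); exists (rnorm (A x) ^+ 2) => n.
  apply: le_trans (sum_coord_sqr ip_norm phi_basis n (A x)).
  apply: ler_sum => j _; rewrite coord_A // !cmodM cmodN cmod_i mul1r cmodR.
  by rewrite exprMn real_normK ?num_real.
suff [] : dom A x /\ A x = - 'i *: diag_app ip phi lambda x by [].
apply: (skew_domP A_skew) => y hy; rewrite -ipNl.
apply: (parseval ip_norm phi_basis) => j.
rewrite coord_A // ipNl ipZl (coord_diag ip_norm phi_basis) // !conjcM conjcN conjcr.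
by rewrite conjci; ring.
Qed.

Section resolution.
Variable E : set (measurableTypeR R) -> H -> H.
Hypothesis E_adj : forall F, measurable F -> forall x y, ip (E F x) y = ip x (E F y).
Hypothesis E_phi : forall F j, measurable F ->
  E F (phi j) = if `[< F (- lambda j) >] then phi j else 0.

(** The spectral measure of x as a sum of point masses: the eigenvalue of -iA at
    phi k is - lambda k. *)
Definition atoms x : {measure set (measurableTypeR R) -> \bar R} :=
  mseries (fun k => mscale (NngNum (sqr_ge0 (cmod (coord x k))))
    (@dirac _ (measurableTypeR R) (- lambda k) R)) 0.

Lemma specmeas_atoms x F : measurable F -> specmeas ip E x F = atoms x F.
Proof.
move=> mF; rewrite /atoms /= /mseries /=; apply/esym/cvg_lim => //.
rewrite /specmeas.
have h : (fun n => complex.Re (ip (E F x) (bproj ip phi n x))) @ \oo -->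
    complex.Re (ip (E F x) x).
  apply/cvgrPdist_lt => e e0.
  have [n0 hn] := cvgs_ipl ip_norm (E F x) (cvgs_proj phi_basis x) e0.
  exists n0 => // n /= /hn; apply: le_lt_trans.
  rewrite distrC -ReB -ipBr; apply: le_trans (cmod_Re _) _.
  by rewrite -ipBl -cmod_conj -ipC.
rewrite (_ : (fun n => _) = EFin \o (fun n => complex.Re (ip (E F x) (bproj ip phi n x)))).
  by apply/fine_cvgP; split; [exact: nearW|].
apply/funext => n /=.
rewrite ip_sumr Re_sum big_mkord -sumEFin; apply: eq_bigr => k _.
rewrite ipZr E_adj // E_phi // /mscale /= diracE -EFinM.
congr _%:E; case: asboolP => hk.
  by rewrite mem_set // mulr1 mulrC mul_conj_cmod.
by rewrite memNset // ip0r mulr0 mulr0.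
Qed.

Lemma integral_atoms x (f : R -> \bar R) : measurable_fun setT f ->
  (forall l, 0 <= f l)%E ->
  (\int[atoms x]_l f l =
   \sum_(0 <= k <oo) (cmod (coord x k) ^+ 2)%:E * f (- lambda k)%R)%E.
Proof.
move=> mf f0; rewrite /atoms ge0_integral_measure_series //.
apply: eq_eseriesr => k _; rewrite ge0_integral_mscale //=.
by rewrite integral_dirac // diracT mul1e.
Qed.

Lemma integral_specmeas x (f : R -> \bar R) :
  (\int[specmeas ip E x]_l f l = \int[atoms x]_l f l)%E.
Proof. by apply: eq_integral_measurable_sets; exact: specmeas_atoms. Qed.

Lemma specmeas_sq_finite (f : R -> R) (w : nat -> R) x :
  measurable_fun setT f -> (forall k, f (- lambda k) ^+ 2 = w k ^+ 2) ->
  (\int[specmeas ip E x]_l (f l ^+ 2)%:E < +oo)%E <-> diag_dom ip phi w x.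
Proof.
move=> mf fw; rewrite integral_specmeas integral_atoms; last 2 first.
- exact/measurable_EFinP/measurable_funX.
- by move=> l; rewrite lee_fin sqr_ge0.
rewrite (@eq_eseriesr _ _ (fun k => (w k ^+ 2 * cmod (coord x k) ^+ 2)%:E)); last first.
  by move=> k _; rewrite fw -EFinM mulrC.
have a0 k : 0 <= w k ^+ 2 * cmod (coord x k) ^+ 2 by rewrite mulr_ge0 ?sqr_ge0.
exact: iff_trans (nneg_series_finP a0) (iff_sym (diag_domE ip_norm phi_basis w x)).
Qed.

Lemma specmeas_integral_ge0 (f : R -> R) (w : nat -> R) x :
  measurable_fun setT f -> (forall l, 0 <= f l) ->
  (forall k, f (- lambda k) = w k) ->
  (\int[specmeas ip E x]_l (f l)%:E =
   \sum_(0 <= k <oo) (w k * cmod (coord x k) ^+ 2)%:E)%E.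
Proof.
move=> mf f0 fw; rewrite integral_specmeas integral_atoms; last 2 first.
- exact/measurable_EFinP.
- by move=> l; rewrite lee_fin.
by apply: eq_eseriesr => k _; rewrite fw -EFinM mulrC.
Qed.

Lemma spectral_integral_diag (f : R -> R) (w : nat -> R) (P : linop H) :
  measurable_fun setT f -> (forall l, 0 <= f l) -> (forall k, f (- lambda k) = w k) ->
  spectral_integral ip E f P ->
  dom P = diag_dom ip phi w /\ forall x, dom P x -> P x = diag_app ip phi w x.
Proof.
move=> mf f0 fw [Pdom Pform].
have w0 k : 0 <= w k by rewrite -fw.
have fw2 k : f (- lambda k) ^+ 2 = w k ^+ 2 by rewrite fw.
have Pdom' : dom P = diag_dom ip phi w.
  by rewrite Pdom; apply/seteqP; split=> x /= /(specmeas_sq_finite x mf fw2).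
split=> //; apply: (quadratic_form_coord ip_norm phi_basis w0 Pdom') => x hx.
by rewrite Pform // (specmeas_integral_ge0 _ mf f0 fw).
Qed.

Lemma diag_spectral_integral (f : R -> R) (w : nat -> R) :
  measurable_fun setT f -> (forall l, 0 <= f l) -> (forall k, f (- lambda k) = w k) ->
  spectral_integral ip E f (diagop ip_norm phi_basis w).
Proof.
move=> mf f0 fw.
have w0 k : 0 <= w k by rewrite -fw.
have fw2 k : f (- lambda k) ^+ 2 = w k ^+ 2 by rewrite fw.
split=> [|x hx].
  by apply/seteqP; split=> x /= /(specmeas_sq_finite x mf fw2).
by rewrite (specmeas_integral_ge0 _ mf f0 fw); exact: diag_form.
Qed.

(** The spectrum lies on the negative half-line, so that only the negative part
    of the identity contributes. *)
Lemma generator_spectral_integral :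
  spectral_integral ip E (fun l => l) (scaleop (- 'i) A).
Proof.
have mid : measurable_fun setT (fun l : R => l) by exact: measurable_id.
split=> [|x hx].
  have fw2 k : (- lambda k) ^+ 2 = lambda k ^+ 2 by rewrite sqrrN.
  apply/seteqP; split=> x /=.
    by move=> /dom_A_diag /(specmeas_sq_finite x mid fw2).
  by move=> /(specmeas_sq_finite x mid fw2) /dom_A_diag.
have hd : diag_dom ip phi lambda x by apply/dom_A_diag.
have -> : scaleop (- 'i) A x = - diag_app ip phi lambda x.
  apply: (coord_ext phi_basis) => j.
  rewrite ipNl (coord_diag ip_norm phi_basis) // /= ipZl coord_A //.
  have ii : 'i * 'i = -1 :> R[i] by apply: complex_eq_Re_Im => /=; ring.
  transitivity ('i * 'i * ((lambda j)%:C * coord x j)); first by ring.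
  by rewrite ii mulN1r.
rewrite ipNl (diag_form ip_norm phi_basis) //; last by move=> j; exact/ltW.
rewrite -realCN; congr _%:C; rewrite integral_specmeas integralE.
set S := (\sum_(0 <= k <oo) _)%E.
have -> : (\int[atoms x]_l (EFin^\+ l) = 0)%E.
  rewrite integral_atoms //; last first.
    by apply: measurable_funepos; exact: measurable_realfun.EFin_measurable.
  apply: eseries0 => k _ _; rewrite funeposE max_r ?mule0 //.
  by rewrite lee_fin oppr_le0 ltW.
have -> : (\int[atoms x]_l (EFin^\- l) = S)%E.
  rewrite integral_atoms //; last first.
    by apply: measurable_funeneg; exact: measurable_realfun.EFin_measurable.
  apply: eq_eseriesr => k _; rewrite funenegE max_l.
    by rewrite -EFinN opprK -EFinM mulrC.
  by rewrite -EFinN lee_fin opprK ltW.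
by rewrite sub0e fineN.
Qed.

End resolution.

Lemma resolution_phi E F j : spectral_resolution ip A E -> measurable F ->
  E F (phi j) = if `[< F (- lambda j) >] then phi j else 0.
Proof.
move=> [E_pvm E_int] mF; have [hj Ej] := proj2 A_eig j.
apply: (eigen_concentrated ip_norm E_pvm (Q := scaleop (- 'i) A)) => //.
  move=> x y hx hy /=; rewrite ipZl ipZr (skew_ip A_skew) // conjcN conjci opprK.
  by rewrite mulrN mulNr opprK.
rewrite /= Ej scalerA; congr (_ *: _).
by apply: complex_eq_Re_Im => /=; ring.
Qed.

(** The spectral projections of -iA *)
Definition eigenproj F x : H :=
  diag_app ip phi (fun j => `[< F (- lambda j) >]%:R) x.

Lemma eigenproj_dom F x : diag_dom ip phi (fun j => `[< F (- lambda j) >]%:R) x.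
Proof.
apply/(diag_domE ip_norm phi_basis); exists (rnorm x ^+ 2) => n.
apply: le_trans (sum_coord_sqr ip_norm phi_basis n x).
apply: ler_sum => j _; rewrite ler_piMl ?sqr_ge0 //.
by case: asboolP; rewrite ?expr1n ?expr0n.
Qed.

Lemma coord_eigenproj F x j :
  coord (eigenproj F x) j = if `[< F (- lambda j) >] then coord x j else 0.
Proof.
rewrite (coord_diag ip_norm phi_basis); last exact: eigenproj_dom.
by case: asboolP; rewrite ?mul1r ?mul0r.
Qed.

Lemma eigenproj_phi F j :
  eigenproj F (phi j) = if `[< F (- lambda j) >] then phi j else 0.
Proof.
apply: (coord_ext phi_basis) => i; rewrite coord_eigenproj (ip_phi phi_basis).
have [<-|hij] := eqVneq j i.
  by case: asboolP; rewrite ?(ip_phi phi_basis) ?eqxx ?ip0l.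
by rewrite if_same; case: asboolP; rewrite ?(ip_phi phi_basis) ?(negbTE hij) ?ip0l.
Qed.

Lemma eigenproj_pvm : pvm ip eigenproj.
Proof.
have lin F : measurable F -> forall (a : R[i]) x y,
    eigenproj F (a *: x + y) = a *: eigenproj F x + eigenproj F y.
  move=> _ a x y; apply: (diag_appP ip_norm phi_basis); exact: eigenproj_dom.
have adj F : measurable F -> forall x y, ip (eigenproj F x) y = ip x (eigenproj F y).
  move=> _ x y; apply: (parseval ip_norm phi_basis) => j; rewrite !coord_eigenproj.
  by case: asboolP; rewrite ?conjC0 ?mul0r ?mulr0.
have top x : eigenproj setT x = x.
  by apply: (coord_ext phi_basis) => j; rewrite coord_eigenproj asboolT.
have cap F G : measurable F -> measurable G -> forall x,
    eigenproj (F `&` G) x = eigenproj F (eigenproj G x).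
  move=> _ _ x; apply: (coord_ext phi_basis) => j; rewrite !coord_eigenproj.
  by rewrite asbool_and; case: asboolP; case: asboolP.
split=> // x F mF tF mU.
have phiE F' j : measurable F' ->
  eigenproj F' (phi j) = if `[< F' (- lambda j) >] then phi j else 0.
  by move=> _; exact: eigenproj_phi.
rewrite (specmeas_atoms adj phiE) //.
apply: cvg_trans (measure_semi_sigma_additive F mF tF mU); apply: near_eq_cvg.
by apply: nearW => n /=; apply: eq_bigr => i _; rewrite (specmeas_atoms adj phiE).
Qed.

Lemma eigenproj_resolution : spectral_resolution ip A eigenproj.
Proof.
split; first exact: eigenproj_pvm.
apply: generator_spectral_integral => [F mF x y|F j _]; last exact: eigenproj_phi.
exact: (pvm_self_adjoint eigenproj_pvm).
Qed.

(** All spectral resolutions of A agree on the eigenvectors (resolution_phi), and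
    eigenproj is one; so |A|^s is diagonal whatever resolution defines it. *)
Lemma abspow_diag (s : R) :
  dom (abspow ip A s) = diag_dom ip phi (fun j => lambda j `^ s) /\
  forall x, diag_dom ip phi (fun j => lambda j `^ s) x ->
    abspow ip A s x = diag_app ip phi (fun j => lambda j `^ s) x.
Proof.
have mf : measurable_fun setT (fun l : R => `|l| `^ s).
  rewrite -[X in measurable_fun _ X]/((@powR R ^~ s) \o (fun l : R => `|l|)).
  by apply: measurableT_comp; [exact: measurable_powR|exact: normr_measurable].
have f0 (l : R) : 0 <= `|l| `^ s by exact: powR_ge0.
have fw k : `|- lambda k| `^ s = lambda k `^ s by rewrite normrN gtr0_norm.
have exP : is_abspow ip A s (diagop ip_norm phi_basis (fun j => lambda j `^ s)).
  exists eigenproj; first exact: eigenproj_resolution.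
  apply: diag_spectral_integral => // [F mF x y|F j _]; last exact: eigenproj_phi.
  exact: (pvm_self_adjoint eigenproj_pvm).
have [E E_res E_int] : is_abspow ip A s (abspow ip A s).
  exact: (@xgetI _ _ [set P | is_abspow ip A s P] _ exP).
have [] := @spectral_integral_diag E _ _ (fun l => `|l| `^ s)
  (fun j => lambda j `^ s) _ mf f0 fw E_int.
- by move=> F mF x y; exact: (pvm_self_adjoint (proj1 E_res)).
- by move=> F j mF; exact: resolution_phi.
by move=> -> h; split.
Qed.

End powers.

(** * Propagation of weighted norms *)

Lemma ip_self_eq0 (R : realType) (H : completeNormedModType R[i])
    (ip : {dot H for Num.conj}) : (forall x : H, `|x| ^+ 2 = ip x x) ->
  forall x, ip x x = 0 -> x = 0.
Proof.
move=> ip_norm x h; apply/rnorm_eq0/eqP.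
have /eqP : rnorm x ^+ 2 = 0 by rewrite (rnorm_sqr ip_norm) h.
by rewrite expf_eq0.
Qed.

Section galerkin.
Context {R : realType} {H : completeNormedModType R[i]}.
Context {ip : {dot H for Num.conj}}.
Hypothesis ip_norm : forall x : H, `|x| ^+ 2 = ip x x.
Variables (A T : linop H) (phi : nat -> H) (mu : nat -> R[i]).
Hypothesis phi_basis : hilbert_basis ip phi.
Hypothesis phi_A : forall j, dom A (phi j) /\ A (phi j) = mu j *: phi j.
Hypothesis T_skew : skew_adjoint ip T.
Hypothesis T_dom : dom T = dom A.
Variables (w : nat -> R) (c D : R).
Hypothesis c_ge0 : 0 <= c.
Hypothesis T_form : forall (a : nat -> R[i]) n,
  `|complex.Re (ip (T (comb phi a n)) (comb phi (fun j => (w j ^+ 2)%:C * a j) n))| <=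
  c * rnorm (comb phi (fun j => (w j)%:C * a j) n) ^+ 2.
Hypothesis T_bound : forall a n M,
  rnorm (comb phi (fun j => (w j)%:C * a j) n) <= M ->
  rnorm (T (comb phi a n) - A (comb phi a n)) <= D * M.
Implicit Types (x y z : H) (a b : nat -> R[i]) (h t : R).

Local Notation coord x j := (ip x (phi j)).
Local Notation J := (resolvent T).
Local Notation U := (ugroup T).
Local Notation wle := (wnorm_le ip phi w).

Lemma dom_comb a n : dom T (comb phi a n).
Proof.
by rewrite T_dom; apply: dom_sum => j _; apply: domZ; exact: (proj1 (phi_A j)).
Qed.

Lemma dom_phi j : dom T (phi j).
Proof. by rewrite T_dom; exact: (proj1 (phi_A j)). Qed.

Lemma A_comb a n : A (comb phi a n) = comb phi (fun j => a j * mu j) n.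
Proof.
rewrite /comb app_sum => [|j _]; last by apply: domZ; exact: (proj1 (phi_A j)).
by apply: eq_bigr => j _; have [hj Ej] := phi_A j; rewrite appZ // Ej scalerA.
Qed.

Lemma wle_comb a n M : rnorm (comb phi (fun j => (w j)%:C * a j) n) <= M ->
  wle (comb phi a n) M.
Proof.
move=> hM m; apply: le_trans hM.
apply: le_trans (rnorm_proj ip_norm phi_basis m _).
rewrite le_eqVlt; apply/orP; left; apply/eqP; congr rnorm.
by apply: comb_ext => j _; rewrite !(coord_comb phi_basis); case: ifP; rewrite ?mulr0.
Qed.

Definition compress_app n x : H := bproj ip phi n (T (bproj ip phi n x)).

Lemma compress_appP n (a : R[i]) x y : setT x -> setT y ->
  compress_app n (a *: x + y) = a *: compress_app n x + compress_app n y.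
Proof.
move=> _ _; rewrite /compress_app proj_lin Defs.appP; try exact: dom_comb.
exact: proj_lin.
Qed.

Definition compress n : linop H :=
  @Linop R H setT (compress_app n) I (fun _ _ _ _ _ => I) (@compress_appP n).

Lemma compress_skew n : skew_adjoint ip (compress n).
Proof.
split; first by move=> O hO _; case: hO => x Ox; exists x.
have skew x y : ip (compress n x) y = - ip x (compress n y).
  rewrite /= /compress_app proj_adj (skew_ip T_skew); try exact: dom_comb.
  by rewrite proj_adj.
move=> y z; split=> [h|[_ ->] x _]; last by rewrite skew ipNr.
split=> //; apply/eqP; rewrite -addr_eq0; apply/eqP/(ip_self_eq0 ip_norm).
by rewrite ipDr -(h _ I) skew addNr.
Qed.

(** The compression of T to the span of the first n eigenvectors is skew-adjoint
    on the whole space, and its resolvent solves the projected equation. *)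
Lemma galerkin_exists h n x : h != 0 -> exists a,
  comb phi a n - h%:C *: bproj ip phi n (T (comb phi a n)) = bproj ip phi n x.
Proof.
move=> h0.
have [_] := resolventP ip_norm (compress_skew n) (bproj ip phi n x) h0.
set y := resolvent _ _ _ => /= Ey; exists (fun j => coord y j).
suff Hy : bproj ip phi n y = y by rewrite -/(bproj ip phi n y) {1}Hy; exact: Ey.
apply: (coord_ext phi_basis) => j; rewrite (coord_proj phi_basis); case: ifP => // hj.
move: Ey => /(congr1 (fun z => coord z j)); rewrite /compress_app ipBl ipZl.
by rewrite !(coord_proj phi_basis) hj mulr0 subr0 => ->.
Qed.

(** The real part of the form bounds the growth. No domain question arises, the
    solution being a finite combination of eigenvectors. *)
Lemma galerkin_bound h n x a M : 0 <= h -> 4 * c * h <= 1 -> wle x M ->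
  comb phi a n - h%:C *: bproj ip phi n (T (comb phi a n)) = bproj ip phi n x ->
  rnorm (comb phi (fun j => (w j)%:C * a j) n) <= expR (2 * c * h) * M.
Proof.
move=> h0 hc hx; set y := comb phi a n => E.
have M0 := wnorm_le_ge0 hx.
set Wy := comb phi _ n.
pose Wt := comb phi (fun j => (w j)%:C * coord (T y) j) n.
have EW : Wy - h%:C *: Wt = comb phi (fun j => (w j)%:C * coord x j) n.
  rewrite /Wt -combZ /Wy -sumrB; apply: eq_bigr => j _; rewrite -scalerBl.
  congr (_ *: _); move: E => /(congr1 (fun z => coord z j)).
  rewrite ipBl ipZl !(coord_proj phi_basis) (coord_comb phi_basis) ltn_ord => <-.
  by ring.
have ipW : ip Wy Wt = Num.conj (ip (T y) (comb phi (fun j => (w j ^+ 2)%:C * a j) n)).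
  rewrite /Wy ip_comb -ipC ip_comb; apply: eq_bigr => j _.
  rewrite (coord_comb phi_basis) ltn_ord conjcM conjcr expr2 realCM; ring.
have h1 : rnorm (Wy - h%:C *: Wt) ^+ 2 <= M ^+ 2.
  by rewrite EW ler_pXn2r ?nnegrE ?rnorm_ge0.
rewrite (rnormB_sqr ip_norm) ipZrR ReZ ipW Re_conjc in h1.
have h2 := le_trans (ler_norm _) (T_form a n); rewrite -/Wy -/y in h2.
set q := complex.Re _ in h1 h2.
have h3 : (1 - 2 * c * h) * rnorm Wy ^+ 2 <= M ^+ 2.
  have : h * q <= h * (c * rnorm Wy ^+ 2) by rewrite ler_wpM2l.
  by have := sqr_ge0 (rnorm (h%:C *: Wt)); lra.
have e1 : 1 + 4 * c * h <= expR (2 * c * h) ^+ 2.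
  rewrite -expRM_natl; apply: le_trans (expR_ge1Dx _).
  by rewrite le_eqVlt; apply/orP; left; apply/eqP; ring.
have u0 : 0 <= 2 * c * h by rewrite !mulr_ge0.
have h4 : rnorm Wy ^+ 2 <= (1 + 4 * c * h) * M ^+ 2.
  have hh : 1 <= (1 + 4 * c * h) * (1 - 2 * c * h) by nra.
  have h5 : 0 <= 1 + 4 * c * h by lra.
  apply: le_trans (_ : (1 + 4 * c * h) * ((1 - 2 * c * h) * rnorm Wy ^+ 2) <= _).
    by rewrite mulrA ler_peMl ?sqr_ge0.
  by rewrite ler_wpM2l.
rewrite -(@ler_pXn2r _ 2) ?nnegrE ?rnorm_ge0 ?mulr_ge0 ?expR_ge0 //.
by apply: le_trans h4 _; rewrite exprMn ler_wpM2r ?sqr_ge0.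
Qed.

(** The consistency error tested against z only sees the relatively bounded part
    T - A, since A commutes with the projections. *)
Lemma galerkin_weak_limit h x (a : nat -> nat -> R[i]) M : h != 0 ->
  (forall n, comb phi (a n) n - h%:C *: bproj ip phi n (T (comb phi (a n) n)) =
     bproj ip phi n x) ->
  (forall n, rnorm (comb phi (fun j => (w j)%:C * a n j) n) <= M) ->
  forall j (e : R), 0 < e -> exists n0, forall n, (n0 <= n)%N ->
    cmod (coord (comb phi (a n) n) j - coord (J h x) j) < e.
Proof.
move=> h0 E hM j e e0; pose y n := comb phi (a n) n; pose y0 := J h x.
have [hy0 Ey0] := resolventP ip_norm T_skew x h0.
have nh0 : - h != 0 by rewrite oppr_eq0.
have [hz Ez] := resolventP ip_norm T_skew (phi j) nh0.
set z := J (- h) (phi j) in hz Ez.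
have key n : coord (y n) j - coord y0 j =
    ip (bproj ip phi n x - x) z - h%:C * ip (T (y n) - A (y n)) (z - bproj ip phi n z).
  have yd : dom T (y n) by exact: dom_comb.
  have Ephi : phi j = z + h%:C *: T z by rewrite -[LHS]Ez realCN scaleNr opprK.
  have adj u : dom T u -> coord u j = ip (u - h%:C *: T u) z.
    move=> hu; rewrite Ephi ipDr ipBl ipZrR ipZl (skew_ip T_skew) //.
    by rewrite mulrN opprK.
  have Az : ip (A (y n)) (z - bproj ip phi n z) = 0.
    rewrite ipBr -(proj_adj phi) A_comb; apply/eqP; rewrite subr_eq0; apply/eqP.
    congr (ip _ z); apply: (coord_ext phi_basis) => i.
    by rewrite (coord_proj phi_basis) !(coord_comb phi_basis); case: ifP.
  have -> : ip (T (y n) - A (y n)) (z - bproj ip phi n z) =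
      ip (T (y n) - bproj ip phi n (T (y n))) z.
    by rewrite (ipBl (T (y n)) (A _)) Az subr0 ipBr -(proj_adj phi) -ipBl.
  rewrite (adj _ yd) (adj _ hy0) Ey0 -ipBl -ipZl -ipBl; congr (ip _ z).
  rewrite -(E n) -/(y n) scalerBr.
  move: (_ *: T (y n)) (_ *: bproj _ _ _ _) => u v.
  by rewrite (addrAC (y n) (- v)) subrACA subrr subr0 addrAC.
have D0 : 0 < 1 + `|h| * (`|D| * `|M|) by rewrite ltr_pwDl ?mulr_ge0.
have [n1 hn1] := cvgs_ipl ip_norm z (cvgs_proj phi_basis x) (divr_gt0 e0 (ltr0Sn R 1)).
have [n2 hn2] := cvgs_proj phi_basis z (divr_gt0 (divr_gt0 e0 (ltr0Sn R 1)) D0).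
exists (maxn n1 n2) => n; rewrite geq_max => /andP[h1 h2].
rewrite -/(y n) -/y0 key; apply: le_lt_trans (cmodB _ _) _.
have := hn1 n h1; rewrite -ipBl => h3.
have := hn2 n h2; rewrite rnorm_sub ltr_pdivlMr // => h4.
have h5 := T_bound (hM n); rewrite -/(y n) in h5.
have h6 : rnorm (T (y n) - A (y n)) <= `|D| * `|M|.
  by rewrite -normrM; apply: le_trans h5 (ler_norm _).
have h7 := cauchy_schwarz ip_norm (T (y n) - A (y n)) (z - bproj ip phi n z).
rewrite cmodM cmodR.
have h8 : rnorm (T (y n) - A (y n)) * rnorm (z - bproj ip phi n z) <=
   `|D| * `|M| * rnorm (z - bproj ip phi n z) by rewrite ler_wpM2r ?rnorm_ge0.
have h9 := ler_wpM2l (normr_ge0 h) (le_trans h7 h8).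
by have := rnorm_ge0 (z - bproj ip phi n z); lra.
Qed.

(** The Galerkin solutions satisfy the bound and converge to the resolvent
    coordinate by coordinate. *)
Lemma resolvent_wle h x M : 0 <= h -> 4 * c * h <= 1 -> wle x M ->
  wle (J h x) (expR (2 * c * h) * M).
Proof.
move=> hge hc hx; have [->|h0] := eqVneq h 0.
  by rewrite resolvent0 mulr0 expR0 mul1r.
have /choice [a ha] n := galerkin_exists n x h0.
have hb n := galerkin_bound hge hc hx (ha n).
apply: (wnorm_le_lim ip_norm phi_basis (u := fun n => comb phi (a n) n) (n0 := 0%N)).
  exact: galerkin_weak_limit ha hb.
by move=> n _; exact: wle_comb.
Qed.

Lemma iter_resolvent_wle h n x M : 0 <= h -> 4 * c * h <= 1 -> wle x M ->
  wle (iter n (J h) x) (expR (2 * c * (n%:R * h)) * M).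
Proof.
move=> h0 hc hx; elim: n => [|n IH] /=; first by rewrite mul0r mulr0 expR0 mul1r.
have := resolvent_wle h0 hc IH; rewrite mulrA -expRD.
by congr (wle _ (expR _ * _)); rewrite -natr1; ring.
Qed.

Lemma euler_step_small t : 0 <= t -> exists n0, forall m, (n0 <= m)%N ->
  0 <= t / (2 ^ m)%:R /\ 4 * c * (t / (2 ^ m)%:R) <= 1.
Proof.
move=> t0; have /cvgr0Pnorm_lt /(_ _ (@ltr01 R)) [n0 _ hn] := cvg_geometric_half (4 * c * t).
exists n0 => m /hn /= h; split; first by rewrite divr_ge0.
by rewrite mulrA ltW //; exact: le_lt_trans (ler_norm _) h.
Qed.

Lemma euler_time m t : (2 ^ m)%:R * (t / (2 ^ m)%:R) = t :> R.
Proof. by rewrite mulrCA mulfV ?mulr1 // pnatr_eq0 -lt0n expn_gt0. Qed.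

(** The resolvent bound, iterated along the Euler scheme *)
Lemma ugroup_wle t x M : 0 <= t -> wle x M -> wle (U t x) (expR (2 * c * t) * M).
Proof.
move=> t0 hx; have [n0 hn] := euler_step_small t0.
apply: (wnorm_le_cvgs ip_norm phi_basis (n0 := n0) (ugroupP ip_norm T_skew t x)) => m hm.
have [h1 h2] := hn m hm.
by have := iter_resolvent_wle (2 ^ m) h1 h2 hx; rewrite euler_time.
Qed.

(** Polarizing the form bound along phi j and the truncations of T phi j shows
    that T phi j has finite weighted norm. *)
Lemma T_phi_wle j : exists M, wle (T (phi j)) M.
Proof.
(* With the factor s = c + 1 on phi j, the term 2 s Y of the polarized form
   dominates the term 2 c Y of the bound. *)
pose f := T (phi j); pose s := c + 1.
pose B := c * s ^+ 2 * w j ^+ 2 + s * (w j ^+ 2 * rnorm f ^+ 2).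
have s0 : 0 <= s by rewrite addr_ge0.
have B0 : 0 <= B.
  by apply: addr_ge0; apply: mulr_ge0 => //; rewrite ?sqr_ge0 // mulr_ge0 // sqr_ge0.
suff hY n : \sum_(i < n) w i ^+ 2 * cmod (coord f i) ^+ 2 <= B.
  exists (Num.sqrt B); apply/(wnorm_leP ip_norm phi_basis); first exact: sqrtr_ge0.
  by rewrite sqr_sqrtr.
wlog hjn : n / (j < n)%N.
  move=> hw; have [hjn|hjn] := ltnP j n; first exact: hw.
  apply: le_trans (hw j.+1 (ltnSn j)).
  have h0 i : 0 <= w i ^+ 2 * cmod (coord f i) ^+ 2 by rewrite mulr_ge0 ?sqr_ge0.
  rewrite -(big_mkord xpredT (fun i => w i ^+ 2 * cmod (coord f i) ^+ 2)).
  rewrite -(big_mkord xpredT (fun i => w i ^+ 2 * cmod (coord f i) ^+ 2)).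
  rewrite (@big_cat_nat _ _ _ n 0 j.+1) //=; last exact: leqW.
  by rewrite lerDl sumr_ge0.
set Y := \sum_(i < n) _.
pose e0 : nat -> R[i] := fun i => s%:C * (i == j)%:R.
pose b0 : nat -> R[i] := fun i => coord f i.
pose K (a : nat -> R[i]) := comb phi (fun i => (w i ^+ 2)%:C * a i) n.
pose W (a : nat -> R[i]) := comb phi (fun i => (w i)%:C * a i) n.
have Ee : comb phi e0 n = s%:C *: phi j.
  apply: (coord_ext phi_basis) => i; rewrite (coord_comb phi_basis) ipZl (ip_phi phi_basis).
  by rewrite /e0 eq_sym; case: ltnP => // hi; rewrite (ltn_eqF (leq_trans hjn hi)) mulr0.
have Y0 : 0 <= Y by apply: sumr_ge0 => i _; rewrite mulr_ge0 ?sqr_ge0.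
have We : rnorm (W e0) ^+ 2 = s ^+ 2 * w j ^+ 2.
  rewrite (comb_sqr ip_norm phi_basis) (bigD1 (Ordinal hjn)) //= big1 ?addr0.
    by rewrite /e0 eqxx mulr1 cmodM !cmodR exprMn !real_normK ?num_real // mulrC.
  move=> i hi; rewrite /e0 (_ : (i == j :> nat) = false) ?mulr0 ?cmod0 ?expr0n //.
  by apply/negbTE; apply: contraNneq hi => hij; apply/eqP/val_inj.
have Wb : rnorm (W b0) ^+ 2 = Y.
  rewrite (comb_sqr ip_norm phi_basis); apply: eq_bigr => i _.
  by rewrite cmodM cmodR exprMn real_normK ?num_real.
have par : rnorm (W e0 + W b0) ^+ 2 + rnorm (W e0 - W b0) ^+ 2 =
    2 * (s ^+ 2 * w j ^+ 2 + Y).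
  by rewrite (rnormD_sqr ip_norm) (rnormB_sqr ip_norm) We Wb; ring.
pose e1 : nat -> R[i] := fun i => e0 i + b0 i.
pose e2 : nat -> R[i] := fun i => e0 i - b0 i.
have c1 : comb phi e1 n = comb phi e0 n + comb phi b0 n by exact: combD.
have c2 : comb phi e2 n = comb phi e0 n - comb phi b0 n.
  by rewrite /comb -sumrB; apply: eq_bigr => i _; rewrite scalerBl.
have K1 : K e1 = K e0 + K b0.
  by rewrite /K -combD; apply: comb_ext => i _; rewrite mulrDr.
have K2 : K e2 = K e0 - K b0.
  by rewrite /K /comb -sumrB; apply: eq_bigr => i _; rewrite -scalerBl -mulrBr.
have W1 : W e1 = W e0 + W b0.
  by rewrite /W -combD; apply: comb_ext => i _; rewrite mulrDr.
have W2 : W e2 = W e0 - W b0.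
  by rewrite /W /comb -sumrB; apply: eq_bigr => i _; rewrite -scalerBl -mulrBr.
have q1 := T_form e1 n; have q2 := T_form e2 n.
rewrite -/(K _) -/(W _) K1 W1 c1 in q1; rewrite -/(K _) -/(W _) K2 W2 c2 in q2.
have hd0 := dom_comb e0 n; have hd1 := dom_comb b0 n.
rewrite appD // in q1; rewrite appB // in q2.
set x0 := T (comb phi e0 n) in q1 q2; set x1 := T (comb phi b0 n) in q1 q2.
have pol : complex.Re (ip (x0 + x1) (K e0 + K b0)) - complex.Re (ip (x0 - x1) (K e0 - K b0)) =
    2 * (complex.Re (ip x0 (K b0)) + complex.Re (ip x1 (K e0))).
  move: (K e0) (K b0) => k0 k1; rewrite (ipDl x0) (ipBl x0).
  by rewrite (ipDr x0) (ipDr x1) (ipBr x0) (ipBr x1) !(ReD, ReB); ring.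
have r0 : complex.Re (ip x0 (K b0)) = s * Y.
  rewrite /x0 Ee appZ; last exact: dom_phi.
  rewrite ipZl ReZ; congr (_ * _); rewrite ipC Re_conjc ip_comb Re_sum.
  apply: eq_bigr => i _; rewrite /b0 -mulrA mul_conj_cmod -realCM //.
have r1 : `|complex.Re (ip x1 (K e0))| <= s * (w j ^+ 2 * rnorm f ^+ 2).
  have -> : K e0 = (s * w j ^+ 2)%:C *: phi j.
    rewrite realCM mulrC -scalerA -Ee -combZ /K; apply: comb_ext => i _.
    rewrite /e0; have [->//|] := eqVneq i j.
    by rewrite !mulr0.
  rewrite ipZrR ReZ normrM (ger0_norm (mulr_ge0 s0 (sqr_ge0 _))) mulrA.
  apply: ler_wpM2l; first by rewrite mulr_ge0 ?sqr_ge0.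
  rewrite /x1 (skew_ip T_skew) //; last exact: dom_phi.
  rewrite ReN normrN; apply: le_trans (cmod_Re _) _.
  apply: le_trans (cauchy_schwarz ip_norm _ _) _; rewrite expr2 ler_wpM2r ?rnorm_ge0 //.
  exact: rnorm_proj.
have := ler_norm (complex.Re (ip (x0 + x1) (K e0 + K b0))).
have := ler_norm (- complex.Re (ip (x0 - x1) (K e0 - K b0))); rewrite normrN.
have := ler_norm (- complex.Re (ip x1 (K e0))); rewrite normrN => n1 n2 n3.
have : 2 * (s * Y) <= 2 * c * (s ^+ 2 * w j ^+ 2 + Y) + 2 * (s * (w j ^+ 2 * rnorm f ^+ 2)).
  have : c * (rnorm (W e0 + W b0) ^+ 2 + rnorm (W e0 - W b0) ^+ 2) =
    2 * c * (s ^+ 2 * w j ^+ 2 + Y) by rewrite par; ring.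
  by rewrite r0 in pol; lra.
rewrite /B /s; nra.
Qed.

Lemma T_comb_wle a n : exists M, wle (T (comb phi a n)) M.
Proof.
elim: n => [|n [M hM]].
  by exists 0; rewrite /comb big_ord0 app0; exact: wnorm_le0.
have [M' hM'] := T_phi_wle n; exists (M + cmod (a n) * M').
rewrite /comb big_ord_recr /= appD ?appZ; last first.
- by apply: domZ; exact: dom_phi.
- exact: dom_comb.
- exact: dom_phi.
by apply: wnorm_leD => //; exact: wnorm_leZ.
Qed.

Lemma iter_resolvent_diff_wle h n x M : 0 <= h -> 4 * c * h <= 1 ->
  dom T x -> wle (T x) M ->
  wle (iter n (J h) x - x) (n%:R * h * (expR (2 * c * (n%:R * h)) * M)).
Proof.
move=> h0 hc hx hM; rewrite (iter_resolvent_step ip_norm T_skew) //.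
have M0 := wnorm_le_ge0 hM.
set K := expR _ * M.
have -> : n%:R * h * K = cmod h%:C * (n%:R * K) by rewrite cmodR ger0_norm //; ring.
apply: wnorm_leZ; apply: wnorm_le_sum => [i|]; last by rewrite mulr_ge0 ?expR_ge0.
apply: wnorm_le_mono (iter_resolvent_wle i.+1 h0 hc hM).
rewrite /K ler_wpM2r // ler_expR ler_wpM2l ?mulr_ge0 //.
by rewrite ler_wpM2r // ler_nat.
Qed.

(** Strong continuity at time 0 in the weighted norm, uniformly for the Euler
    scheme: finite combinations move at finite speed, and their complement is
    small and stays so. *)
Lemma iter_resolvent_cont x M (e : R) : wle x M -> 0 < e ->
  exists2 t0, 0 < t0 & forall h n, 0 <= h -> 4 * c * h <= 1 -> n%:R * h <= t0 ->
    wle (iter n (J h) x - x) e.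
Proof.
move=> hx e0; have e4 : 0 < e / 4 by rewrite divr_gt0.
have [N hN] := wnorm_le_tail ip_norm phi_basis hx e4.
set y := bproj ip phi N x in hN.
have [My hMy] := T_comb_wle (fun j => coord x j) N; rewrite -/(bproj ip phi N x) -/y in hMy.
have My0 := wnorm_le_ge0 hMy.
have d0 : 0 < 8 * (My + 1) by lra.
pose t0 := Num.min (4 * (c + 1))^-1 (e / (8 * (My + 1))).
have c4 : 0 < 4 * (c + 1) by have := c_ge0; lra.
exists t0; first by rewrite lt_min invr_gt0 c4 divr_gt0.
move=> h n h0 hc hn.
have nh0 : 0 <= n%:R * h by rewrite mulr_ge0.
have hn1 : n%:R * h <= (4 * (c + 1))^-1 by apply: le_trans hn _; rewrite ge_min lexx.
have hn2 : n%:R * h <= e / (8 * (My + 1)) by apply: le_trans hn _; rewrite ge_min lexx orbT.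
have E2 : expR (2 * c * (n%:R * h)) <= 2.
  have u : 2 * c * (n%:R * h) <= 2^-1.
    have := c_ge0; rewrite -[_^-1]mul1r ler_pdivlMr // in hn1; nra.
  have := expR_ge1Dx (- (2 * c * (n%:R * h))); rewrite expRN => hE.
  have h1 : 2^-1 <= (expR (2 * c * (n%:R * h)))^-1 by lra.
  by rewrite lef_pV2 ?posrE ?expR_gt0 // in h1.
have -> : iter n (J h) x - x = (iter n (J h) y - y) + (iter n (J h) (x - y) - (x - y)).
  by rewrite (iter_resolventB ip_norm T_skew) subrACA [RHS]addrC subrK.
have hdy : dom T y by exact: dom_comb.
apply: wnorm_le_mono (wnorm_leD (iter_resolvent_diff_wle n h0 hc hdy hMy)
  (wnorm_leB (iter_resolvent_wle n h0 hc hN) hN)).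
rewrite ler_pdivlMr // in hn2.
have E1 := expR_gt0 (2 * c * (n%:R * h)).
set u := expR _ in E1 E2 *; set v := n%:R * h in nh0 hn2 *.
have : v * (u * My) <= e / 4 by nra.
have : u * (e / 4) <= 2 * (e / 4) by rewrite ler_wpM2r // ltW.
lra.
Qed.

Lemma ugroup_cont x M (e : R) : wle x M -> 0 < e ->
  exists2 t0, 0 < t0 & forall t, 0 <= t <= t0 -> wle (U t x - x) e.
Proof.
move=> hx e0; have [t0 t00 ht0] := iter_resolvent_cont hx e0.
exists t0 => // t /andP[tge tle]; have [n0 hn] := euler_step_small tge.
apply: (wnorm_le_cvgs ip_norm phi_basis (n0 := n0)
  (cvgsB (ugroupP ip_norm T_skew t x) (cvgs_cst x))) => m hm.
by have [h1 h2] := hn m hm; apply: ht0 => //; rewrite euler_time.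
Qed.

(** The increments of the Euler scheme are multiples of iterates of T phi j, which
    stay close to T phi j by strong continuity. *)
Lemma ugroup_phi_expand j (e : R) : 0 < e ->
  exists2 t0, 0 < t0 & forall t, 0 <= t <= t0 ->
    wle (U t (phi j) - phi j - t%:C *: T (phi j)) (t * e).
Proof.
move=> e0; have [M hM] := T_phi_wle j.
have [t0 t00 ht0] := iter_resolvent_cont hM e0.
exists t0 => // t /andP[tge tle]; have [n0 hn] := euler_step_small tge.
apply: (wnorm_le_cvgs ip_norm phi_basis (n0 := n0)
  (cvgsB (cvgsB (ugroupP ip_norm T_skew t (phi j)) (cvgs_cst (phi j)))
    (cvgs_cst (t%:C *: T (phi j))))) => m hm.
have [h1 h2] := hn m hm; rewrite /euler (iter_resolvent_step ip_norm T_skew); last exact: dom_phi.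
set N := (2 ^ m)%N in h1 h2 *; set h := t / N%:R in h1 h2 *.
have tE : N%:R * h = t by exact: euler_time.
have -> : t%:C *: T (phi j) = h%:C *: \sum_(i < N) T (phi j).
  rewrite sumr_const card_ord -[T (phi j) *+ N]scaler_nat scalerA -tE mulrC realCM.
  by rewrite -(rmorph_nat (real_complex R)).
rewrite -scalerBr -sumrB.
have -> : t * e = cmod h%:C * (N%:R * e) by rewrite cmodR ger0_norm // -tE; ring.
apply: wnorm_leZ; apply: wnorm_le_sum => [i|]; last exact: ltW.
apply: (ht0 h i.+1) => //; apply: le_trans tle; rewrite -tE.
by rewrite ler_wpM2r // ler_nat.
Qed.

End galerkin.

(** * Unimodular numbers *)

Definition cis (R : realType) (x : R) : R[i] := Complex (cos x) (sin x).

Section cis_theory.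
Context {R : realType}.
Implicit Types (x y : R) (z : R[i]).

Lemma cis0 : cis (0 : R) = 1.
Proof. by rewrite /cis cos0 sin0. Qed.

Lemma cisD x y : cis (x + y) = cis x * cis y.
Proof. by apply/eqP; rewrite eq_complex /= cosD sinD [sin x * _ + _]addrC !eqxx. Qed.

Lemma cis_conj x : Num.conj (cis x) = cis (- x).
Proof. by apply/eqP; rewrite eq_complex Re_conjc Im_conjc /= cosN sinN !eqxx. Qed.

Lemma cmod_cis x : cmod (cis x) = 1.
Proof.
apply/eqP; rewrite -(@eqrXn2 _ 2) ?cmod_ge0 ?ler01 //.
by rewrite cmod_sqr /= cos2Dsin2 expr1n.
Qed.

Lemma cisNK x : cis (- x) * cis x = 1.
Proof. by rewrite -cisD addNr cis0. Qed.

Lemma cis_natX x n : cis x ^+ n = cis (x * n%:R).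
Proof.
elim: n => [|n IH]; first by rewrite expr0 mulr0 cis0.
by rewrite exprS IH -cisD -natr1 mulrDr mulr1 addrC.
Qed.

Lemma cis_2pi_nat n : cis (2 * pi * n%:R : R) = 1.
Proof.
rewrite -cis_natX; suff -> : cis (2 * pi : R) = 1 by rewrite expr1n.
by rewrite mulr_natl /cis cos2pi mulr2n sinDpi sinpi oppr0.
Qed.

Lemma cis_pihalf : cis (pi / 2 : R) = 'i.
Proof. by rewrite /cis cos_pihalf sin_pihalf. Qed.

Lemma cis_neq1 x : 0 < `|x| < 2 * pi -> cis x != 1.
Proof.
move=> /andP[h1 h2]; apply/eqP => /(congr1 (@complex.Re R)) /= hc.
have h3 : cos `|x| = 1 by case: (ger0P x) => // _; rewrite cosN.
have s : 0 < sin (`|x| / 2) by apply: sin_gt0_pi; rewrite divr_gt0 //= ltr_pdivrMr // mulrC.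
have E : `|x| / 2 *+ 2 = `|x| by rewrite -mulr_natr divfK ?pnatr_eq0.
have := cos_mulr2n (`|x| / 2); rewrite E h3 cos2sin2.
by have := exprn_gt0 2 s; lra.
Qed.

Lemma cis_surj z : cmod z = 1 -> exists2 x, 0 < x & z = cis x.
Proof.
move=> hz; have := cmod_sqr z; rewrite hz expr1n.
case: z hz => a b /= hz hab.
have ha : -1 <= a <= 1.
  by rewrite -ler_norml -(@ler_pXn2r _ 2) ?nnegrE // expr1n real_normK ?num_real //; nra.
have [/andP[h0 hpi] hc] := acos_def ha.
have hs : sin (acos a) = `|b|.
  by rewrite sin_acos // (_ : 1 - a ^+ 2 = b ^+ 2) ?sqrtr_sqr //; lra.
have [b0|b0] := leP 0 b.
  exists (acos a + 2 * pi); first by have := pi_gt0 R; lra.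
  by rewrite cisD -[2 * pi]mulr1 (cis_2pi_nat 1) mulr1 /cis hc hs ger0_norm.
exists (- acos a + 2 * pi); first by have := pi_gt0 R; lra.
by rewrite cisD -[2 * pi]mulr1 (cis_2pi_nat 1) mulr1 /cis cosN sinN hc hs ltr0_norm // opprK.
Qed.

Lemma mvt_bound (f df : R -> R) K x : 0 <= x ->
  (forall y, is_derive y 1 f (df y)) ->
  (forall y, 0 <= y <= x -> `|df y| <= K) -> `|f x - f 0| <= K * x.
Proof.
move=> x0 hd hb.
have cf : {within `[0, x], continuous f}.
  apply: continuous_subspaceT => y; apply: differentiable_continuous.
  by apply/derivable1_diffP; exact: (@ex_derive _ _ _ _ _ _ _ (hd y)).
have [c hc ->] := MVT_segment x0 (fun y _ => hd y) cf.
by rewrite subr0 normrM (ger0_norm x0) ler_wpM2r // hb // -in_itv.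
Qed.

Lemma sin_le x : 0 <= x -> `|sin x| <= x.
Proof.
move=> x0; have := mvt_bound x0 (@is_derive_sin R) (fun y _ => cos_max y).
by rewrite sin0 subr0 mul1r.
Qed.

Lemma cos_sub1 x : 0 <= x -> `|cos x - 1| <= x ^+ 2.
Proof.
move=> x0; have := @mvt_bound cos (fun y => - sin y) x x x0 (@is_derive_cos R).
rewrite cos0 expr2; apply => y /andP[y0 yx].
by rewrite normrN; exact: le_trans (sin_le y0) yx.
Qed.

Lemma sin_sub x : 0 <= x -> `|sin x - x| <= x ^+ 3.
Proof.
move=> x0; have := @mvt_bound (fun y => sin y - y) (fun y => cos y - 1) (x ^+ 2) x x0.
rewrite sin0 !subr0 -exprSr; apply => y /andP[y0 yx].
apply: le_trans (cos_sub1 y0) _.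
by rewrite ler_pXn2r // nnegrE // (le_trans y0).
Qed.

Lemma cis_expand x : `|x| <= 1 -> cmod (cis x - 1 - 'i * x%:C) <= 2 * x ^+ 2.
Proof.
have main y : 0 <= y <= 1 -> cmod (cis y - 1 - 'i * y%:C) <= 2 * y ^+ 2.
  move=> /andP[y0 y1].
  have -> : cis y - 1 - 'i * y%:C = (cos y - 1)%:C + 'i * (sin y - y)%:C.
    apply/eqP; rewrite eq_complex /=; apply/andP; split; apply/eqP; ring.
  apply: le_trans (cmodD _ _) _; rewrite cmodM cmod_i mul1r !cmodR.
  have := cos_sub1 y0; have := sin_sub y0; rewrite exprSr.
  have : y ^+ 2 * y <= y ^+ 2 by rewrite ler_piMr ?sqr_ge0.
  lra.
move=> hx; have [x0|x0] := leP 0 x.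
  by apply: main; rewrite x0 -(ger0_norm x0).
have -> : cis x - 1 - 'i * x%:C = Num.conj (cis (- x) - 1 - 'i * (- x)%:C).
  apply/eqP; rewrite eq_complex Re_conjc Im_conjc /= cosN sinN.
  by apply/andP; split; apply/eqP; ring.
rewrite cmod_conj.
by rewrite -sqrrN; apply: main; rewrite oppr_ge0 ltW //= -(ltr0_norm x0).
Qed.

End cis_theory.

(** * Averaging weights *)

Section averaging_weights.
Context {R : realType}.
Variables M K : nat.
Hypothesis M_gt2 : (2 < M)%N.
Hypothesis K_gt0 : (0 < K)%N.

Let N := (M * K)%N.
Let theta : R := 2 * pi / M%:R.

(** K periods of a raised cosine, of M samples each. Among the frequencies, its
    mean singles out 0, with value 1, and the two resonant ones theta and - theta,
    with value 1/2. *)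
Definition pulse_weight i : R := (1 + cos (theta * i%:R)) / N%:R.

Definition pulse_filter (x : R) : R[i] :=
  \sum_(i < N) (pulse_weight i)%:C * cis (x * i%:R).

Definition cis_sum (x : R) : R[i] := \sum_(i < N) cis (x * i%:R).

Lemma N_neq0 : N%:R != 0 :> R.
Proof. by rewrite pnatr_eq0 -lt0n muln_gt0 K_gt0 (leq_trans _ M_gt2). Qed.

Lemma N_gt0 : 0 < N%:R :> R.
Proof. by rewrite lt_def N_neq0 ler0n. Qed.

Lemma M_gt0 : 0 < M%:R :> R.
Proof. by rewrite ltr0n (leq_trans _ M_gt2). Qed.

Lemma theta_gt0 : 0 < theta.
Proof. by rewrite divr_gt0 ?M_gt0 // mulr_gt0 // pi_gt0. Qed.

Lemma theta3 : 3 * theta <= 2 * pi.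
Proof.
have := pi_gt0 R; rewrite /theta mulrA ler_pdivrMr ?M_gt0 // => h.
by rewrite [3 * _]mulrC ler_wpM2l ?mulr_ge0 ?(ltW h) // (ler_nat R 3 M).
Qed.

Lemma pulse_weight_ge0 i : 0 <= pulse_weight i.
Proof. by rewrite divr_ge0 // -lerBlDl sub0r cos_geN1. Qed.

Lemma pulse_filterE x :
  pulse_filter x = (N%:R^-1)%:C *
    (cis_sum x + (2^-1)%:C * (cis_sum (x + theta) + cis_sum (x - theta))).
Proof.
rewrite /pulse_filter /cis_sum -big_split /= mulr_sumr -big_split /= mulr_sumr.
apply: eq_bigr => i _; rewrite [(x + _) * _]mulrDl [(x - _) * _]mulrBl !cisD.
by apply/eqP; rewrite eq_complex /= cosN sinN /pulse_weight; apply/andP; split; apply/eqP;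
  field; exact: N_neq0.
Qed.

Lemma cis_sum0 : cis_sum 0 = N%:R.
Proof.
rewrite /cis_sum (eq_bigr (fun=> 1)) => [|i _]; first by rewrite sumr_const card_ord.
by rewrite mul0r cis0.
Qed.

Lemma cis_sum_mul x : (cis x - 1) * cis_sum x = cis (x * N%:R) - 1.
Proof.
rewrite -cis_natX subrX1; congr (_ * _); apply: eq_bigr => i _.
by rewrite cis_natX.
Qed.

Lemma cis_sum_period x : cis x != 1 -> cis (x * N%:R) = 1 -> cis_sum x = 0.
Proof.
move=> h1 h2; have := cis_sum_mul x; rewrite h2 subrr => /eqP.
by rewrite mulf_eq0 subr_eq0 (negbTE h1) => /eqP.
Qed.

Lemma cis_theta n : cis (n%:R * theta * N%:R) = 1.
Proof.
rewrite (_ : _ * N%:R = 2 * pi * (n * K)%:R) ?cis_2pi_nat //.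
rewrite /N !natrM /theta; field; exact: lt0r_neq0 M_gt0.
Qed.

Lemma theta_neq1 : cis theta != 1.
Proof.
have h0 := theta_gt0; have h3 := theta3.
by apply: cis_neq1; rewrite gtr0_norm // h0 /=; lra.
Qed.

Lemma theta2_neq1 : cis (2 * theta) != 1.
Proof.
have h0 := theta_gt0; have h3 := theta3; have h2 : 0 < 2 * theta by lra.
by apply: cis_neq1; rewrite gtr0_norm // h2 /=; lra.
Qed.

Lemma cisN_eq1 x : (cis (- x) == 1) = (cis x == 1 :> R[i]).
Proof.
apply/eqP/eqP => h; have := cisNK x; first by rewrite h mul1r.
by rewrite h mulr1.
Qed.

Lemma pulse_filter0 : pulse_filter 0 = 1.
Proof.
rewrite pulse_filterE add0r sub0r cis_sum0 !cis_sum_period ?addr0 ?mulr0 ?addr0.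
- by rewrite -(rmorph_nat (real_complex R)) -realCM mulVf ?N_neq0.
- by rewrite cisN_eq1 theta_neq1.
- by have := cis_theta 1; rewrite mul1r mulNr => h; apply/eqP; rewrite cisN_eq1 h.
- exact: theta_neq1.
- by have := cis_theta 1; rewrite mul1r.
Qed.

Lemma pulse_filterN x : pulse_filter (- x) = Num.conj (pulse_filter x).
Proof.
rewrite /pulse_filter raddf_sum; apply: eq_bigr => i _ /=.
by rewrite conjcM conjcr cis_conj mulNr.
Qed.

Lemma pulse_filter_theta : pulse_filter theta = (2^-1)%:C.
Proof.
rewrite pulse_filterE subrr cis_sum0 -[theta + theta]mulr2n -[theta *+ 2]mulr_natl.
rewrite !cis_sum_period ?theta_neq1 ?theta2_neq1 ?cis_theta //.
- rewrite !add0r -(rmorph_nat (real_complex R)) mulrCA -realCM mulVf ?N_neq0 //.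
  by rewrite mulr1.
- by have := cis_theta 1; rewrite mul1r.
Qed.

Lemma pulse_filter_thetaN : pulse_filter (- theta) = (2^-1)%:C.
Proof. by rewrite pulse_filterN pulse_filter_theta conjcr. Qed.

Lemma sum_pulse_weight : \sum_(i < N) pulse_weight i = 1.
Proof.
have := pulse_filter0 => /(congr1 (@complex.Re R)); rewrite /pulse_filter Re_sum /= => <-.
by apply: eq_bigr => i _; rewrite !mul0r cos0 mulr1 subr0.
Qed.

Lemma cmod_pulse_filter x : cmod (pulse_filter x) <= 1.
Proof.
rewrite /pulse_filter; apply: le_trans (le_cmod_sum _ _ _) _; rewrite -sum_pulse_weight.
rewrite le_eqVlt; apply/orP; left; apply/eqP/eq_bigr => i _; rewrite cmodM cmod_cis mulr1 cmodR ger0_norm //.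
exact: pulse_weight_ge0.
Qed.

(** A geometric sum of unimodular ratio different from 1 is bounded whatever its
    length. *)
Lemma cmod_cis_sum x : cis x != 1 -> cmod (cis_sum x) <= 2 / cmod (cis x - 1).
Proof.
move=> h; have h0 : 0 < cmod (cis x - 1).
  rewrite lt_def cmod_ge0 andbT; apply: contraNneq h => /cmod_eq0/eqP.
  by rewrite subr_eq0.
rewrite ler_pdivlMr // mulrC -cmodM cis_sum_mul.
by apply: le_trans (cmodB _ _) _; rewrite cmod_cis cmod1.
Qed.

End averaging_weights.

(** None of the frequencies x, x + theta and x - theta of the three geometric sums
    is a multiple of 2 pi, so that only the division by their length matters. *)
Lemma pulse_filter_small (R : realType) (M : nat) (x e : R) : (2 < M)%N ->
  0 < `|x| -> `|x| != 2 * pi / M%:R -> `|x| + 2 * pi / M%:R < 2 * pi -> 0 < e ->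
  exists K0, forall K, (K0 <= K)%N -> (0 < K)%N -> cmod (pulse_filter M K x) <= e.
Proof.
move=> hM x0 hx1 hx2 e0; set th := _ / _ in hx1 hx2.
have th0 : 0 < th := theta_gt0 hM.
have n1 : cis x != 1 by apply: cis_neq1; rewrite x0 /=; lra.
have n2 : cis (x + th) != 1.
  apply: cis_neq1; apply/andP; split; last by have := ler_normD x th; rewrite (gtr0_norm th0); lra.
  rewrite normr_gt0; apply: contra_neq hx1 => h.
  by rewrite (_ : x = - th) ?normrN ?gtr0_norm //; lra.
have n3 : cis (x - th) != 1.
  apply: cis_neq1; apply/andP; split; last by have := ler_normB x th; rewrite (gtr0_norm th0); lra.
  rewrite normr_gt0; apply: contra_neq hx1 => h.
  by rewrite (_ : x = th) ?gtr0_norm //; lra.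
set C := 2 / cmod (cis x - 1) + (2 / cmod (cis (x + th) - 1) + 2 / cmod (cis (x - th) - 1)).
have C0 : 0 <= C by rewrite !addr_ge0 // divr_ge0 ?cmod_ge0.
have C1 : 0 < C + 1 by lra.
have [K0 hK0] := inv_natr_small (divr_gt0 e0 C1).
exists K0.+1 => K hK K1; rewrite pulse_filterE //.
set a := cis_sum _ _ x; set b := cis_sum _ _ _; set d := cis_sum _ _ _.
have ha : cmod a <= 2 / cmod (cis x - 1) := cmod_cis_sum M K n1.
have hb : cmod b <= 2 / cmod (cis (x + th) - 1) := cmod_cis_sum M K n2.
have hd : cmod d <= 2 / cmod (cis (x - th) - 1) := cmod_cis_sum M K n3.
have N0 : 0 < (M * K)%:R :> R := N_gt0 hM K1.
rewrite cmodM cmodR gtr0_norm ?invr_gt0 //.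
have h1 : cmod (a + (2^-1)%:C * (b + d)) <= C.
  apply: le_trans (cmodD _ _) _; rewrite cmodM cmodR gtr0_norm ?invr_gt0 // /C.
  by have := cmodD b d; have := cmod_ge0 (b + d); lra.
rewrite mulrC ler_pdivrMr //; apply: le_trans h1 _.
have h2 := hK0 K0 (leqnn _).
have h3 : K0.+1%:R <= (M * K)%:R :> R.
  by rewrite ler_nat; apply: leq_trans hK _; rewrite leq_pmull // (leq_trans _ hM).
have h4 : 1 < e / (C + 1) * K0.+1%:R by rewrite -ltr_pdivrMr ?ltr0n // div1r.
have h5 : C + 1 <= e * K0.+1%:R.
  by have := ltW h4; rewrite mulrAC ler_pdivlMr // mul1r.
have : e * K0.+1%:R <= e * (M * K)%:R by rewrite ler_pM2l.
by lra.
Qed.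

(** * Resonant transfer between two levels *)

Lemma subr_insert (U : zmodType) (p q r s d u : U) :
  p - r - (s + d) = (p - q - u) + ((q - r - d) + (u - s)).
Proof.
have e1 : p - q - u + (q - r - d) = p - r - d - u.
  by rewrite [in LHS]addrAC -[q - r - d]addrA addrA subrK addrA.
by rewrite addrA e1 addrA subrK opprD addrA addrAC.
Qed.

Section weighted_coordinates.
Context {R : realType} {H : completeNormedModType R[i]}.
Context {ip : {dot H for Num.conj}}.
Hypothesis ip_norm : forall x : H, `|x| ^+ 2 = ip x x.
Context {phi : nat -> H} (phi_basis : hilbert_basis ip phi).
Variable w : nat -> R.
Implicit Types x y : H.

Local Notation coord x j := (ip x (phi j)).
Local Notation wle := (wnorm_le ip phi w).

Lemma wnorm_le_coord x y r M : 0 <= r ->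
  (forall j, cmod (coord y j) <= r * cmod (coord x j)) -> wle x M -> wle y (r * M).
Proof.
move=> r0 h hx; have M0 := wnorm_le_ge0 hx.
apply/(wnorm_leP ip_norm phi_basis) => [|n]; first exact: mulr_ge0.
have hn := proj1 (wnorm_leP ip_norm phi_basis w x M0) hx n.
rewrite exprMn; apply: le_trans (ler_wpM2l (sqr_ge0 r) hn).
rewrite mulr_sumr; apply: ler_sum => j _; rewrite [leRHS]mulrCA ler_wpM2l ?sqr_ge0 //.
by rewrite -exprMn ler_pXn2r ?nnegrE ?mulr_ge0 ?cmod_ge0.
Qed.

End weighted_coordinates.

Section averaging.
Context {R : realType} {H : completeNormedModType R[i]}.
Context {ip : {dot H for Num.conj}}.
Hypothesis ip_norm : forall x : H, `|x| ^+ 2 = ip x x.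
Context {phi : nat -> H} (phi_basis : hilbert_basis ip phi).
Variables (w lambda : nat -> R) (F V : R -> H -> H) (G : nat -> H) (c : R).
Implicit Types (x y : H) (t e M : R) (z : R[i]).

Local Notation coord x j := (ip x (phi j)).
Local Notation wle := (wnorm_le ip phi w).

Hypothesis c_ge0 : 0 <= c.
Hypothesis F_coord : forall t x j, coord (F t x) j = cis (- lambda j * t) * coord x j.
Hypothesis V_lin : forall t (a : R[i]) x y, V t (a *: x + y) = a *: V t x + V t y.
Hypothesis V_wle : forall t x M, 0 <= t -> wle x M -> wle (V t x) (expR (c * t) * M).
Hypothesis V_cont : forall x M e, wle x M -> 0 < e ->
  exists2 t0, 0 < t0 & forall t, 0 <= t <= t0 -> wle (V t x - x) e.
Hypothesis V_expand : forall n e, 0 < e ->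
  exists2 t0, 0 < t0 & forall t, 0 <= t <= t0 ->
    wle (V t (phi n) - phi n - t%:C *: G n) (t * e).
Hypothesis G_wle : forall n, exists M, wle (G n) M.
Hypothesis G_skew : forall n m, coord (G n) m = - Num.conj (coord (G m) n).

Lemma free_lin t (a : R[i]) x y : F t (a *: x + y) = a *: F t x + F t y.
Proof.
apply: (coord_ext phi_basis) => j.
by rewrite F_coord !ipDl !ipZl !F_coord mulrDr mulrCA.
Qed.

Lemma free_phi t n : F t (phi n) = cis (- lambda n * t) *: phi n.
Proof.
apply: (coord_ext phi_basis) => j; rewrite F_coord ipZl (ip_phi phi_basis).
by have [->|] := eqVneq n j; rewrite ?mulr0.
Qed.

Lemma free_wle t x M : wle x M -> wle (F t x) M.
Proof.
move=> hx; rewrite -[M]mul1r; apply: wnorm_le_coord (hx) => // j.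
by rewrite F_coord cmodM cmod_cis.
Qed.

(** A switching sequence is a list of phases of given durations: [true] for the
    coupled and [false] for the free evolution. *)
Definition run (p : bool * R) x := if p.1 then V p.2 x else F p.2 x.
Definition play (ws : seq (bool * R)) x := foldl (fun x p => run p x) x ws.
Definition valid (ws : seq (bool * R)) := all (fun p => 0 <= p.2) ws.
Definition pulse_time (ws : seq (bool * R)) : R :=
  \sum_(p <- ws) (if p.1 then p.2 else 0).

Lemma play_cat ws1 ws2 x : play (ws1 ++ ws2) x = play ws2 (play ws1 x).
Proof. exact: foldl_cat. Qed.

Lemma play_lin ws (a : R[i]) x y : play ws (a *: x + y) = a *: play ws x + play ws y.
Proof.
elim: ws x y => [//|[[] t] ws IH] x y; rewrite /= /run /=.
  by rewrite V_lin IH.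
by rewrite free_lin IH.
Qed.

Lemma playB ws x y : play ws (x - y) = play ws x - play ws y.
Proof. exact: (linB (play_lin ws)). Qed.

Lemma playZ ws (a : R[i]) x : play ws (a *: x) = a *: play ws x.
Proof. exact: (linZ (play_lin ws)). Qed.

Lemma play_wle ws x M : valid ws -> wle x M ->
  wle (play ws x) (expR (c * pulse_time ws) * M).
Proof.
rewrite /valid /pulse_time; elim: ws x M => [|[[] t] ws IH] x M /=.
- by rewrite big_nil mulr0 expR0 mul1r.
- move=> /andP[t0 h] hx; rewrite big_cons /= mulrDr expRD [expR (c * t) * _]mulrC -mulrA.
  by apply: IH => //; exact: V_wle.
- move=> /andP[t0 h] hx; rewrite big_cons /= add0r; apply: IH => //; exact: free_wle.
Qed.

(** The right derivative of f at 0 in the weighted norm is y, and its value x. *)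
Definition expands (f : R -> H) (x y : H) : Prop := forall e, 0 < e ->
  exists2 t0, 0 < t0 & forall t, 0 <= t <= t0 -> wle (f t - x - t%:C *: y) (t * e).

Lemma expands_free s f x y : expands f x y ->
  expands (fun t => F s (f t)) (F s x) (F s y).
Proof.
move=> h e /h[t0 t00 ht]; exists t0 => // t /ht/(free_wle s).
by rewrite !(linB (free_lin s)) (linZ (free_lin s)).
Qed.

(** The expansion of V is only known on eigenvectors, whence the form of the
    leading term; on the first-order term y, strong continuity is enough. *)
Lemma expands_pulse v n z f y M : 0 <= v -> wle y M -> expands f (z *: phi n) y ->
  expands (fun t => V (v * t) (f t)) (z *: phi n) (y + (z * v%:C) *: G n).
Proof.
move=> v0 hy hf e e0.
have cv0 : 0 < c * v + 1 by have := mulr_ge0 c_ge0 v0; lra.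
have e1 : 0 < e / 3 / expR 1 by rewrite !divr_gt0 ?expR_gt0.
have zv0 : 0 < cmod z * v + 1 by have := mulr_ge0 (cmod_ge0 z) v0; lra.
have e2 : 0 < e / 3 / (cmod z * v + 1) by rewrite !divr_gt0.
have e3 : 0 < e / 3 by rewrite divr_gt0.
have [t1 t10 h1] := hf _ e1; have [t2 t20 h2] := V_expand n e2.
have [t3 t30 h3] := V_cont hy e3.
have v1 : 0 < v + 1 by lra.
exists (Num.min (Num.min t1 (c * v + 1)^-1) (Num.min (t2 / (v + 1)) (t3 / (v + 1)))).
  by rewrite !lt_min t10 invr_gt0 cv0 !divr_gt0.
move=> t; rewrite !le_min => /andP[t0 /andP[/andP[g1 g2] /andP[g3 g4]]].
have vt0 : 0 <= v * t by rewrite mulr_ge0.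
have vt2 : v * t <= t2 by rewrite ler_pdivlMr // in g3; nra.
have vt3 : v * t <= t3 by rewrite ler_pdivlMr // in g4; nra.
have ct : c * (v * t) <= 1 by rewrite -[_^-1]mul1r ler_pdivlMr // in g2; nra.
have VB := linB (V_lin (v * t)); have VZ := linZ (V_lin (v * t)).
(* Three errors: of the incoming expansion, of V on phi n, and of V on y *)
have -> : V (v * t) (f t) - z *: phi n - t%:C *: (y + (z * v%:C) *: G n) =
  V (v * t) (f t - z *: phi n - t%:C *: y) +
  (z *: (V (v * t) (phi n) - phi n - (v * t)%:C *: G n) +
   t%:C *: (V (v * t) y - y)).
  rewrite !VB !VZ !scalerBr scalerDr !scalerA realCM.
  have -> : z * (v%:C * t%:C) = t%:C * (z * v%:C) by ring.
  move: (V _ (f t)) (z *: V _ _) (z *: phi n) (_ *: V _ y) (_ *: y) (_ *: G n).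
  by move=> p q r s u d; exact: subr_insert.
apply: wnorm_le_mono (wnorm_leD (V_wle vt0 (h1 t _)) 
  (wnorm_leD (wnorm_leZ z (h2 _ _)) (wnorm_leZ t%:C (h3 _ _)))); rewrite ?t0 ?vt0 //.
rewrite cmodR ger0_norm //.
have a1 : expR (c * (v * t)) * (t * (e / 3 / expR 1)) <= t * (e / 3).
  have -> : t * (e / 3) = expR 1 * (t * (e / 3 / expR 1)) by field; rewrite ?lt0r_neq0 ?expR_gt0.
  by rewrite ler_wpM2r ?ler_expR // mulr_ge0 // ltW.
have a2 : cmod z * (v * t * (e / 3 / (cmod z * v + 1))) <= t * (e / 3).
  rewrite !mulrA ler_pdivrMr //; have := mulr_ge0 t0 (ltW e3); nra.
lra.
Qed.

Lemma phi_wle n : exists M, wle (phi n) M.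
Proof.
have [M] := wnorm_le_comb ip_norm phi_basis w (fun i => (i == n)%:R) n.+1.
rewrite (_ : comb _ _ _ = phi n); first by exists M.
apply: (coord_ext phi_basis) => j; rewrite (ip_phi phi_basis) (coord_comb phi_basis).
by rewrite eq_sym; case: ltnP => // hj; rewrite ltn_eqF.
Qed.

(** A waiting time depending on t changes the diagonal of the first-order term,
    which serves to compensate detuning. *)
Lemma expands_drift s r n :
  expands (fun t => F (s + r * t) (phi n)) (cis (- lambda n * s) *: phi n)
    ((cis (- lambda n * s) * ('i * (- lambda n * r)%:C)) *: phi n).
Proof.
move=> e e0; have [M hM] := phi_wle n.
have M0 := wnorm_le_ge0 hM; set k := - lambda n * r.
have d0 : 0 < 2 * (k ^+ 2 * M) + 1 by have := mulr_ge0 (sqr_ge0 k) M0; lra.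
exists (Num.min (e / (2 * (k ^+ 2 * M) + 1)) (1 + `|k|)^-1).
  by rewrite lt_min divr_gt0 //= invr_gt0 ltr_pwDl.
move=> t; rewrite le_min => /andP[t0 /andP[g1 g2]].
rewrite free_phi mulrDr cisD mulrA -/k !scalerA -!scalerBl.
set z := cis (- lambda n * s).
have -> : z * cis (k * t) - z - t%:C * (z * ('i * k%:C)) =
   z * (cis (k * t) - 1 - 'i * (k * t)%:C) by rewrite [(k * t)%:C]realCM; ring.
apply: wnorm_le_mono (wnorm_leZ _ hM); rewrite cmodM cmod_cis mul1r.
have k1 : 0 < 1 + `|k| by rewrite ltr_pwDl.
have kt : `|k * t| <= 1.
  rewrite normrM (ger0_norm t0); rewrite -[_^-1]mul1r ler_pdivlMr // in g2.
  by rewrite mulrC; nra.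
have h := ler_wpM2r M0 (cis_expand kt); apply: le_trans h _.
rewrite ler_pdivlMr // in g1.
have -> : 2 * (k * t) ^+ 2 * M = t * (t * (2 * (k ^+ 2 * M))) by ring.
by rewrite ler_wpM2l //; apply: le_trans g1; rewrite ler_wpM2l // lerDl.
Qed.

(** Between two pulses, the free evolution during [a] turns the phases of the
    couplings at their own frequencies. *)
Fixpoint pulses (v : nat -> R) a t i : seq (bool * R) :=
  if i is i'.+1 then pulses v a t i' ++ [:: (true, v i' * t); (false, a)] else [::].

(** To first order the effects of the pulses add up, each coupling of phi n to
    phi m with the phase accumulated at the time of the pulse. *)
Lemma pulses_expand v a n z f y0 M0 : (forall i, 0 <= v i) -> wle y0 M0 ->
  expands f (z *: phi n) y0 -> forall i, exists y M,
  [/\ expands (fun t => play (pulses v a t i) (f t))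
        ((z * cis (- lambda n * (a * i%:R))) *: phi n) y,
      wle y M &
      forall m, coord y m = cis (- lambda m * (a * i%:R)) *
        (coord y0 m + z * (\sum_(k < i) (v k)%:C * cis ((lambda m - lambda n) * a * k%:R)) *
           coord (G n) m)].
Proof.
move=> v0 hy0 hf; elim=> [|i [y [M [IH1 IH2 IH3]]]].
  exists y0, M0; split=> [|//|m]; first by rewrite !mulr0 cis0 mulr1.
  by rewrite big_ord0 !mulr0 cis0 mul0r addr0 mul1r.
have [MG hG] := G_wle n.
set zi := z * _ in IH1.
exists (F a (y + (zi * (v i)%:C) *: G n)), (M + cmod (zi * (v i)%:C) * MG); split.
- have := expands_free a (expands_pulse (v0 i) IH2 IH1).
  rewrite (_ : F a (zi *: phi n) = (z * cis (- lambda n * (a * i.+1%:R))) *: phi n).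
    by move=> h e /h[t0 t00 ht]; exists t0 => // t /ht; rewrite play_cat.
  rewrite -[zi *: phi n]addr0 -[0 in LHS](scale0r (phi n)) -scalerDl addr0.
  apply: (coord_ext phi_basis) => j; rewrite F_coord !ipZl (ip_phi phi_basis).
  have [<-|_] := eqVneq n j; rewrite ?mulr0 // !mulr1 /zi -natr1 mulrCA -cisD.
  by congr (_ * cis _); ring.
- by apply: free_wle; apply: wnorm_leD => //; exact: wnorm_leZ.
- move=> m; rewrite F_coord ipDl ipZl IH3 big_ord_recr /=.
  rewrite mulrDr mulrA -cisD (_ : - lambda m * a + - lambda m * (a * i%:R) =
    - lambda m * (a * i.+1%:R)); last by rewrite -natr1; ring.
  have -> : cis (- lambda m * a) * (zi * (v i)%:C * coord (G n) m) =
     cis (- lambda m * (a * i.+1%:R)) *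
     (z * ((v i)%:C * cis ((lambda m - lambda n) * a * i%:R)) * coord (G n) m).
    have E : cis (- lambda m * (a * i.+1%:R)) * cis ((lambda m - lambda n) * a * i%:R) =
      cis (- lambda m * a) * cis (- lambda n * (a * i%:R)).
      by rewrite -!cisD; congr cis; rewrite -natr1; ring.
    by rewrite /zi; transitivity (z * (v i)%:C * coord (G n) m *
      (cis (- lambda m * a) * cis (- lambda n * (a * i%:R)))); [|rewrite -E]; ring.
  by ring.
Qed.

Lemma valid_pulses v a t i : (forall i, 0 <= v i) -> 0 <= a -> 0 <= t -> valid (pulses v a t i).
Proof.
move=> v0 a0 t0; elim: i => [//|i IH].
by rewrite /valid /= all_cat [all _ _]IH /= a0 mulr_ge0.
Qed.

Lemma pulse_time_cat ws1 ws2 : pulse_time (ws1 ++ ws2) = pulse_time ws1 + pulse_time ws2.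
Proof. exact: big_cat. Qed.

Lemma pulse_time_pulses v a t i : pulse_time (pulses v a t i) = (\sum_(k < i) v k) * t.
Proof.
elim: i => [|i IH]; first by rewrite /pulse_time big_nil big_ord0 mul0r.
rewrite /= pulse_time_cat IH [in X in _ + X]/pulse_time !big_cons big_nil /= big_ord_recr /=.
by rewrite mulrDl !addr0.
Qed.

(** After averaging, everything but the resonant couplings is negligible: the
    frequencies below a cutoff are filtered out, the others carry little norm. *)
Lemma resonance_residual g n (X : pred nat) e : 0 < g -> 0 < e ->
  (forall m, ~~ X m -> lambda m != lambda n) ->
  (forall m, ~~ X m -> `|lambda m - lambda n| = g -> coord (G n) m = 0) ->
  exists p0, forall p, (p0 <= p)%N -> (2 < p)%N ->
  exists K0, forall K, (K0 <= K)%N -> (0 < K)%N -> forall y,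
    (forall m, cmod (coord y m) <= if X m then 0 else
       cmod (pulse_filter p K ((lambda m - lambda n) * (2 * pi / p%:R / g))) *
       cmod (coord (G n) m)) ->
    wle y e.
Proof.
move=> g0 e0 hX hres; have [MG hG] := G_wle n; have MG0 := wnorm_le_ge0 hG.
have e2 : 0 < e / 2 by rewrite divr_gt0.
have [n1 hn1] := wnorm_le_tail ip_norm phi_basis hG e2.
pose W := \sum_(m < n1) `|lambda m - lambda n|.
have W0 : 0 <= W by exact: sumr_ge0.
(* So many samples per period that no frequency below the cutoff is mistaken for
   0 or for the gap. *)
exists (Num.bound (W / g + 1)) => p hp p2.
have pR : W / g + 1 < p%:R.
  apply: lt_le_trans (_ : (Num.bound (W / g + 1))%:R <= _); last by rewrite ler_nat.
  by apply: archi_boundP; rewrite addr_ge0 // divr_ge0 // ltW.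
pose rho := e / 2 / (MG + 1).
have MG1 : 0 < MG + 1 by lra.
have rho0 : 0 < rho by rewrite divr_gt0.
have th0 : 0 < 2 * pi / p%:R :> R := theta_gt0 p2.
have pn0 : 0 < p%:R :> R := M_gt0 p2.
pose om m := (lambda m - lambda n) * (2 * pi / p%:R / g).
have omE m : `|om m| = `|lambda m - lambda n| / g * (2 * pi / p%:R).
  rewrite /om normrM (gtr0_norm (divr_gt0 th0 g0)); move: `|_| => d.
  by rewrite mulrA mulrAC.
have [K0 hK0] : exists K0, forall K, (K0 <= K)%N -> forall m, (m < n1)%N ->
   ~~ X m -> (0 < K)%N ->
   cmod (pulse_filter p K (om m)) * cmod (coord (G n) m) <= rho * cmod (coord (G n) m).
  apply: (@fin_eventually n1 (fun m K => ~~ X m -> (0 < K)%N ->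
    cmod (pulse_filter p K (om m)) * cmod (coord (G n) m) <= rho * cmod (coord (G n) m))) => m hm.
  have [hXm|hXm] := boolP (X m); first by exists 0%N.
  have [hg|hg] := eqVneq `|lambda m - lambda n| g.
    by exists 0%N => K _ _ _; rewrite (hres m hXm hg) cmod0 !mulr0.
  have h1 : 0 < `|om m|.
    by rewrite omE mulr_gt0 // divr_gt0 // normr_gt0 subr_eq0 hX.
  have h2 : `|om m| != 2 * pi / p%:R.
    rewrite omE -[X in _ != X]mul1r; apply: contra_neq hg => /(mulIf (lt0r_neq0 th0)) h.
    by rewrite -[g]mul1r -h divfK // lt0r_neq0.
  have h3 : `|om m| + 2 * pi / p%:R < 2 * pi.
    rewrite omE -[X in _ + X]mul1r -mulrDl.
    have {2}-> : 2 * pi = p%:R * (2 * pi / p%:R) :> R by field; exact: lt0r_neq0.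
    rewrite ltr_pM2r //; apply: le_lt_trans pR; rewrite lerD2r ler_pM2r ?invr_gt0 //.
    by rewrite /W (bigD1 (Ordinal hm)) //= lerDl sumr_ge0.
  have [K0 hK0] := pulse_filter_small p2 h1 h2 h3 rho0.
  by exists K0 => K hK _ K1; rewrite ler_wpM2r ?cmod_ge0 // hK0.
exists K0 => K hK K1 y hy.
have y1 : wle (bproj ip phi n1 y) (rho * MG).
  apply: (wnorm_le_coord ip_norm phi_basis (ltW rho0) _ hG) => m.
  rewrite (coord_proj phi_basis); case: ltnP => hm; last first.
    by rewrite cmod0 mulr_ge0 ?cmod_ge0 // ltW.
  apply: le_trans (hy m) _; case: ifPn => hXm; first by rewrite mulr_ge0 ?cmod_ge0 // ltW.
  exact: hK0.
have y2 : wle (y - bproj ip phi n1 y) (1 * (e / 2)).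
  apply: (wnorm_le_coord ip_norm phi_basis ler01 _ hn1) => m.
  rewrite !ipBl !(coord_proj phi_basis); case: ltnP => hm; first by rewrite !subrr cmod0 mulr0.
  rewrite !subr0 mul1r; apply: le_trans (hy m) _.
  case: ifP => _; first exact: cmod_ge0.
  by rewrite ler_piMl ?cmod_ge0 // cmod_pulse_filter.
rewrite -[y](subrK (bproj ip phi n1 y)).
apply: wnorm_le_mono (wnorm_leD y2 y1).
have : rho * MG <= e / 2 by rewrite /rho mulrAC ler_pdivrMr // ler_wpM2l ?(ltW e2) // lerDl.
lra.
Qed.

Lemma cis_2pi_abs (x : R) n : `|x| = 2 * pi * n%:R -> cis x = 1.
Proof.
move=> hx; have [x0|x0] := ger0P x; first by rewrite -(ger0_norm x0) hx cis_2pi_nat.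
apply/eqP; rewrite -cisN_eq1 -(ltr0_norm x0) hx; apply/eqP; exact: cis_2pi_nat.
Qed.

Lemma cis_sync (x y s : R) n : `|x - y| * s = 2 * pi * n%:R -> 0 <= s ->
  cis (- x * s) = cis (- y * s).
Proof.
move=> h s0; have := @cis_2pi_abs ((x - y) * s) n; rewrite normrM (ger0_norm s0) => /(_ h) E.
by rewrite -[RHS]mul1r -(cisNK ((x - y) * s)) E mulr1 -cisD; congr cis; ring.
Qed.

(** To first order, on the span of the two levels and up to e, a cycle is the phase
    z times the flow of i kappa plus half of the resonant coupling. *)
Definition cycle_effect (C : R -> seq (bool * R)) (z : R[i]) (kappa e : R) n n' : Prop :=
  exists2 y, expands (fun t => play (C t) (phi n)) (z *: phi n) y &
    wle (y - z *: (('i * kappa%:C) *: phi n + ((2^-1)%:C * coord (G n) n') *: phi n')) e.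

(** The spacing a = th / g tunes the weights to the gap g. The waiting time r t,
    of either sign, balances the diagonal entries of the two levels; the fixed
    wait s makes the total positive without changing the relative phase. *)
Lemma cycle_exists j l e : 0 < e -> injective lambda -> j != l ->
  (forall n m, n \in [:: j; l] -> m \notin [:: j; l] ->
     `|lambda m - lambda n| = `|lambda j - lambda l| -> coord (G n) m = 0) ->
  exists C z kappa t1, [/\ 0 < t1, cmod z = 1,
    forall t, 0 <= t <= t1 -> valid (C t) /\ pulse_time (C t) = t,
    cycle_effect C z kappa e j l & cycle_effect C z kappa e l j].
Proof.
move=> e0 linj jl hres; set g := `|lambda j - lambda l| in hres.
have d0 : lambda j - lambda l != 0 by rewrite subr_eq0 (inj_eq linj).
have g0 : 0 < g by rewrite normr_gt0.
pose X := [pred m | m \in [:: j; l]].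
have hX n m : n \in [:: j; l] -> ~~ X m -> lambda m != lambda n.
  by move=> hn; rewrite (inj_eq linj); apply: contraNneq => ->.
have jX : j \in [:: j; l] by rewrite mem_head.
have lX : l \in [:: j; l] by rewrite in_cons mem_head orbT.
have [p1 hp1] := resonance_residual g0 e0 (fun m => hX j m jX) (fun m => hres j m jX).
have [p2 hp2] := resonance_residual g0 e0 (fun m => hX l m lX) (fun m => hres l m lX).
pose p := (p1 + p2 + 3)%N.
have hp : (2 < p)%N by exact: leq_addl.
have [K1 hK1] := hp1 p (leq_trans (leq_addr p2 _) (leq_addr _ _)) hp.
have [K2 hK2] := hp2 p (leq_trans (leq_addl p1 _) (leq_addr _ _)) hp.
pose K := (K1 + K2).+1; have K0 : (0 < K)%N by [].
have {hp1 hp2}hK1 := hK1 K (leqW (leq_addr _ _)) K0.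
have {hK2}hK2 := hK2 K (leqW (leq_addl _ _)) K0.
pose th : R := 2 * pi / p%:R; have th0 : 0 < th := theta_gt0 hp.
pose a := th / g; have a0 : 0 < a by rewrite divr_gt0.
pose s := 2 * pi / g; have s0 : 0 < s by rewrite divr_gt0 // mulr_gt0 // pi_gt0.
pose N := (p * K)%N.
have gs : g * s = 2 * pi * 1%:R by rewrite /s mulr1 mulrC divfK // lt0r_neq0.
have gN : g * (a * N%:R) = 2 * pi * K%:R.
  rewrite /a /th /N natrM; field; rewrite (lt0r_neq0 g0) /=.
  by rewrite pnatr_eq0 -lt0n (leq_trans _ hp).
have aN0 : 0 <= a * N%:R by rewrite mulr_ge0 // ltW.
pose T n := complex.Im (coord (G n) n).
have TE n : coord (G n) n = 'i * (T n)%:C.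
  have := G_skew n n; rewrite /T; case: (coord (G n) n) => u v /(congr1 (@complex.Re R)) /= h.
  by apply/eqP; rewrite eq_complex /=; apply/andP; split; apply/eqP; lra.
pose r := (T j - T l) / (lambda j - lambda l).
pose kappa := T j - r * lambda j.
have kappaE : kappa = T l - r * lambda l.
  have : r * (lambda j - lambda l) = T j - T l by rewrite divfK.
  by rewrite /kappa; lra.
pose z := cis (- lambda j * s) * cis (- lambda j * (a * N%:R)).
pose C t := (false, s + r * t) :: pulses (pulse_weight p K) a t N.
have wt0 i : 0 <= pulse_weight p K i :> R by exact: pulse_weight_ge0.
have main n n' : (n, n') = (j, l) \/ (n, n') = (l, j) ->
    (forall y, (forall m, cmod (coord y m) <= if X m then 0 else
       cmod (pulse_filter p K ((lambda m - lambda n) * a)) * cmod (coord (G n) m)) ->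
    wle y e) -> cycle_effect C z kappa e n n'.
  move=> hn hy.
  have nn' : n != n' by case: hn => [[-> ->]|[-> ->]] //; rewrite eq_sym.
  have Xn m : X m = (m == n) || (m == n').
    by case: hn => [[-> ->]|[-> ->]]; rewrite /X /= !inE // orbC.
  have gn : `|lambda n' - lambda n| = g.
    by case: hn => [[-> ->]|[-> ->]] //; rewrite distrC.
  have zn m : X m -> cis (- lambda m * s) = cis (- lambda j * s) /\
     cis (- lambda m * (a * N%:R)) = cis (- lambda j * (a * N%:R)).
    rewrite /X /= !inE => /orP[/eqP->//|/eqP->].
    by split; apply/esym; [apply: (cis_sync gs)|apply: (cis_sync gN)] => //; exact: ltW.
  have [y0 hy0] := phi_wle n.
  have [y [M [h1 h2 h3]]] := pulses_expand a wt0 (wnorm_leZ _ hy0) (expands_drift s r n) N.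
  have [z1 z2] : cis (- lambda n * s) = cis (- lambda j * s) /\
      cis (- lambda n * (a * N%:R)) = cis (- lambda j * (a * N%:R)).
    by apply: zn; rewrite Xn eqxx.
  rewrite z1 z2 in h1; exists y; first exact: h1.
  apply: hy => m; rewrite ipBl h3 z1 !ipZl ipDl !ipZl !(ip_phi phi_basis).
  rewrite -/(pulse_filter p K ((lambda m - lambda n) * a)) Xn.
  rewrite [n == m]eq_sym [n' == m]eq_sym.
  have [->|mn] /= := eqVneq m n.
    rewrite (negbTE nn') subrr mul0r pulse_filter0 // z2 TE /z.
    have -> : kappa = T n - r * lambda n by case: hn => [[-> _]|[-> _]].
    have -> : (T n - r * lambda n)%:C = (T n)%:C + (- lambda n * r)%:C.
      by rewrite -realCD; congr (_%:C); ring.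
    rewrite [false%:R]mulr0n.
    by rewrite le_eqVlt; apply/orP; left; apply/eqP; rewrite -[RHS](@cmod0 R); congr cmod; ring.
  have [->|mn'] /= := eqVneq m n'.
    have -> : pulse_filter p K ((lambda n' - lambda n) * a) = (2^-1)%:C.
      have := gn; case: (ger0P (lambda n' - lambda n)) => _ h.
        by rewrite h /a mulrC divfK ?lt0r_neq0 // pulse_filter_theta.
      have -> : lambda n' - lambda n = - g by rewrite -h opprK.
      by rewrite mulNr /a mulrC divfK ?lt0r_neq0 // pulse_filter_thetaN.
    rewrite (proj2 (zn n' _)) ?Xn ?eqxx ?orbT // /z.
    by rewrite le_eqVlt; apply/orP; left; apply/eqP; rewrite -[RHS](@cmod0 R); congr cmod; ring.
  rewrite !mulr0 add0r addr0 mulr0 subr0 !cmodM !cmod_cis !mul1r //.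
exists C, z, kappa, (s / (`|r| + 1)); split.
- by rewrite divr_gt0 // ltr_wpDl.
- by rewrite cmodM !cmod_cis mulr1.
- move=> t /andP[t0 t1]; split.
    rewrite /valid /= [all _ _]valid_pulses ?(ltW a0) // andbT.
    have r1 : 0 < `|r| + 1 by rewrite ltr_wpDl.
    rewrite ler_pdivlMr // in t1; have := ler_norm (- r); rewrite normrN; nra.
  by rewrite /C -cat1s pulse_time_cat pulse_time_pulses sum_pulse_weight // mul1r
    /pulse_time big_seq1 add0r.
- by apply: main => //; left.
- by apply: main => //; right.
Qed.

Lemma expands_lin f f' x x' y y' (a : R[i]) : expands f x y -> expands f' x' y' ->
  expands (fun t => f t + a *: f' t) (x + a *: x') (y + a *: y').
Proof.
move=> h h' e e0; have a0 : 0 < cmod a + 1 by have := cmod_ge0 a; lra.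
have e2 : 0 < e / 2 by rewrite divr_gt0.
have [t1 t10 h1] := h _ e2; have [t2 t20 h2] := h' _ (divr_gt0 e2 a0).
exists (Num.min t1 t2); first by rewrite lt_min t10.
move=> t; rewrite le_min => /andP[t0 /andP[g1 g2]].
have -> : f t + a *: f' t - (x + a *: x') - t%:C *: (y + a *: y') =
    (f t - x - t%:C *: y) + a *: (f' t - x' - t%:C *: y').
  rewrite !scalerBr scalerDr !scalerA [a * _]mulrC.
  by rewrite !opprD (addrACA (f t)) [LHS]addrACA.
apply: wnorm_le_mono (wnorm_leD (h1 t _) (wnorm_leZ a (h2 t _))); rewrite ?t0 //.
have : cmod a * (t * (e / 2 / (cmod a + 1))) <= t * (e / 2).
  rewrite !mulrA ler_pdivrMr //; have := mulr_ge0 t0 (ltW e2); have := cmod_ge0 a; nra.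
by lra.
Qed.

(** The defects of the successive steps add up, amplified at most by q per step. *)
Lemma approx_eigen_iter (U : H -> H) q d (z : R[i]) v m :
  (forall (a : R[i]) x y, U (a *: x + y) = a *: U x + U y) -> 1 <= q ->
  (forall x M, wle x M -> wle (U x) (q * M)) -> cmod z = 1 ->
  wle (U v - z *: v) d -> wle (iter m U v - z ^+ m *: v) (m%:R * d * q ^+ m).
Proof.
move=> Ulin q1 hU hz hd; have d0 := wnorm_le_ge0 hd.
elim: m => [|m IH]; first by rewrite expr0 scale1r subrr !mul0r; exact: wnorm_le0.
have -> : iter m.+1 U v - z ^+ m.+1 *: v =
    U (iter m U v - z ^+ m *: v) + z ^+ m *: (U v - z *: v).
  by rewrite (linB Ulin) (linZ Ulin) scalerBr scalerA -exprSr addrA subrK.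
apply: wnorm_le_mono (wnorm_leD (hU _ _ IH) (wnorm_leZ _ hd)).
have -> : cmod (z ^+ m) = 1 by rewrite cmodX hz expr1n.
have qm : 1 <= q ^+ m.+1 by exact: exprn_ege1.
rewrite -natr1 mul1r [q ^+ m.+1]exprS in qm *.
have : d <= d * (q * q ^+ m) by rewrite ler_peMr.
by lra.
Qed.

Lemma iter_play ws m x : iter m (play ws) x = play (flatten (nseq m ws)) x.
Proof.
by elim: m x => [//|m IH] x; rewrite iterSr IH /= play_cat.
Qed.

Lemma valid_flatten ws m : valid ws -> valid (flatten (nseq m ws)).
Proof. by move=> h; elim: m => [//|m IH]; rewrite /valid /= all_cat -/(valid _) h. Qed.

(** The vector phi j + sg phi l diagonalizes the effective generator, which reduces
    the dynamics on the span of the two levels to scalar phases. *)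
Lemma cycle_eigen C z kappa e j l om (sg : R[i]) :
  0 < e -> cmod z = 1 -> cmod sg = 1 ->
  coord (G j) l = (2 * om)%:C * 'i * sg ->
  cycle_effect C z kappa e j l -> cycle_effect C z kappa e l j ->
  exists2 t0, 0 < t0 & forall t, 0 <= t <= t0 ->
    wle (play (C t) (phi j + sg *: phi l) -
         (z * cis ((kappa + om) * t)) *: (phi j + sg *: phi l)) (t * (4 * e)).
Proof.
move=> e0 hz hsg hb [yj hj rj] [yl hl rl].
set v := phi j + sg *: phi l.
have [Mj hMj] := phi_wle j; have [Ml hMl] := phi_wle l.
have hv : wle v (Mj + Ml).
  by apply: wnorm_leD => //; rewrite -[Ml]mul1r -hsg; exact: wnorm_leZ.
set Mv := Mj + Ml in hv; have Mv0 := wnorm_le_ge0 hv.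
have hex := expands_lin sg hj hl.
have ss : Num.conj sg * sg = 1 by rewrite mulrC mul_conj_cmod hsg expr1n.
have res : wle ((yj + sg *: yl) - (z * ('i * (kappa + om)%:C)) *: v) (2 * e).
  have -> : (yj + sg *: yl) - (z * ('i * (kappa + om)%:C)) *: v =
    (yj - z *: (('i * kappa%:C) *: phi j + ((2^-1)%:C * coord (G j) l) *: phi l)) +
    sg *: (yl - z *: (('i * kappa%:C) *: phi l + ((2^-1)%:C * coord (G l) j) *: phi j)).
    apply: (coord_ext phi_basis) => m.
    rewrite (G_skew l j) hb !conjcM conjcr conjci.
    rewrite /v !(ipDl, ipNl, ipZl).
    move: (coord yj m) (coord yl m) (coord (phi j) m) (coord (phi l) m).
    move=> a b p q; rewrite realCD [(2 * om)%:C]realCM.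
    have h2 : (2^-1)%:C * 2%:C = 1 :> R[i] by rewrite -realCM mulVf ?pnatr_eq0.
    set h := (2^-1)%:C in h2 *; set k := 2%:C in h2 *;
    set o := om%:C.
    set sc := Num.conj sg in ss *.
    transitivity (a + sg * b - z * ('i * (kappa%:C + (h * k) * o)) * (p + sg * q)).
      by rewrite h2 mul1r.
    transitivity (a + sg * b - z * 'i * kappa%:C * (p + sg * q) -
      z * 'i * (h * k) * o * (sc * sg * p + sg * q)); first by rewrite ss; ring.
    by ring.
  apply: wnorm_le_mono (wnorm_leD rj (wnorm_leZ sg rl)).
  by rewrite hsg mul1r mulr_natl mulr2n.
set k := kappa + om in res *.
have d0 : 0 < 2 * (k ^+ 2 * Mv) + 1 by have := mulr_ge0 (sqr_ge0 k) Mv0; lra.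
have k1 : 0 < 1 + `|k| by rewrite ltr_pwDl.
have [t1 t10 h1] := hex _ e0.
exists (Num.min t1 (Num.min (e / (2 * (k ^+ 2 * Mv) + 1)) (1 + `|k|)^-1)).
  by rewrite !lt_min t10 divr_gt0 //= invr_gt0.
move=> t; rewrite !le_min => /andP[t0 /and3P[g1 g2 g3]].
have {}h1 := h1 t _; rewrite t0 g1 in h1; have {}h1 := h1 isT.
have kt : `|k * t| <= 1.
  rewrite normrM (ger0_norm t0); rewrite -[_^-1]mul1r ler_pdivlMr // in g3.
  by rewrite mulrC; nra.
have h3 : cmod (cis (k * t) - 1 - 'i * (k * t)%:C) * Mv <= t * e.
  apply: le_trans (ler_wpM2r Mv0 (cis_expand kt)) _.
  rewrite ler_pdivlMr // in g2.
  have -> : 2 * (k * t) ^+ 2 * Mv = t * (t * (2 * (k ^+ 2 * Mv))) by ring.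
  by rewrite ler_wpM2l //; apply: le_trans g2; rewrite ler_wpM2l // lerDl.
have -> : play (C t) v - (z * cis (k * t)) *: v =
  (play (C t) (phi j) + sg *: play (C t) (phi l) - (z *: phi j + sg *: (z *: phi l)) -
     t%:C *: (yj + sg *: yl)) +
  (t%:C *: ((yj + sg *: yl) - (z * ('i * k%:C)) *: v) -
   (z * (cis (k * t) - 1 - 'i * (k * t)%:C)) *: v).
  have -> : play (C t) v = play (C t) (phi j) + sg *: play (C t) (phi l).
    by rewrite /v addrC play_lin addrC.
  apply: (coord_ext phi_basis) => m; rewrite /v !(ipDl, ipNl, ipZl) [(k * t)%:C]realCM.
  by ring.
apply: wnorm_le_mono (wnorm_leD h1 (wnorm_leB (wnorm_leZ _ res) (wnorm_leZ _ hv))).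
rewrite cmodM hz mul1r cmodR ger0_norm //; lra.
Qed.

(** At total pulse time Th, with beta Th = pi / 2, the two eigenvectors
    phi j + sg phi l and phi j - sg phi l have acquired opposite relative phases;
    so their sum, along phi j, has become their difference, along phi l. *)
Lemma transition j l e : 0 < e -> injective lambda -> j != l ->
  (forall n m, n \in [:: j; l] -> m \notin [:: j; l] ->
     `|lambda m - lambda n| = `|lambda j - lambda l| -> coord (G n) m = 0) ->
  coord (G j) l != 0 ->
  exists ws z, [/\ valid ws, cmod z = 1 & wle (play ws (phi j) - z *: phi l) e].
Proof.
move=> e0 linj jl hres b0; set b := coord (G j) l in b0.
have cb0 : 0 < cmod b.
  by rewrite lt_def cmod_ge0 andbT; apply: contraNneq b0 => /cmod_eq0 ->.
pose beta := cmod b / 2; have beta0 : 0 < beta by rewrite divr_gt0.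
(* The effective coupling is a rotation at speed beta. *)
pose sg : R[i] := - 'i * (b * (cmod b)^-1%:C).
have cc : (cmod b)%:C * (cmod b)^-1%:C = 1 :> R[i] by rewrite -realCM mulfV ?lt0r_neq0.
have ii : 'i * 'i = -1 :> R[i] by rewrite -expr2 sqrCi.
have hsg : cmod sg = 1.
  by rewrite /sg cmodM cmodN cmod_i mul1r cmodM cmodR gtr0_norm ?invr_gt0 // mulfV ?lt0r_neq0.
have b1 : coord (G j) l = (2 * beta)%:C * 'i * sg.
  rewrite (_ : 2 * beta = cmod b); last by rewrite /beta mulrC divfK.
  transitivity (- ('i * 'i) * b * ((cmod b)%:C * (cmod b)^-1%:C)).
    by rewrite ii cc opprK mul1r mulr1.
  by rewrite /sg; ring.
have b2 : coord (G j) l = (2 * - beta)%:C * 'i * - sg.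
  by rewrite b1 [2 * - beta]mulrN [(- (2 * beta))%:C]realCN; ring.
have [Th Th0 bT] : exists2 Th, 0 < Th & beta * Th = pi / 2.
  by exists (pi / 2 / beta); rewrite ?divr_gt0 ?pi_gt0 // mulrC divfK ?lt0r_neq0.
pose eta := e / (4 * Th * expR (c * Th)).
have den0 : 0 < 4 * Th * expR (c * Th) by rewrite !mulr_gt0 ?expR_gt0.
have eta0 : 0 < eta by rewrite divr_gt0.
have [C [z [kappa [t1 [t10 hz hC he1 he2]]]]] := cycle_exists eta0 linj jl hres.
have [t2 t20 h2] := cycle_eigen eta0 hz hsg b1 he1 he2.
have [t3 t30 h3] := cycle_eigen eta0 hz (etrans (cmodN sg) hsg) b2 he1 he2.
have q0 : 0 < Num.min t1 (Num.min t2 t3) / Th by rewrite divr_gt0 // !lt_min t10 t20.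
have [m hm] := inv_natr_small q0; have {hm}hm := hm m (leqnn m).
(* m.+1 cycles of pulse time t each *)
pose t := Th / m.+1%:R.
have m0 : 0 < m.+1%:R :> R by rewrite ltr0n.
have tE : m.+1%:R * t = Th by rewrite /t mulrC divfK ?lt0r_neq0.
have t0 : 0 <= t by rewrite ltW // divr_gt0.
have : t <= Num.min t1 (Num.min t2 t3).
  by move: hm; rewrite ltr_pdivlMr // => /ltW; rewrite /t mulrC.
rewrite !le_min => /and3P[g1 g2 g3].
have [|hv hp] := hC t; first by rewrite t0 g1.
have q1 : 1 <= expR (c * t) by rewrite -expR0 ler_expR mulr_ge0.
have hU x M : wle x M -> wle (play (C t) x) (expR (c * t) * M).
  by move=> hx; rewrite -[in X in expR (c * X)]hp; exact: play_wle.
have e2 := approx_eigen_iter m.+1 (play_lin (C t)) q1 hU _ (h2 t _).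
have e3 := approx_eigen_iter m.+1 (play_lin (C t)) q1 hU _ (h3 t _).
rewrite -!expRM_natl !iter_play !exprMn !cis_natX in e2 e3.
set W := flatten _ in e2 e3.
have {}e2 := e2 _ _; have {}e3 := e3 _ _.
rewrite t0 g2 cmodM hz cmod_cis mul1r in e2; have {}e2 := e2 erefl erefl.
rewrite t0 g3 cmodM hz cmod_cis mul1r in e3; have {}e3 := e3 erefl erefl.
pose Z := z ^+ m.+1 * cis (kappa * Th).
have p1 : z ^+ m.+1 * cis ((kappa + beta) * t * m.+1%:R) = Z * 'i.
  rewrite -mulrA [t * _]mulrC tE mulrDl bT cisD cis_pihalf mulrA //.
have p2 : z ^+ m.+1 * cis ((kappa - beta) * t * m.+1%:R) = - (Z * 'i).
  by rewrite -mulrA [t * _]mulrC tE mulrBl bT cisD -cis_conj cis_pihalf conjci mulrN mulrN mulrA.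
rewrite p1 in e2; rewrite p2 in e3.
exists W, (Z * 'i * sg); split; first exact: valid_flatten.
  by rewrite cmodM hsg !cmodM cmodX hz expr1n !cmod_cis cmod_i !mul1r.
have hh : (2^-1)%:C + (2^-1)%:C = 1 :> R[i] by rewrite -realCD; congr (_%:C); lra.
set h := (2^-1)%:C in hh.
have -> : play W (phi j) - (Z * 'i * sg) *: phi l =
  h *: (play W (phi j + sg *: phi l) - (Z * 'i) *: (phi j + sg *: phi l)) +
  h *: (play W (phi j + - sg *: phi l) - (- (Z * 'i)) *: (phi j + - sg *: phi l)).
  rewrite ![phi j + _]addrC !play_lin.
  apply: (coord_ext phi_basis) => n; rewrite !(ipDl, ipNl, ipZl).
  move: (coord (play W _) n) (coord (play W _) n) (coord (phi j) n) (coord (phi l) n).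
  move=> x y p q; transitivity ((h + h) * (y - Z * 'i * sg * q)).
    by rewrite hh mul1r.
  by ring.
apply: wnorm_le_mono (wnorm_leD (wnorm_leZ h e2) (wnorm_leZ h e3)).
rewrite cmodR gtr0_norm ?invr_gt0 //.
have -> : m.+1%:R * (t * (4 * eta)) * expR (m.+1%:R * (c * t)) = e.
  rewrite [m.+1%:R * (c * t)]mulrCA mulrA tE.
  rewrite /eta; field; rewrite ?lt0r_neq0 //; exact: expR_gt0.
by rewrite -mulrDl (_ : 2^-1 + 2^-1 = 1) ?mul1r //; lra.
Qed.

(** The phase is left free: it is fixed once, at the very end. *)
Definition reachable p q : Prop := forall e, 0 < e ->
  exists ws z, [/\ valid ws, cmod z = 1 & wle (play ws (phi p) - z *: phi q) e].

Lemma reachable_refl p : reachable p p.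
Proof.
move=> e e0; exists [::], 1; split; [by []|exact: cmod1|].
by rewrite scale1r subrr; apply: wnorm_le0; exact: ltW.
Qed.

(** The second sequence is chosen first, as it amplifies the error of the first. *)
Lemma reachable_trans p q r : reachable p q -> reachable q r -> reachable p r.
Proof.
move=> h1 h2 e e0; have e2 : 0 < e / 2 by rewrite divr_gt0.
have [ws2 [z2 [v2 hz2 hw2]]] := h2 _ e2.
have E0 := expR_gt0 (c * pulse_time ws2).
have [ws1 [z1 [v1 hz1 hw1]]] := h1 _ (divr_gt0 e2 E0).
exists (ws1 ++ ws2), (z1 * z2); split.
- by rewrite /valid all_cat; apply/andP.
- by rewrite cmodM hz1 hz2 mulr1.
have -> : play (ws1 ++ ws2) (phi p) - (z1 * z2) *: phi r =
  play ws2 (play ws1 (phi p) - z1 *: phi q) + z1 *: (play ws2 (phi q) - z2 *: phi r).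
  by rewrite play_cat playB playZ scalerBr scalerA addrA subrK.
apply: wnorm_le_mono (wnorm_leD (play_wle v2 hw1) (wnorm_leZ z1 hw2)).
by rewrite hz1 mul1r mulrC divfK ?lt0r_neq0 // -splitr.
Qed.

(** A free evolution of the target level absorbs the phase. *)
Lemma reachable_exact p q e : 0 < e -> 0 < lambda q -> reachable p q ->
  exists ws t, [/\ valid ws, 0 < t & wle (play (rcons ws (false, t)) (phi p) - phi q) e].
Proof.
move=> e0 lq /(_ e e0) [ws [z [hv hz hw]]]; have [x x0 zx] := cis_surj hz.
exists ws, (x / lambda q); split=> //; first exact: divr_gt0.
have -> : play (rcons ws (false, x / lambda q)) (phi p) - phi q =
    F (x / lambda q) (play ws (phi p) - z *: phi q).
  rewrite -cats1 play_cat /= /run /=.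
  apply: (coord_ext phi_basis) => m; rewrite ipBl !F_coord ipBl ipZl mulrBr; congr (_ - _).
  rewrite (ip_phi phi_basis); have [<-|_] := eqVneq q m; rewrite ?mulr0 // mulr1 zx -cisD.
  by rewrite mulNr mulrC divfK ?lt0r_neq0 // addNr cis0.
exact: free_wle.
Qed.

End averaging.

Arguments reachable {R H} ip phi w F V p q.

(** * Switching sequences and trajectories *)

Section control_words.
Context {R : realType} {H : completeNormedModType R[i]}.
Context {ip : {dot H for Num.conj}}.
Variables (A B C : linop H) (delta : R).
Implicit Types (x : H) (ws : seq (bool * R)) (s t v : R).

Local Notation E v := (expgroup ip (ctrlop A B C v (v ^+ 2))).
Hypothesis E0 : forall v x, E v 0 x = x.
Hypothesis ED : forall v s t x, E v (s + t) x = E v s (E v t x).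

Definition level (b : bool) : R := if b then delta else 0.

Fixpoint control ws t : R :=
  if ws is p :: ws' then
    if t < p.2 then level p.1 else control ws' (t - p.2)
  else 0.

Definition duration ws : R := \sum_(p <- ws) p.2.

Lemma duration_ge0 ws : valid ws -> 0 <= duration ws.
Proof.
move=> /allP h; rewrite /duration big_seq; apply: sumr_ge0 => p /h.
by [].
Qed.

Lemma duration_cons p ws : duration (p :: ws) = p.2 + duration ws.
Proof. exact: big_cons. Qed.

Lemma control_values ws t : control ws t = 0 \/ control ws t = delta.
Proof.
elim: ws t => [|[b d] ws IH] t /=; first by left.
by case: ifP => _ //; case: b; [right|left].
Qed.

Lemma control_piecewise_constant ws : valid ws -> piecewise_constant (control ws).
Proof.
elim: ws => [_|[b d] ws IH /= /andP[d0 /IH [tau [tau0 tauh tauoo tauc]]]].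
  exists (fun n => n%:R); split=> // [i j ij|]; first by rewrite ler_nat.
  exact: cvgr_idn.
exists (fun n => if n is m.+1 then d + tau m else 0); split=> //.
- case=> [|i] [|j] //= ij; last by rewrite lerD2l tauh.
  by rewrite addr_ge0 // -tau0 tauh.
- have h : (fun n => d + tau n) @ \oo --> +oo.
    apply/cvgryPge => M; have /cvgryPge /(_ (M - d)) := tauoo.
    by apply: filterS => n; rewrite lerBlDl.
  by rewrite -(cvg_shiftS (fun n => if n is m.+1 then d + tau m else 0)).
- case=> [|j] t /andP[h1 h2].
    by rewrite tau0 addr0 in h2; rewrite h2 (le_lt_trans h1 h2).
  have t0 : 0 <= tau j by rewrite -tau0 tauh.
  have h3 : d <= t by apply: le_trans h1; rewrite lerDl.
  rewrite !ltNge h3 lerDl t0 /= [d + _]addrC addrK; apply: tauc.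
  by rewrite lerBrDl h1 ltrBlDl.
Qed.

Fixpoint path ws x t : H :=
  if ws is p :: ws' then
    if t < p.2 then E (level p.1) t x else path ws' (E (level p.1) p.2 x) (t - p.2)
  else E 0 t x.

Lemma path0 ws x : valid ws -> path ws x 0 = x.
Proof.
elim: ws x => [|[b d] ws IH] x /=; first by rewrite E0.
move=> /andP[d0 h]; case: ltP => hd; rewrite ?E0 //.
have -> : d = 0 by apply: le_anti; rewrite hd.
by rewrite E0 subrr IH.
Qed.

(** An interval on which the control is constant may extend over several phases of
    the sequence; the group law then glues their contributions. *)
Lemma path_step ws x s t : valid ws -> 0 <= s -> s <= t ->
  (forall r, s <= r < t -> control ws r = control ws s) ->
  path ws x t = E (control ws s) (t - s) (path ws x s).
Proof.
elim: ws x s t => [|[b d] ws IH] x s t /=; first by move=> *; rewrite -ED subrK.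
move=> /andP[d0 hv] s0 st hc.
have shift r : 0 <= r ->
    (if r + d < d then level b else control ws (r + d - d)) = control ws r.
  by move=> r0; rewrite ltNge lerDr r0 addrK.
have [sd|ds] := ltP s d.
  have [td|dt] := ltP t d; first by rewrite -ED subrK.
  have -> : E (level b) (t - s) (E (level b) s x) = E (level b) (t - d) (E (level b) d x).
    by rewrite -!ED !subrK.
  have [->|ntd] := eqVneq t d; first by rewrite subrr E0 path0.
  have dt' : d < t by rewrite lt_def ntd.
  have hcd r : 0 <= r < t - d -> control ws r = level b.
    move=> /andP[r0 rt]; have := hc (r + d); rewrite sd shift //; apply.
    by rewrite -ltrBrDr rt (le_trans (ltW sd)) // lerDr.
  rewrite (IH _ 0 (t - d)) ?subr_ge0 // => [|r hr].
    by rewrite subr0 path0 // hcd // lexx subr_gt0.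
  by rewrite !hcd // lexx subr_gt0.
have dt := le_trans ds st; rewrite [t < d]ltNge dt /=.
rewrite (IH _ (s - d) (t - d)) ?subr_ge0 ?lerB // => [|r /andP[h1 h2]].
  by congr (E _ _ _); rewrite opprB addrA subrK.
have := hc (r + d); rewrite [s < d]ltNge ds /= shift; last first.
  by rewrite (le_trans _ h1) // subr_ge0.
by apply; rewrite -lerBlDr h1 -ltrBrDr.
Qed.

Lemma run_level p x : run (E 0) (E delta) p x = E (level p.1) p.2 x.
Proof. by case: p => [[]]. Qed.

(** By induction on the sequence, with a moving initial time; phases of zero
    duration, invisible in the control, act as the identity. *)
Lemma trajectory_end ws t0 (psi : R -> H) : valid ws ->
  (forall s t, t0 <= s -> s <= t ->
     (forall r, s <= r < t -> control ws (r - t0) = control ws (s - t0)) ->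
     psi t = E (control ws (s - t0)) (t - s) (psi s)) ->
  psi (t0 + duration ws) = play (E 0) (E delta) ws (psi t0).
Proof.
elim: ws t0 => [|[b d] ws IH] t0 /=; first by rewrite /duration big_nil addr0.
move=> /andP[d0 hv] hpsi; rewrite duration_cons addrA IH //=.
  congr (play _ _ _ _); rewrite run_level /=.
  have [->|dn] := eqVneq d 0; first by rewrite addr0 E0.
  have dp : 0 < d by rewrite lt_def dn.
  rewrite (hpsi t0 (t0 + d)) ?lerDl // => [|r /andP[r1 r2]].
    by rewrite subrr dp [t0 + d]addrC addrK.
  by rewrite subrr dp ltrBlDl r2.
move=> s t hs st hc.
have shift r : t0 + d <= r -> (if r - t0 < d then level b else control ws (r - t0 - d)) =
    control ws (r - (t0 + d)).
  by move=> hr; rewrite ltNge lerBrDl hr /= opprD addrA.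
rewrite (hpsi s t) ?shift // ?(le_trans _ hs) ?lerDl // => r /andP[h1 h2].
by rewrite !shift ?(le_trans hs) // hc // h1.
Qed.

Lemma Upsilon_play ws x : valid ws ->
  Upsilon ip A B C (control ws) (duration ws) 0 x = play (E 0) (E delta) ws x.
Proof.
move=> hv; rewrite /Upsilon.
have htr : trajectory ip A B C (control ws) 0 x (path ws x).
  by split; [exact: path0|move=> s t; exact: path_step].
have [h1 h2] := @xgetI _ (fun=> x) [set psi | trajectory ip A B C (control ws) 0 x psi] _ htr.
move: (xget _ _) h1 h2 => psi h1 h2.
rewrite -[x in RHS]h1 -[duration ws]add0r; apply: trajectory_end => // s t s0 st hc.
by rewrite subr0; apply: h2 => // r /hc; rewrite !subr0.
Qed.

End control_words.

(** * The control system *)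

Section comparison.
Context {R : realType} {H : completeNormedModType R[i]}.
Context {ip : {dot H for Num.conj}}.
Hypothesis ip_norm : forall x : H, `|x| ^+ 2 = ip x x.
Context {phi : nat -> H} (phi_basis : hilbert_basis ip phi).

Lemma rnorm_comb_le (a b : nat -> R[i]) n K : 0 <= K ->
  (forall j, cmod (a j) <= K * cmod (b j)) ->
  rnorm (comb phi a n) <= K * rnorm (comb phi b n).
Proof.
move=> K0 h; rewrite -(@ler_pXn2r _ 2) ?nnegrE ?mulr_ge0 ?rnorm_ge0 //.
rewrite exprMn !(comb_sqr ip_norm phi_basis) mulr_sumr; apply: ler_sum => j _.
by rewrite -exprMn ler_pXn2r ?nnegrE ?mulr_ge0 ?cmod_ge0.
Qed.

Lemma wnorm_le_weight (w w' : nat -> R) x K M : 0 <= K ->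
  (forall j, `|w' j| <= K * `|w j|) -> wnorm_le ip phi w x M ->
  wnorm_le ip phi w' x (K * M).
Proof.
move=> K0 h hx n; apply: le_trans (ler_wpM2l K0 (hx n)).
apply: rnorm_comb_le => // j; rewrite !cmodM !cmodR mulrA.
by rewrite ler_wpM2r ?cmod_ge0.
Qed.

End comparison.

Lemma powR_le_mul (R : realType) (m x s t : R) : 0 < m -> m <= x -> s <= t ->
  x `^ s <= m `^ (s - t) * x `^ t.
Proof.
move=> m0 mx st; have x0 : 0 < x := lt_le_trans m0 mx.
have -> : x `^ s = x `^ (s - t) * x `^ t.
  by rewrite -powRD ?subrK // (gt_eqF x0) implybT.
rewrite ler_wpM2r ?powR_ge0 // -[s - t]opprB !powRN.
by rewrite lef_pV2 ?posrE ?powR_gt0 // ge0_ler_powR ?nnegrE ?subr_ge0 // ltW.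
Qed.

(** Eigenvectors evolve by phases: over n equal steps the deviation is at most n
    times the deviation over one step, which is of second order. *)
Lemma ugroup_eigen (R : realType) (H : completeNormedModType R[i])
    (ip : {dot H for Num.conj}) (T : linop H) (x : H) (l t : R) :
  (forall x : H, `|x| ^+ 2 = ip x x) -> skew_adjoint ip T ->
  dom T x -> T x = ('i * l%:C) *: x -> ugroup T t x = cis (l * t) *: x.
Proof.
move=> ip_norm T_skew hx Tx; pose D s := ugroup T s x - cis (l * s) *: x.
have Ulin s := ugroup_lin ip_norm T_skew s.
have step s h : rnorm (D (s + h)) <= rnorm (D s) + rnorm (D h).
  have -> : D (s + h) = ugroup T s (D h) + cis (l * h) *: D s.
    rewrite /D (linB (Ulin s)) (linZ (Ulin s)) scalerBr scalerA.
    by rewrite addrA subrK (ugroupD ip_norm T_skew) mulrDr cisD [cis (l * s) * _]mulrC.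
  rewrite addrC; apply: le_trans (rnormD _ _) _.
  by rewrite rnormZ cmod_cis mul1r (ugroup_isometry ip_norm T_skew).
have steps n h : rnorm (D (n%:R * h)) <= n%:R * rnorm (D h).
  elim: n => [|n IH].
    by rewrite !mul0r /D mulr0 cis0 scale1r (ugroup0 ip_norm T_skew) subrr rnorm0.
  rewrite -natr1 !mulrDl !mul1r; apply: le_trans (step _ _) _.
  by rewrite lerD2r.
pose K := 3 * (l ^+ 2 * rnorm x).
have small h : `|l * h| <= 1 -> rnorm (D h) <= h ^+ 2 * K.
  move=> lh; have hTx : dom T (T x) by rewrite Tx; exact: domZ.
  have h1 := ugroup_small2 ip_norm T_skew h (conj hx hTx).
  have -> : D h = (ugroup T h x - x - h%:C *: T x) - (cis (l * h) - 1 - 'i * (l * h)%:C) *: x.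
    rewrite /D Tx !scalerBl scale1r scalerA !opprB.
    have -> : h%:C * ('i * l%:C) = 'i * (l * h)%:C by rewrite [(l * h)%:C]realCM; ring.
    by move: (_ *: x) (cis _ *: x) (ugroup _ _ _) => u v y; rewrite addrA subrK addrA subrK.
  apply: le_trans (rnormB _ _) _; rewrite rnormZ.
  have TTx : rnorm (T (T x)) = l ^+ 2 * rnorm x.
    rewrite Tx appZ // Tx !rnormZ !cmodM cmod_i !mul1r cmodR mulrA -expr2.
    by rewrite real_normK ?num_real.
  have := ler_wpM2r (rnorm_ge0 x) (cis_expand lh).
  by rewrite TTx in h1; rewrite /K exprMn; lra.
apply/eqP; rewrite -subr_eq0 -/(D t); apply/eqP/rnorm_small => e e0.
have K0 : 0 <= K := mulr_ge0 (ler0n _ 3) (mulr_ge0 (sqr_ge0 l) (rnorm_ge0 x)).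
have tK := mulr_ge0 (sqr_ge0 t) K0.
have l1 : 0 < `|l * t| + 1 by rewrite ltr_wpDl.
have K1 : 0 < t ^+ 2 * K + 1 by exact: ltr_wpDl.
have [|n /(_ n (leqnn n))] := @inv_natr_small R
  (Num.min (`|l * t| + 1)^-1 (e / (t ^+ 2 * K + 1))).
  by rewrite lt_min invr_gt0 l1 divr_gt0.
have n0 : 0 < n.+1%:R :> R by rewrite ltr0n.
rewrite lt_min -[(_ + 1)^-1]mul1r !ltr_pdivlMr // => /andP[h1 h2].
have := steps n.+1 (t / n.+1%:R); rewrite mulrCA mulfV ?mulr1 ?lt0r_neq0 //.
move/le_trans; apply; move: h1 h2; set i := n.+1%:R^-1 => h1 h2.
have i0 : 0 < i by rewrite invr_gt0.
apply: le_trans (ler_wpM2l (ltW n0) (small _ _)) _.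
  by rewrite mulrA normrM (gtr0_norm i0); nra.
have -> : n.+1%:R * ((t * i) ^+ 2 * K) = i * (t ^+ 2 * K).
  by rewrite /i; field; rewrite lt0r_neq0.
by nra.
Qed.

Section system.
Context {R : realType} {H : completeNormedModType R[i]}.
Context {ip : {dot H for Num.conj}}.
Hypothesis ip_norm : forall x : H, `|x| ^+ 2 = ip x x.
Variables (A B C : linop H) (k : R) (lambda : nat -> R) (phi : nat -> H) (delta : R).
Hypothesis wc : WC ip A B C k lambda.
Hypothesis A_eig : eigenbasis ip A (fun j => - 'i * (lambda j)%:C) phi.
Hypothesis delta_gt0 : 0 < delta.

Let phi_basis := proj1 A_eig.
Let phi_A := proj2 A_eig.
Let T := ctrlop A B C delta (delta ^+ 2).
Let w j := lambda j `^ (k / 2).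

Local Notation coord x j := (ip x (phi j)).

Lemma lambda_le i j : (i <= j)%N -> lambda i <= lambda j.
Proof.
move=> /subnK <-; elim: (j - i)%N => [//|n IH].
by apply: le_trans IH _; rewrite addSn ltW // (WC_lambda_incr wc).
Qed.

Lemma lambda_inj : injective lambda.
Proof.
move=> i j; wlog ij : i j / (i <= j)%N.
  by move=> h; have [/h|/ltnW/h hji /esym/hji] := leqP i j.
have [//|lt] := eqVneq i j => hij.
have : (i < j)%N by rewrite ltn_neqAle lt.
by move=> /lambda_le; rewrite -hij leNgt (WC_lambda_incr wc).
Qed.

Lemma abspow_comb s a n :
  dom (abspow ip A s) (comb phi a n) /\
  abspow ip A s (comb phi a n) = comb phi (fun j => (lambda j `^ s)%:C * a j) n.
Proof.
have [hd ha] := abspow_diag ip_norm (WC_skew wc) A_eig (WC_lambda_gt0 wc) s.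
have hx := diag_dom_comb ip_norm phi_basis (fun j => lambda j `^ s) a n.
split; first by rewrite hd.
rewrite ha //; apply: (coord_ext phi_basis) => j.
rewrite coord_diag // !(coord_comb phi_basis).
by case: ifP; rewrite ?mulr0.
Qed.

Lemma w_sqr j : w j ^+ 2 = lambda j `^ k.
Proof. by rewrite /w -powR_mulrn ?powR_ge0 // -powRrM divfK. Qed.

Lemma w_gt0 j : 0 < w j.
Proof. by rewrite powR_gt0 // (WC_lambda_gt0 wc). Qed.

Lemma T_skew : skew_adjoint ip T. Proof. exact: (proj1 (WC_ctrl wc _ _)). Qed.

Lemma T_dom : dom T = dom A. Proof. exact: (proj2 (WC_ctrl wc _ _)). Qed.

Lemma T_sub x : T x - A x = delta%:C *: B x + (delta ^+ 2)%:C *: C x.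
Proof. by rewrite /= addrC addKr. Qed.

(** Only B and C contribute, the form of A against |A|^k being purely imaginary. *)
Lemma T_form : exists2 c, 0 <= c & forall (a : nat -> R[i]) n,
  `|complex.Re (ip (T (comb phi a n)) (comb phi (fun j => (w j ^+ 2)%:C * a j) n))| <=
  c * rnorm (comb phi (fun j => (w j)%:C * a j) n) ^+ 2.
Proof.
have [M hM] := WC_form wc.
have d2 : 0 < delta + delta ^+ 2 by rewrite addr_gt0 ?exprn_gt0.
exists ((delta + delta ^+ 2) * `|M|) => [|a n]; first by rewrite mulr_ge0 // ltW.
set x := comb phi a n; have [hx Ex] := abspow_comb k a n.
have -> : comb phi (fun j => (w j ^+ 2)%:C * a j) n = abspow ip A k x.
  by rewrite Ex; apply: comb_ext => j _; rewrite w_sqr.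
set y := abspow ip A k x; set N := rnorm _.
have NE : ip y x = (N ^+ 2)%:C.
  rewrite /y Ex ip_comb /N (comb_sqr ip_norm phi_basis) rmorph_sum; apply: eq_bigr => j _ /=.
  rewrite (coord_comb phi_basis) ltn_ord -w_sqr -mulrA mul_conj_cmod cmodM cmodR exprMn.
  by rewrite real_normK ?num_real // -realCM.
have ReA : complex.Re (ip y (A x)) = 0.
  rewrite /y Ex ip_comb Re_sum big1 // => j _.
  rewrite (A_comb phi_A) (coord_comb phi_basis) ltn_ord.
  have -> : (lambda j `^ k)%:C * a j * Num.conj (a j * (- 'i * (lambda j)%:C)) =
      (lambda j `^ k * cmod (a j) ^+ 2 * lambda j)%:C * 'i.
    rewrite !conjcM conjcN conjci opprK conjcr [(_ * lambda j)%:C]realCM realCM -mul_conj_cmod.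
    by ring.
  by rewrite ReZ /= mulr0.
rewrite Re_ipC; have -> : ip y (T x) =
    ip y (A x) + (delta%:C * ip y (B x) + (delta ^+ 2)%:C * ip y (C x)).
  rewrite -(subrK (A x) (T x)) T_sub addrC ipDr ipDr !ipZrR //.
rewrite ReD ReA add0r ReD !ReZ.
have [x0|xn0] := eqVneq x 0.
  rewrite x0 (app0 B) (app0 C) !ip0r /= !mulr0 addr0 normr0 mulr_ge0 ?sqr_ge0 //.
  by rewrite mulr_ge0 // ltW.
have N0 : 0 < N.
  rewrite lt_def rnorm_ge0 andbT; apply: contra_neq xn0 => /rnorm_eq0 h.
  apply: (coord_ext phi_basis) => j; rewrite (coord_comb phi_basis) ip0l.
  case: ifP => // hj; have := congr1 (fun z => coord z j) h.
  rewrite (coord_comb phi_basis) hj ip0l => /eqP.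
  rewrite mulf_eq0 => /orP[/eqP/(congr1 (@complex.Re R))/= h0|/eqP//].
  by have := w_gt0 j; rewrite h0 ltxx.
have := hM _ (ex_intro2 _ _ x (conj hx (elimN eqP xn0)) erefl).
have cN : complex.Re `|ip y x| = N ^+ 2 by rewrite -/(cmod _) NE cmodR ger0_norm ?sqr_ge0.
cbv zeta; rewrite -/y cN -mulrDl ler_pdivrMr ?exprn_gt0 //.
move: (complex.Re (ip y (B x))) (complex.Re (ip y (C x))) => b c h.
have h1 : `|b| + `|c| <= `|M| * N ^+ 2.
  by apply: le_trans h _; rewrite ler_wpM2r ?sqr_ge0 // ler_norm.
apply: le_trans (ler_normD _ _) _; rewrite !normrM !(gtr0_norm delta_gt0) -expr2.
rewrite -[leRHS]mulrA [leRHS]mulrDl; apply: lerD; rewrite ler_wpM2l ?exprn_ge0 ?(ltW delta_gt0) //;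
  by apply: le_trans h1; rewrite ?lerDl ?lerDr.
Qed.

(** As r < k and the frequencies are bounded below, |A|^(r/2) is dominated by
    |A|^(k/2). *)
Lemma T_bound : exists D, forall (a : nat -> R[i]) n M,
  rnorm (comb phi (fun j => (w j)%:C * a j) n) <= M ->
  rnorm (T (comb phi a n) - A (comb phi a n)) <= D * M.
Proof.
have [d [r [d0 r0 rk hBC]]] := WC_bound wc.
pose m := lambda 0%N `^ (r / 2 - k / 2); have m0 : 0 <= m by exact: powR_ge0.
have dd : 0 <= delta + delta ^+ 2 by rewrite addr_ge0 ?exprn_ge0 // ltW.
exists ((delta + delta ^+ 2) * (d * m)) => a n M hM; set x := comb phi a n.
have [hx Ex] := abspow_comb (r / 2) a n; have [_ _ hB hC] := hBC x hx.
have hs : sobolev_norm ip A (r / 2) x <= m * M.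
  rewrite /sobolev_norm Ex; apply: le_trans (ler_wpM2l m0 hM).
  apply: (rnorm_comb_le ip_norm phi_basis) => // j; rewrite !cmodM !cmodR mulrA.
  rewrite ler_wpM2r ?cmod_ge0 // !ger0_norm ?powR_ge0 //.
  apply: powR_le_mul; [exact: (WC_lambda_gt0 wc)|exact: lambda_le|].
  by rewrite ler_pM2r // ltW.
have hs' := ler_wpM2l (ltW d0) hs.
rewrite T_sub; apply: le_trans (rnormD _ _) _; rewrite !rnormZr.
rewrite (gtr0_norm delta_gt0) (gtr0_norm (exprn_gt0 2 delta_gt0)).
rewrite -[leRHS]mulrA [leRHS]mulrDl; apply: lerD; rewrite ler_wpM2l ?exprn_ge0 ?(ltW delta_gt0) //.
- by apply: le_trans hB _; rewrite -mulrA.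
- by apply: le_trans hC _; rewrite -mulrA.
Qed.


(** Outside their domains B and C have arbitrary values, but here with factor 0. *)
Lemma ctrlop0 : ctrlop A B C 0 (0 ^+ 2) = A.
Proof.
have [_ hd] := WC_ctrl wc 0 (0 ^+ 2).
have ha : app (ctrlop A B C 0 (0 ^+ 2)) = app A.
  by apply/funext => x; rewrite /= expr0n /= !scale0r !addr0.
move: hd ha; case: (ctrlop _ _ _ _ _) => d a z p q; case: A => d' a' z' p' q' /= hd ha.
by subst d' a'; congr Linop; exact: Prop_irrelevance.
Qed.

Local Notation F := (ugroup A).
Local Notation V := (ugroup T).
Local Notation wle := (wnorm_le ip phi w).

Lemma F_coord t x j : coord (F t x) j = cis (- lambda j * t) * coord x j.
Proof.
have As := WC_skew wc; have uA := ugroup_unitary ip_norm As.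
have -> : phi j = F t (F (- t) (phi j)).
  by rewrite -(ugroupD ip_norm As) subrr (ugroup0 ip_norm As).
rewrite (ug_isometry uA) -(ugroupD ip_norm As) subrr (ugroup0 ip_norm As).
have [hd hA] := phi_A j.
rewrite (@ugroup_eigen _ _ ip A (phi j) (- lambda j)) //; last by rewrite hA realCN mulrN mulNr.
by rewrite ipZr cis_conj mulNr mulrN opprK mulNr.
Qed.

Lemma T_coord n m : n != m -> coord (T (phi n)) m =
  delta%:C * Num.conj (ip (phi m) (B (phi n) + delta%:C *: C (phi n))).
Proof.
move=> nm; rewrite -[T (phi n)](subrK (A (phi n))) T_sub addrC ipDl.
have [_ ->] := phi_A n; rewrite ipZl (ip_phi phi_basis) (negbTE nm) mulr0 add0r.
by rewrite -ipC !ipDl !ipZl mulrDr mulrA -realCM.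
Qed.

Lemma T_phi_skew n m : coord (T (phi n)) m = - Num.conj (coord (T (phi m)) n).
Proof.
have hd i : dom T (phi i) by rewrite T_dom; exact: (proj1 (phi_A i)).
by rewrite (skew_ip T_skew) // ipC.
Qed.

(** By weak nondegeneracy, among the entries of T attached to the levels j or l, only
    the coupling between them has their gap. A step from a level to itself is
    void. *)
Lemma reachable_transition j l :
  weakly_nondegenerate_transition ip lambda phi (addop B (scaleop delta%:C C)) (zeroop H) (j, l) ->
  ip (phi l) (B (phi j) + delta%:C *: C (phi j)) != 0 ->
  reachable ip phi w F V j l.
Proof.
move=> [_ hnd] hb; have [->|jl] := eqVneq j l; first exact: reachable_refl.
have [c c0 hc] := T_form; have [D hD] := T_bound.
move=> e e0; have c2 : 0 <= 2 * c by rewrite mulr_ge0.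
apply: (transition ip_norm phi_basis (w := w) (lambda := lambda) (F := F) (V := V)
  (G := fun n => T (phi n)) c2) => //.
- exact: F_coord.
- exact: (ugroup_lin ip_norm T_skew).
- by move=> t x M; exact: (ugroup_wle ip_norm phi_basis phi_A T_skew T_dom c0 hc hD).
- by move=> x M e'; exact: (ugroup_cont ip_norm phi_basis phi_A T_skew T_dom c0 hc hD).
- by move=> n e'; exact: (ugroup_phi_expand ip_norm phi_basis phi_A T_skew T_dom c0 hc hD).
- exact: (T_phi_wle ip_norm phi_basis phi_A T_skew T_dom c0 hc).
- exact: T_phi_skew.
- exact: lambda_inj.
- move=> n m hn hm hg.
  have nm : n != m by apply: contraNneq hm => <-.
  have [E|E|E] := hnd m n (etrans (esym hg) (distrC _ _)).
  + have : [set j; l] m by rewrite E; left.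
    by move: hm; rewrite !inE => /norP[/eqP h1 /eqP h2] [].
  + rewrite T_coord //; move: E => /=; rewrite ip0r normr0 addr0 => /eqP.
    by rewrite normr_eq0 => /eqP ->; rewrite conjC0 mulr0.
  + have : ([set m; n] `&` [set j; l]) n.
      by split; [right|move: hn; rewrite !inE => /orP[/eqP ->|/eqP ->]; [left|right]].
    by rewrite E.
- rewrite T_coord // mulf_neq0 //.
    by apply: contraTneq delta_gt0 => /(congr1 (@complex.Re R)) /= ->; rewrite ltxx.
  by rewrite conjC_eq0.
Qed.

Lemma reachable_chain S : weakly_nondegenerate_chain ip lambda phi
    (addop B (scaleop delta%:C C)) (zeroop H) S ->
  forall p q, reachable ip phi w F V p q.
Proof.
move=> [[al hch] hnd] p q; have [h [s [hS hp hq hl hip]]] := hch p q.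
have step l : (l <= h)%N -> reachable ip phi w F V (s l).1 (s l).2.
  move=> hlh; apply: reachable_transition; first by rewrite -surjective_pairing; apply/hnd/hS.
  by have := hip l hlh; rewrite /= scaler0 addr0.
have [c c0 hc] := T_form; have [D hD] := T_bound.
have trans := reachable_trans ip_norm phi_basis F_coord (ugroup_lin ip_norm T_skew)
  (fun t x M => @ugroup_wle _ _ _ ip_norm _ _ _ _ phi_basis phi_A T_skew T_dom _ _ _ c0 hc hD t x M).
rewrite -hp -hq; suff : forall l, (l <= h)%N -> reachable ip phi w F V (s 0%N).1 (s l).2 by exact.
elim=> [|l IH] hlh; first exact: step.
by apply: trans (IH (ltnW hlh)) _; rewrite hl //; exact: step.
Qed.

(** The frequencies are bounded below by m <= 1, which bounds the powers of negative
    exponent r - k / 2 uniformly in r. *)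
Lemma sobolev_norm_le (r0 : R) : exists2 K, 0 < K & forall r x M,
  r0 <= r -> r < k / 2 -> wle x M ->
  dom (abspow ip A r) x /\ sobolev_norm ip A r x <= K * M.
Proof.
pose m := Num.min 1 (lambda 0%N).
have m0 : 0 < m by rewrite lt_min ltr01 (WC_lambda_gt0 wc).
exists (m `^ (r0 - k / 2)) => [|r x M h0 hr hx]; first exact: powR_gt0.
have M0 := wnorm_le_ge0 hx.
have hK : wnorm_le ip phi (fun j => lambda j `^ r) x (m `^ (r0 - k / 2) * M).
  apply: (wnorm_le_weight ip_norm phi_basis _ _ hx); first exact: powR_ge0.
  move=> j; rewrite !ger0_norm ?powR_ge0 //.
  apply: le_trans (@powR_le_mul _ m (lambda j) r (k / 2) m0 _ (ltW hr)) _.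
    by rewrite ge_min lambda_le ?orbT.
  rewrite ler_wpM2r ?powR_ge0 //.
  rewrite -[r - _]opprB -[r0 - _]opprB !powRN lef_pV2 ?posrE ?powR_gt0 //.
  by rewrite ger_powR ?m0 ?ge_min ?lexx // lerB.
have [hd ha] := abspow_diag ip_norm (WC_skew wc) A_eig (WC_lambda_gt0 wc) r.
have hdx : diag_dom ip phi (fun j => lambda j `^ r) x by exists (m `^ (r0 - k / 2) * M).
split; first by rewrite hd.
by rewrite /sobolev_norm ha //; apply/(rnorm_diag_le ip_norm phi_basis) => //; rewrite mulr_ge0 ?powR_ge0.
Qed.

End system.

Theorem theorem3 (R : realType) (H : completeNormedModType R[i])
    (ip : {dot H for Num.conj})
    (A B C : linop H) (k : R) (lambda : nat -> R) (phi : nat -> H)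
    (S : set (nat * nat)) (delta : R)
    (hH : separable_hilbert ip)
    (hWC : WC ip A B C k lambda)
    (hphi : eigenbasis ip A (fun j => - 'i * (lambda j)%:C) phi)
    (hk : 1 <= k)
    (hdelta : 0 < delta)
    (hS : weakly_nondegenerate_chain ip lambda phi
            (addop B (scaleop delta%:C C)) (zeroop H) S) :
  forall (eps : R) (p q : nat) (r0 : R), 0 < eps ->
  exists (T : R) (u : R -> R),
    [/\ 0 < T,
        piecewise_constant u,
        forall t, 0 <= t <= T -> u t = 0 \/ u t = delta &
        forall r : R, r0 <= r -> r < k / 2 ->
          dom (abspow ip A r) (Upsilon ip A B C u T 0 (phi p) - phi q) /\
          sobolev_norm ip A r (Upsilon ip A B C u T 0 (phi p) - phi q) < eps].
Proof.
move=> eps p q r0 eps0; have ip_norm := hH.1; have phi_basis := hphi.1.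
have [K K0 hK] := sobolev_norm_le ip_norm hWC hphi r0.
have e0 : 0 < eps / 2 / K by rewrite !divr_gt0.
have hr := reachable_chain ip_norm hWC hphi hdelta hS p q.
have [ws [t [hv t0 hw]]] := reachable_exact ip_norm phi_basis
  (F_coord ip_norm hWC hphi) e0 (WC_lambda_gt0 hWC q) hr.
pose W := rcons ws (false, t).
have hW : valid W by rewrite /valid all_rcons /= ltW.
have skew v : skew_adjoint ip (ctrlop A B C v (v ^+ 2)) by exact: (proj1 (WC_ctrl hWC _ _)).
have U : Upsilon ip A B C (control delta W) (duration W) 0 (phi p) =
    play (ugroup A) (ugroup (ctrlop A B C delta (delta ^+ 2))) W (phi p).
  rewrite Upsilon_play //.
  - congr (play _ _ _ _); apply/funext => s; apply/funext => x; rewrite expgroupE //.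
    by rewrite (ctrlop0 hWC).
  - by move=> v x; rewrite (expgroupE ip_norm (skew v)) (ugroup0 ip_norm (skew v)).
  - by move=> v s s' x; rewrite !(expgroupE ip_norm (skew v)) (ugroupD ip_norm (skew v)).
exists (duration W), (control delta W); split.
- rewrite /duration /W -cats1 big_cat big_seq1 /= ltr_wpDl //.
  exact: (duration_ge0 hv).
- exact: control_piecewise_constant.
- by move=> s _; exact: control_values.
- move=> r h0 hrk; rewrite U; have [h1 h2] := hK r _ _ h0 hrk hw; split=> //.
  apply: le_lt_trans h2 _; rewrite mulrC divfK ?lt0r_neq0 //.
  by rewrite ltr_pdivrMr // ltr_pMr // ltr1n.
Qed.
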